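(* Suppose that $d\geq 2$ and that $\operatorname{char}(\mathbf{k})=p>0$. Then \[ \sum_{j\geq 0}h^j_{st}(-d,d)\cdot t^j = \sum_{\underline{a}\in A_{p,d}} t^{|\underline{a}|_p}.\]
   Context: $\mathbf{k}$ is an algebraically closed field. $Fl_n$ is the variety of complete flags $0\subset V_1\subset\cdots\subset V_{n-1}\subset V_n=\mathbf{k}^n$, $\dim V_i=i$. For $\lambda\in\mathbb{Z}^n$, $\mathcal{O}_{Fl_n}(\lambda)=\bigotimes_{i=1}^n (\mathcal{V}_{n+1-i}/\mathcal{V}_{n-i})^{\otimes\lambda_i}$, where $\mathcal{V}_i$ is the tautological rank $i$ subbundle of $\mathbf{k}^n\otimes\mathcal{O}_{Fl_n}$ (so that $H^0(Fl_n,\mathcal{O}_{Fl_n}(d,0,\dots,0))=\operatorname{Sym}^d(\mathbf{k}^n)$). For $\lambda\in\mathbb{Z}^r$ with $\lambda_1+\cdots+\lambda_r=0$, the group $H^j(Fl_n,\mathcal{O}_{Fl_n}(\lambda_1,\dots,\lambda_r,0,\dots,0))$ is, for $n\gg 0$, a finite dimensional vector space with trivial $\operatorname{GL}_n$-action, independent of $n$; it is called the stable cohomology $H^j_{st}(\lambda)$, and $h^j_{st}(\lambda)$ is its dimension. For a non-negative integer $m\equiv 0,1 \pmod p$, write $m=pa+b$ with $b\in\{0,1\}$, and define the $p$-index $|m|_p=2a+b$. Let $A_{p,d}$ be the set of tuples $\underline{a}=(a_0,\dots,a_k)$ of integers $a_i\ge 0$ with $a_i\equiv 0,1\pmod p$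 for all $i$ and $\sum_{i=0}^k a_i p^i=d$, where $k$ is arbitrary and tuples differing only by trailing zeros are identified. For such a tuple, $|\underline{a}|_p=\sum_{i=0}^k|a_i|_p$. *)

(* Defs.v *)
From HB Require Import structures.
From mathcomp Require Import all_boot all_order all_algebra.
From mathcomp Require Import boolp classical_sets functions fsbigop.
From mathcomp Require Import topology_structure.
(* Importing the notations of mpoly would clash with those above. *)
From mathcomp Require Import (canonicals) mpoly.

Set Implicit Arguments.
Unset Strict Implicit.
Unset Printing Implicit Defensive.

Import GRing.Theory.
Local Open Scope classical_set_scope.
Local Open Scope ring_scope.

Record opens (X : topologicalType) := Opens {
  oset :> set X;
  oset_open : open oset }.

Definition whole (X : topologicalType) : opens X := Opens openT.

Record sheaf (k : fieldType) (X : topologicalType) := Sheaf {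
  sec :> opens X -> lmodType k;
  res : forall U V : opens X, V `<=` U -> {linear sec U -> sec V};
  res_id : forall (U : opens X) (h : U `<=` U) (s : sec U), res h s = s;
  res_comp : forall (U V W : opens X) (hVU : V `<=` U) (hWV : W `<=` V)
      (hWU : W `<=` U) (s : sec U),
    res hWV (res hVU s) = res hWU s;
  sheaf_separated : forall (U : opens X) (I : Type) (W : I -> opens X)
      (hW : forall i, W i `<=` U),
    U `<=` \bigcup_i W i ->
    forall s : sec U, (forall i, res (hW i) s = 0) -> s = 0;
  sheaf_glue : forall (U : opens X) (I : Type) (W : I -> opens X)
      (hW : forall i, W i `<=` U),
    U `<=` \bigcup_i W i ->
    forall s : (forall i, sec (W i)),
    (forall i j (O : opens X) (hi : O `<=` W i) (hj : O `<=` W j),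
       res hi (s i) = res hj (s j)) ->
    exists t : sec U, forall i, res (hW i) t = s i }.

Arguments res {k X} F [U V] h : rename.

Record sheaf_hom (k : fieldType) (X : topologicalType) (F G : sheaf k X) :=
  SheafHom {
    shom :> forall U : opens X, {linear F U -> G U};
    shom_res : forall (U V : opens X) (h : V `<=` U) (s : F U),
      shom V (res F h s) = res G h (shom U s) }.

(* Kernels of sheaf morphisms are computed on sections, so this is exactly
   the condition of having zero kernel. *)
Definition sheaf_mono (k : fieldType) (X : topologicalType) (F G : sheaf k X)
    (m : sheaf_hom F G) : Prop :=
  forall U : opens X, injective (m U).

Definition injective_sheaf (k : fieldType) (X : topologicalType)
    (I : sheaf k X) : Prop :=
  forall (A B : sheaf k X) (m : sheaf_hom A B), sheaf_mono m ->
  forall f : sheaf_hom A I, exists g : sheaf_hom B I,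
  forall (U : opens X) (s : A U), g U (m U s) = f U s.

(* The image sheaf: [s] is in it when it lifts along [f] locally, but not
   necessarily over the whole of [U]. *)
Definition in_image (k : fieldType) (X : topologicalType) (F G : sheaf k X)
    (f : sheaf_hom F G) (U : opens X) (s : G U) : Prop :=
  forall x : X, oset U x -> exists (V : opens X) (h : V `<=` U),
    oset V x /\ exists t : F V, f V t = res G h s.

Record injective_resolution (k : fieldType) (X : topologicalType)
    (F : sheaf k X) := InjectiveResolution {
  rterm :> nat -> sheaf k X;
  rdiff : forall j, sheaf_hom (rterm j) (rterm j.+1);
  raug : sheaf_hom F (rterm 0);
  rterm_injective : forall j, injective_sheaf (rterm j);
  raug_mono : sheaf_mono raug;
  rexact0 : forall (U : opens X) (s : rterm 0 U),
    rdiff 0 U s = 0 <-> in_image raug s;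
  rexactS : forall j (U : opens X) (s : rterm j.+1 U),
    rdiff j.+1 U s = 0 <-> in_image (rdiff j) s }.

Section Cohomology.
Variables (k : fieldType) (X : topologicalType) (F : sheaf k X).
Variable R : injective_resolution F.

Definition cocycles (j : nat) : set (R j (whole X)) :=
  [set z | rdiff R j (whole X) z = 0].

Definition coboundaries (j : nat) : set (R j (whole X)) :=
  match j return set (R j (whole X)) with
  | 0%N => [set 0]
  | j'.+1 => range (rdiff R j' (whole X))
  end.

End Cohomology.

(* dim_k H^j(X, F) = h : the classes of b_0, ..., b_(h-1) form a basis of
   cocycles / coboundaries. In particular H^j is finite dimensional. *)
Definition cohomology_dim (k : fieldType) (X : topologicalType)
    (F : sheaf k X) (j h : nat) : Prop :=
  exists (R : injective_resolution F) (b : 'I_h -> R j (whole X)),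
    (forall i, cocycles (b i)) /\
    forall z : R j (whole X), cocycles z ->
      exists! c : 'rV[k]_h, coboundaries (z - \sum_(i < h) c 0 i *: b i).

Section Flag.
Variables (k : closedFieldType) (n : nat).

Definition is_flag (V : {ffun 'I_n.+1 -> {vspace 'rV[k]_n}}) : bool :=
  [forall i : 'I_n.+1, \dim (V i) == i] &&
  [forall i : 'I_n.+1, forall j : 'I_n.+1, (i <= j)%N ==> (V i <= V j)%VS].

Record flag := Flag {
  flag_val :> {ffun 'I_n.+1 -> {vspace 'rV[k]_n}};
  flagP : is_flag flag_val }.

HB.instance Definition _ := [isSub for flag_val].
HB.instance Definition _ := [Choice of flag by <:].

(* The rows v_0, ..., v_(n-1) of g form a basis of k^n such that, for all i,
   v_0, ..., v_(i-1) is a basis of V_i. *)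
Definition adapted (V : flag) (g : 'M[k]_n) : Prop :=
  g \in unitmx /\
  forall (i : 'I_n.+1) (j : 'I_n), (j < i)%N -> row j g \in V i.

Lemma adapted_span (V : flag) (g : 'M[k]_n) (i : 'I_n.+1) : adapted V g ->
  V i = <<take i [seq row j g | j <- enum 'I_n]>>%VS.
Proof.
move=> [ug Vg]; set r := [seq _ | _ <- _].
have sz : size r = n by rewrite size_map size_enum_ord.
have fr : free r.
  have dT : \dim {:'rV[k]_n} = n by rewrite dimvf; exact: mul1n.
  apply: (@basis_free _ _ fullv); rewrite basisEdim sz dT.
  rewrite leqnn andbT; apply/subvP => u _; rewrite -[u](mulmxKV ug).
  rewrite mulmx_sum_row; apply: memv_suml => j _; rewrite memvZ // memv_span //.
  by apply: map_f; rewrite mem_enum.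
have ft : free (take i r).
  by move: fr; rewrite -{1}(cat_take_drop i r) => /catl_free.
have /andP[/forallP/(_ i)/eqP dV _] := flagP V.
apply/esym/eqP; rewrite eqEdim dV (eqnP ft) size_take sz.
apply/andP; split; last by case: ltnP => // _; rewrite -ltnS.
apply/span_subvP => u; rewrite -map_take => /mapP[j jt ->]; apply: Vg.
move: jt; rewrite -(mem_map val_inj) map_take val_enum_ord take_iota.
rewrite mem_iota add0n.
by move=> /= ji; rewrite (leq_trans ji) // geq_minl.
Qed.

Lemma adapted_inj (V V' : flag) (g : 'M[k]_n) :
  adapted V g -> adapted V' g -> V = V'.
Proof.
move=> Vg V'g; apply: val_inj; apply/ffunP => i /=.
by rewrite (adapted_span i Vg) (adapted_span i V'g).
Qed.

Definition mx_eval (P : mpoly.mpoly (n * n) k) (g : 'M[k]_n) : k :=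
  mpoly.meval (fun i => mxvec g 0 i) P.

(* The map sending g to the flag it is adapted to identifies the set of flags
   with the quotient of GL_n by the lower triangular matrices acting on the
   left. The Zariski topology is the quotient topology: a set of flags is open
   when its preimage in GL_n is a union of sets {Q <> 0}, Q polynomial. *)
Definition zariski_open (U : set flag) : Prop :=
  forall (V : flag) (g : 'M[k]_n), U V -> adapted V g ->
  exists Q : mpoly.mpoly (n * n) k, mx_eval Q g != 0 /\
    forall (V' : flag) (g' : 'M[k]_n),
      adapted V' g' -> mx_eval Q g' != 0 -> U V'.

Lemma mx_evalM (P Q : mpoly.mpoly (n * n) k) g :
  mx_eval (P * Q) g = mx_eval P g * mx_eval Q g.
Proof. exact: mpoly.mevalM. Qed.

Lemma mx_evalD (P Q : mpoly.mpoly (n * n) k) g :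
  mx_eval (P + Q) g = mx_eval P g + mx_eval Q g.
Proof. exact: mpoly.mevalD. Qed.

Lemma mx_evalC c g : mx_eval (mpoly.mpolyC _ c) g = c.
Proof. exact: mpoly.mevalC. Qed.

Lemma zariski_openT : zariski_open setT.
Proof.
move=> V g _ _; exists (mpoly.mpolyC _ 1); split=> //.
by rewrite mx_evalC oner_neq0.
Qed.

Lemma zariski_openI : setI_closed zariski_open.
Proof.
move=> A B oA oB V g [AV BV] Vg.
have [P [Pg PA]] := oA V g AV Vg; have [Q [Qg QB]] := oB V g BV Vg.
exists (P * Q); split; first by rewrite mx_evalM mulf_neq0.
move=> V' g' Vg'; rewrite mx_evalM mulf_eq0 negb_or => /andP[Pg' Qg'].
by split; [exact: PA Vg' Pg' | exact: QB Vg' Qg'].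
Qed.

Lemma zariski_open_bigU (I : Type) (f : I -> set flag) :
  (forall i, zariski_open (f i)) -> zariski_open (\bigcup_i f i).
Proof.
move=> of_ V g [i _ fiV] Vg; have [Q [Qg Qf]] := of_ i V g fiV Vg.
by exists Q; split=> // V' g' Vg' Qg'; exists i => //; exact: Qf Vg' Qg'.
Qed.

HB.instance Definition _ := isOpenTopological.Build flag
  zariski_openT zariski_openI zariski_open_bigU.

End Flag.

Section LineBundle.
Variables (k : closedFieldType) (n : nat) (lambda : seq int).

Implicit Types (U : opens (flag k n)) (f : 'M[k]_n -> k).

(* For g adapted to V, with rows v_0, ..., v_(n-1), the fibre at V of
     O(lambda) = (x)_(i < n) (V_(n-i) / V_(n-i-1))^(lambda_i)
   (lambda_i counted from 0, and lambda extended by zeros) is spanned by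
   (x)_i [v_(n-i-1)]^(lambda_i). A section over U is given by its coordinate f
   in these bases: f is a regular function of the frames g adapted to a flag
   in U, and replacing g by b *m g with b lower triangular replaces v_i by
   b_ii v_i modulo V_i. Off these frames f is set to 0, so that a section
   determines f. *)

Definition over U (g : 'M[k]_n) : Prop := exists2 V : flag k n, oset U V & adapted V g.

Lemma over_mul U (b g : 'M[k]_n) : b \in unitmx -> is_trig_mx b ->
  over U g -> over U (b *m g).
Proof.
move=> ub tb [V UV [ug Vg]]; exists V => //; split.
  by rewrite unitmx_mul ub ug.
move=> i j ji; rewrite row_mul mulmx_sum_row; apply: memv_suml => l _.
rewrite mxE; have [jl|lj] := ltnP j l.
  by rewrite (is_trig_mxP tb) // scale0r mem0v.
by rewrite memvZ // Vg // (leq_ltn_trans lj).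
Qed.

Definition regular_over U f : Prop :=
  forall g, over U g -> exists P Q : mpoly.mpoly (n * n) k,
    mx_eval Q g != 0 /\
    forall g', over U g' -> mx_eval Q g' != 0 ->
      f g' = mx_eval P g' / mx_eval Q g'.

Definition equivariant_over U f : Prop :=
  forall b g : 'M[k]_n, b \in unitmx -> is_trig_mx b -> over U g ->
    f (b *m g) = \prod_(i < n) b (rev_ord i) (rev_ord i) ^ (- lambda`_i) * f g.

Definition is_section U f : Prop :=
  [/\ regular_over U f, equivariant_over U f & forall g, ~ over U g -> f g = 0].

Definition section_pred U : {pred 'M[k]_n -> k^o} :=
  [pred f | `[< is_section U f >]].

Fact section_pred_submod U : submod_closed (section_pred U).
Proof.
split=> [|a f h].
  apply/asboolP; split=> [g _|b g _ _ _|//]; last by rewrite /= mulr0.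
  exists (mpoly.mpolyC _ 0), (mpoly.mpolyC _ 1); rewrite mx_evalC oner_neq0.
  by split=> // g' _ _; rewrite !mx_evalC mul0r.
move=> /asboolP[rf ef zf] /asboolP[rh eh zh]; apply/asboolP; split.
- move=> g Ug; have [P [Q [Qg fE]]] := rf g Ug.
  have [P' [Q' [Qg' hE]]] := rh g Ug.
  exists (mpoly.mpolyC _ a * P * Q' + P' * Q), (Q * Q').
  split=> [|g' Ug']; first by rewrite mx_evalM mulf_neq0.
  rewrite mx_evalM mulf_eq0 negb_or => /andP[q q'].
  rewrite mx_evalD !mx_evalM mx_evalC.
  have -> : (a *: f + h) g' = a * f g' + h g' by [].
  by rewrite fE // hE // mulrA addf_div.
- move=> b g ub tb Ug.
  have E g' : (a *: f + h) g' = a * f g' + h g' by [].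
  by rewrite !E ef // eh // mulrDr mulrCA.
- move=> g Ug; have -> : (a *: f + h) g = a * f g + h g by [].
  by rewrite zf // zh // mulr0 addr0.
Qed.

HB.instance Definition _ U :=
  GRing.isSubmodClosed.Build k ('M[k]_n -> k^o) (section_pred U)
    (section_pred_submod U).

Record sections U := Sections {
  section_val :> 'M[k]_n -> k^o;
  section_valP : section_val \in section_pred U }.

HB.instance Definition _ U := [isSub for @section_val U].
HB.instance Definition _ U := [Choice of sections U by <:].
HB.instance Definition _ U := [SubChoice_isSubLmodule of sections U by <:].


Section Restriction.
Variables (U W : opens (flag k n)) (hWU : W `<=` U).

Definition restrict (f : 'M[k]_n -> k) (g : 'M[k]_n) : k :=
  if `[< over W g >] then f g else 0.

Lemma over_sub g : over W g -> over U g.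
Proof. by move=> [V WV Vg]; exists V => //; exact: hWU. Qed.

Fact restrict_subproof (s : sections U) : restrict s \in section_pred W.
Proof.
have /asboolP[rs es zs] := section_valP s; apply/asboolP; split.
- move=> g Wg; have [P [Q [Qg sE]]] := rs g (over_sub Wg).
  exists P, Q; split=> // g' Wg' Qg'; rewrite /restrict asboolT //.
  by apply: sE => //; exact: over_sub.
- move=> b g ub tb Wg; rewrite /restrict !asboolT //; last exact: over_mul.
  by apply: es => //; exact: over_sub.
- by move=> g Wg; rewrite /restrict asboolF.
Qed.

Definition section_res (s : sections U) : sections W :=
  Sections (restrict_subproof s).

Fact section_res_linear : linear section_res.
Proof.
move=> a s t; apply: val_inj; apply/funext => g.
change (restrict (a *: section_val s + section_val t) g =
  a * restrict s g + restrict t g).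
by rewrite /restrict; case: asboolP => // _; rewrite mulr0 addr0.
Qed.

HB.instance Definition _ :=
  GRing.isLinear.Build k (sections U) (sections W) _ section_res
    section_res_linear.

End Restriction.

Lemma line_bundle_res_id U (h : U `<=` U) (s : sections U) :
  section_res h s = s.
Proof.
apply: val_inj; apply/funext => g; rewrite /= /restrict; case: asboolP => // Ug.
by have /asboolP[_ _ ->] := section_valP s.
Qed.

Lemma line_bundle_res_comp (U V W : opens (flag k n))
    (hVU : V `<=` U) (hWV : W `<=` V) (hWU : W `<=` U) (s : sections U) :
  section_res hWV (section_res hVU s) = section_res hWU s.
Proof.
apply: val_inj; apply/funext => g; rewrite /= /restrict; case: asboolP => // Wg.
by rewrite asboolT //; exact: (over_sub hWV).
Qed.

Lemma over_bigcup U (I : Type) (W : I -> opens (flag k n)) g :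
  U `<=` \bigcup_i W i -> over U g -> exists i, over (W i) g.
Proof. by move=> UW [V /UW[i _ WiV] Vg]; exists i, V. Qed.

Lemma line_bundle_separated U (I : Type) (W : I -> opens (flag k n))
    (hW : forall i, W i `<=` U) :
  U `<=` \bigcup_i W i ->
  forall s : sections U, (forall i, section_res (hW i) s = 0) -> s = 0.
Proof.
move=> UW s s0; apply: val_inj; apply/funext => g; rewrite linear0 /=.
have /asboolP[_ _ zs] := section_valP s.
have [Ug|/zs//] := pselect (over U g).
have [i Wig] := over_bigcup UW Ug.
have /(congr1 (fun t => val t g)) := s0 i.
by rewrite linear0 /= /restrict asboolT.
Qed.

Lemma line_bundle_glue U (I : Type) (W : I -> opens (flag k n))
    (hW : forall i, W i `<=` U) :
  U `<=` \bigcup_i W i ->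
  forall s : (forall i, sections (W i)),
  (forall i j (O : opens (flag k n)) (hi : O `<=` W i) (hj : O `<=` W j),
     section_res hi (s i) = section_res hj (s j)) ->
  exists t : sections U, forall i, section_res (hW i) t = s i.
Proof.
move=> UW s sE.
have sEg i j g : over (W i) g -> over (W j) g -> s i g = s j g.
  move=> [V WiV Vg] [V' WjV' V'g].
  have VV' := adapted_inj V'g Vg; rewrite VV' in WjV'.
  pose O := Opens (openI (oset_open (W i)) (oset_open (W j))).
  have hi : O `<=` W i by move=> x [].
  have hj : O `<=` W j by move=> x [].
  have /(congr1 (fun t => val t g)) := sE i j O hi hj.
  by rewrite /= /restrict asboolT //; exists V.
pose t g := if pselect (over U g) is left Ug
            then s (projT1 (cid (over_bigcup UW Ug))) g else 0.
have tE i g : over (W i) g -> t g = s i g.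
  move=> Wig; rewrite /t; case: pselect => [Ug|]; last first.
    by case; exact: (over_sub (hW i)).
  by case: cid => j Wjg /=; exact: sEg.
have t_section : t \in section_pred U.
  apply/asboolP; split.
  - move=> g Ug; have [i Wig] := over_bigcup UW Ug.
    have /asboolP[rs _ _] := section_valP (s i).
    have [P [Q [Qg siE]]] := rs g Wig.
    have [V WiV Vg] := Wig.
    have [Q0 [Q0g WiQ0]] := (oset_open (W i) : zariski_open _) V g WiV Vg.
    exists (P * Q0), (Q * Q0); split; first by rewrite mx_evalM mulf_neq0.
    move=> g' [V' UV' V'g']; rewrite mx_evalM mulf_eq0 negb_or => /andP[Qg' Q0g'].
    have Wig' : over (W i) g' by exists V' => //; exact: WiQ0 V'g' Q0g'.
    by rewrite (tE i) // siE // mx_evalM -mulf_div divff // mulr1.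
  - move=> b g ub tb Ug; have [i Wig] := over_bigcup UW Ug.
    have /asboolP[_ es _] := section_valP (s i).
    by rewrite !(tE i) ?es //; exact: over_mul.
  - by move=> g Ug; rewrite /t; case: pselect.
exists (Sections t_section) => i; apply: val_inj; apply/funext => g.
rewrite /= /restrict; case: asboolP => [Wig|Wig]; first exact: tE.
by have /asboolP[_ _ ->] := section_valP (s i).
Qed.

Definition line_bundle : sheaf k (flag k n) :=
  @Sheaf k (flag k n) (fun U => sections U)
    (fun U V h => section_res h)
    line_bundle_res_id line_bundle_res_comp line_bundle_separated
    line_bundle_glue.

End LineBundle.

(* H^j(Fl_n, O(lambda_1, ..., lambda_r, 0, ..., 0)) has dimension h for n >> 0. *)
Definition stable_cohomology_dim (k : closedFieldType) (lambda : seq int)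
    (j h : nat) : Prop :=
  exists N : nat, forall n, (N <= n)%N ->
    cohomology_dim (line_bundle k n lambda) j h.

Definition p_index (p m : nat) : nat := (2 * (m %/ p) + m %% p)%N.

Definition tuple_index (p : nat) (a : seq nat) : nat :=
  (\sum_(m <- a) p_index p m)%N.

(* Tuples up to trailing zeros are represented by the sequences without
   trailing zeros; the empty sequence, which stands for the zero tuple,
   satisfies the last condition. *)
Definition A_set (p d : nat) : set (seq nat) :=
  [set a : seq nat |
    [/\ forall m, m \in a -> (m = 0 %[mod p] \/ m = 1 %[mod p])%N,
        (\sum_(i < size a) nth 0%N a i * p ^ i)%N = d
      & last 1%N a != 0%N]].

(* Main.v *)
(* Let x and y be the first two rows of coordinates of a frame of a flag, and
   let L = O(-d, d, 0, ..., 0). Over the locus where x_j <> 0 for all j in s,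
   s nonempty, the sections of L are the functions F(x, y), Laurent in x with
   poles only along s and polynomial in y, of bidegree (-d, d), which are
   invariant under y -> y + c x; and L is acyclic there. Both facts descend
   from the big cells of the flag variety, where acyclicity follows from the
   Nullstellensatz by Cartan's argument: Gaussian elimination of one more row
   gives a cover whose Cech complex consists of Laurent polynomials, and splits
   monomial by monomial.

   Invariance under y -> y + c x means the vanishing of the Hasse derivatives
   D^(p^l) of c |-> F(x, y + c x). For each l, D^(p^l) and D^((p-1)p^l)
   alternate in a complex which is exact except at its start, because they act
   as shifts on the l-th digit of the exponents; the tensor product over l of
   these complexes resolves L. Its terms are indexed by tuples b, in degree |b|, and consist of
   functions of bidegree (w - d, d - w), where w is the sum of the
   p^l a(b_l) with a(2q + r) = p q + r for r = 0, 1.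

   Cech cochains with values in this resolution, and in a resolution by
   injective sheaves, form two double complexes with exact rows (for the
   former, n > d is needed), exact columns and the same kernels. Hence H^j(L)
   is the cohomology of the global sections of the former: these are constants
   on the b with w = d, with zero differential. *)

Require Import Defs.
From HB Require Import structures.
From mathcomp Require Import all_boot all_order all_algebra.
From mathcomp Require Import boolp classical_sets functions fsbigop.
From mathcomp Require Import topology_structure.
From mathcomp Require Import (canonicals, coercions) mpoly.
From mathcomp Require Import perm ring zify.

Set Implicit Arguments.
Unset Strict Implicit.
Unset Printing Implicit Defensive.

Import Order.TTheory GRing.Theory Num.Theory.
Local Open Scope classical_set_scope.
Local Open Scope ring_scope.
Local Notation over := Defs.over.
Local Notation restrict := Defs.restrict.

(** * Injective resolutions *)

(** [cohomology_dim] asks for one injective resolution, so an explicit one is built: its terms are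
    sheaves of all functions on sets of functionals on stalks. Sections over every open set then lie
    in one space of functions, restriction cuts the support, and the faces of Cech cochains are
    commuting operators on a single module; no type depends on a tuple. Cohomology groups are
    compared by linear relations, not maps, since each step through a double complex involves a
    choice. The descent from the big cells frees one row at a time, and a freed row ranges over a
    projective space. This works where the row has nonnegative degree, hence not for the first row,
    of degree [-d]. There the Cech complex is kept, and it has no top cohomology because a Laurent
    monomial with a pole along each of the [n] coordinates has degree at most [-n < -d]. The tuples
    of [A_set] come from the orders of the derivatives: in units of [p^l] they are 1, p - 1, 1, p -
    1, ..., with partial sums 0, 1, p, p + 1, 2p, ..., the numbers congruent to 0 or 1 modulo p. The
    number of derivatives applied is the p-index. *)

Section FunctionalExtension.
Variables (k : fieldType) (V : lmodType k).

(* A partial linear functional on V is encoded by its graph. *)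
Definition linear_graph (D : set (V * k)) : Prop :=
  [/\ D (0, 0),
      forall (c : k) u v a b, D (u, a) -> D (v, b) -> D (c *: u + v, c * a + b)
    & forall a, D (0, a) -> a = 0].

(** Zorn's lemma on graphs: a maximal linear graph above [D] is defined everywhere, since a missing
    vector could be adjoined with an arbitrary value. *)
Lemma functional_extension (D : set (V * k)) : linear_graph D ->
  exists l : V -> k, (forall (c : k) u v, l (c *: u + v) = c * l u + l v) /\
    forall u a, D (u, a) -> l u = a.
Proof.
move=> gD.
(* The empty chain has empty union, so the empty set has to be admissible; taking the union with [D]
   makes it so. *)
have [|M [[gM DM] Mmax]] := @Zorn_bigcup (V * k)%type
    [set E | linear_graph (E `|` D) /\ (D `<=` E \/ E = set0)].
  move=> F FP totF.
  have Fcase : \bigcup_(E in F) E = set0 \/ exists2 E, F E & D `<=` E.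
    have [[E FE nE]|nF] := pselect (exists2 E, F E & E !=set0).
      by have [_ [DE|E0]] := FP E FE; [right; exists E|case: nE => x; rewrite E0].
    left; apply/seteqP; split=> // x [E FE Ex]; apply: nF; exists E => //.
    by exists x.
  split; last first.
    case: Fcase => [->|[E FE DE]]; [by right|left=> x /DE Ex].
    by exists E.
  case: Fcase => [->|[E FE DE]]; first by rewrite set0U.
  have inE x : F `<=` F -> (\bigcup_(E in F) E `|` D) x ->
      exists2 E', F E' & (E `<=` E') /\ E' x.
    move=> _ [[E' FE' E'x]|Dx]; last by exists E => //; split=> //; exact: DE.
    have [EE'|E'E] := totF E E' FE FE'; first by exists E'.
    by exists E => //; split=> //; exact: E'E.
  split.
  - by right; case: gD.
  - move=> c u v a b /inE[//|E1 FE1 [EE1 E1u]] /inE[//|E2 FE2 [EE2 E2v]].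
    left.
    wlog [E3 [FE3 E3u E3v DE3]] : / exists E3, [/\ F E3, E3 (u, a), E3 (v, b) & D `<=` E3].
      apply; have [E12|E21] := totF E1 E2 FE1 FE2.
        by exists E2; split=> //; [exact: E12|apply: subset_trans EE2].
      by exists E1; split=> //; [exact: E21|apply: subset_trans EE1].
    have [[_ cl _] _] := FP E3 FE3.
    have := cl c u v a b (or_introl E3u) (or_introl E3v).
    by move=> [?|/DE3 ?]; exists E3.
  - move=> a /inE[//|E1 FE1 [EE1 E1u]].
    by have [[_ _ z] _] := FP E1 FE1; apply: z; left.
have DsM : D `<=` M.
  case: DM => // M0; exfalso.
  apply: (Mmax D); last by split; [rewrite setUid|left].
  rewrite M0; split=> // /(_ (0, 0)); apply.
  by case: gD.
have MD : M `|` D = M by apply/seteqP; split=> [x [//|/DsM]|x Mx] //; left.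
rewrite MD in gM; have [M00 Mcl M0] := gM.
have Muniq u a b : M (u, a) -> M (u, b) -> a = b.
  move=> Ma Mb; have := Mcl (-1) u u a b Ma Mb.
  rewrite scaleN1r addNr mulN1r => /M0 /eqP; rewrite addrC subr_eq0 => /eqP.
  by [].
have Mtot u : exists a, M (u, a).
  apply: contrapT => nu.
  (* [M'] gives the missing vector [u] the value 0. It stays single-valued because no nonzero
     multiple of [u] lies in the domain of [M]. *)
  pose M' := [set x : V * k | exists c v a, M (v, a) /\ x = (c *: u + v, a)].
  apply: (Mmax M'); last first.
    have M'D : M' `|` D = M'.
      apply/seteqP; split=> [x [//|/DsM Mx]|x Mx]; last by left.
      by exists 0, x.1, x.2; rewrite scale0r add0r; case: x Mx.
    split; last first.
      left=> -[v a] /DsM Mx.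
      by exists 0, v, a; rewrite scale0r add0r.
    rewrite M'D; split.
    - by exists 0, 0, 0; rewrite scale0r addr0.
    - move=> c u1 v1 a b [c1 [w1 [a1 [Mw1 [-> ->]]]]] [c2 [w2 [a2 [Mw2 [-> ->]]]]].
      exists (c * c1 + c2), (c *: w1 + w2), (c * a1 + a2); split; first exact: Mcl.
      by rewrite scalerDr scalerA addrACA scalerDl.
    - move=> a [c [v [b [Mv [e ->]]]]].
      have [c0|c0] := eqVneq c 0.
        by apply: M0; rewrite e c0 scale0r add0r.
      exfalso; apply: nu; exists (- c^-1 * b).
      have -> : u = (- c^-1) *: v.
        move/eqP: e; rewrite eq_sym addrC addr_eq0 => /eqP ->.
        by rewrite scaleNr scalerN opprK scalerA mulVf // scale1r.
      by have := Mcl (- c^-1) v 0 b 0 Mv M00; rewrite !addr0.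
  split.
    by move=> -[v a] Mv; exists 0, v, a; rewrite scale0r add0r.
  move=> sub; apply: nu; exists 0; apply: sub.
  by exists 1, 0, 0; rewrite scale1r addr0.
exists (fun u => sval (cid (Mtot u))); split.
  move=> c u v; case: cid => w /= Mw; case: cid => a /= Ma; case: cid => b /= Mb.
  by apply: Muniq Mw _; exact: Mcl.
by move=> u a Da; case: cid => b /= Mb; apply: Muniq Mb _; exact: DsM.
Qed.

End FunctionalExtension.

Definition dprod (k : fieldType) (I : Type) (M : I -> lmodType k) := forall i, M i.

Section DependentProduct.
Variables (k : fieldType) (I : Type) (M : I -> lmodType k).
Implicit Types f g h : dprod M.

HB.instance Definition _ := gen_eqMixin (dprod M).
HB.instance Definition _ := gen_choiceMixin (dprod M).

Let addf f g : dprod M := fun i => f i + g i.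
Let zerof : dprod M := fun i => 0.
Let oppf f : dprod M := fun i => - f i.
Let scalef (c : k) f : dprod M := fun i => c *: f i.

Fact dprod_addA : associative addf.
Proof. by move=> f g h; apply: functional_extensionality_dep => i; exact: addrA. Qed.
Fact dprod_addC : commutative addf.
Proof. by move=> f g; apply: functional_extensionality_dep => i; exact: addrC. Qed.
Fact dprod_add0 : left_id zerof addf.
Proof. by move=> f; apply: functional_extensionality_dep => i; exact: add0r. Qed.
Fact dprod_addN : left_inverse zerof oppf addf.
Proof. by move=> f; apply: functional_extensionality_dep => i; exact: addNr. Qed.

HB.instance Definition _ :=
  GRing.isZmodule.Build (dprod M) dprod_addA dprod_addC dprod_add0 dprod_addN.

Fact dprod_scaleA (a b : k) f : scalef a (scalef b f) = scalef (a * b) f.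
Proof. by apply: functional_extensionality_dep => i; exact: scalerA. Qed.
Fact dprod_scale1 : left_id 1 scalef.
Proof. by move=> f; apply: functional_extensionality_dep => i; exact: scale1r. Qed.
Fact dprod_scaleDr : right_distributive scalef +%R.
Proof. by move=> c f g; apply: functional_extensionality_dep => i; exact: scalerDr. Qed.
Fact dprod_scaleDl f : {morph scalef^~ f : a b / a + b}.
Proof. by move=> a b; apply: functional_extensionality_dep => i; exact: scalerDl. Qed.

HB.instance Definition _ :=
  GRing.Zmodule_isLmodule.Build k (dprod M) dprod_scaleA dprod_scale1
    dprod_scaleDr dprod_scaleDl.

End DependentProduct.

Section Germs.
Variables (k : fieldType) (X : topologicalType) (B : sheaf k X) (x : X).

Lemma res_irr (U V : opens X) (h h' : V `<=` U) (s : B U) : res B h s = res B h' s.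
Proof.
by rewrite -(res_comp h (@subset_refl _ V) h') res_id.
Qed.

Definition opensI (U V : opens X) : opens X :=
  Opens (openI (oset_open U) (oset_open V)).

(* A functional on the stalk of [B] at [x]; its values on the sections over
   neighbourhoods of [x] are what matters. *)
Definition germ_functional (eta : forall V : opens X, B V -> k) : Prop :=
  (forall V, oset V x -> forall (c : k) u v,
     eta V (c *: u + v) = c * eta V u + eta V v) /\
  (forall (U V : opens X) (h : V `<=` U) (s : B U), oset V x ->
     eta V (res B h s) = eta U s).

(** The stalk at [x] is not formed. A section is extended by zero to a family indexed by all open
    sets, and [G] holds the prescribed values on the families that restrict one section below some
    neighbourhood of [x]; the functional is extended from there to the whole product. *)
Lemma germ_extension (D : forall V : opens X, B V -> k -> Prop) :
  (forall V, D V 0 0) ->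
  (forall V (c : k) u v a b, D V u a -> D V v b -> D V (c *: u + v) (c * a + b)) ->
  (forall (U V : opens X) (h : V `<=` U) s a, D U s a -> D V (res B h s) a) ->
  (forall V a, oset V x -> D V 0 a -> a = 0) ->
  exists2 eta, germ_functional eta &
    forall V s a, oset V x -> D V s a -> eta V s = a.
Proof.
move=> D0 Dlin Dres Duniq.
pose G := [set q : dprod (fun V : opens X => B V) * k | exists (V0 : opens X) (s : B V0),
  [/\ oset V0 x, D V0 s q.2 & forall (V : opens X) (h : V `<=` V0), q.1 V = res B h s]].
have [|l [llin lG]] := @functional_extension k (dprod (fun V : opens X => B V)) G.
  split.
  - exists (whole X), 0; split=> // V h; rewrite linear0; exact: erefl.
  - move=> c u v a b [U [s [Ux Ds us]]] [V [t [Vx Dt vt]]].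
    pose W := opensI U V.
    have WU : W `<=` U by move=> y [].
    have WV : W `<=` V by move=> y [].
    exists W, (c *: res B WU s + res B WV t); split=> //.
      by apply: Dlin; exact: Dres.
    move=> V' h /=.
    rewrite linearP (res_comp WU h (subset_trans h WU)).
    rewrite (res_comp WV h (subset_trans h WV)) -us -vt; exact: erefl.
  - move=> a [U [s [Ux Ds us]]]; apply: (Duniq U) => //.
    by have e : s = 0 by [rewrite -[s](res_id (@subset_refl _ U)) -us]; rewrite -e.
pose ext (V : opens X) (s : B V) : dprod (fun V : opens X => B V) := fun W =>
  if pselect (W `<=` V) is left h then res B h s else 0.
exists (fun V s => l (ext V s)).
  split.
    move=> V Vx c u v; rewrite -llin; congr l.
    apply: functional_extensionality_dep => W.
    change (ext V (c *: u + v) W = c *: ext V u W + ext V v W).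
    rewrite /ext; case: pselect => [h|_]; first exact: linearP.
    by rewrite scaler0 addr0.
  move=> U V h s Vx.
  (* The families of [s] and of its restriction agree below [V], so their difference lies in the
     graph with value 0. *)
  apply/eqP; rewrite -subr_eq0 -[l (ext U s)]mul1r -mulNr addrC -llin; apply/eqP.
  apply: lG; exists V, 0; split=> // W hW /=.
  change ((-1) *: ext U s W + ext V (res B h s) W = res B hW 0).
  rewrite linear0 /ext; case: pselect => [WU|]; last by case; exact: subset_trans h.
  case: pselect => [WV|//]; rewrite (res_comp h WV WU).
  by rewrite scaleN1r addNr.
move=> V s a Vx Ds; apply: lG; exists V, s; split=> // W h.
by rewrite /ext /=; case: pselect => [h'|//]; exact: res_irr.
Qed.

End Germs.

Section FunctionSheaf.
Variables (k : fieldType) (X : topologicalType) (Xi : Type) (pi : Xi -> X).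
Implicit Types U V W : opens X.

(** These are the sections of a product of skyscraper sheaves: each [xi] contributes a copy of [k]
    at the point [pi xi]. They are functions on all of [Xi], so that restriction is a cut-off inside
    one space. *)
Definition support_pred (U : opens X) : {pred Xi -> k^o} :=
  [pred f | `[< forall xi, ~ oset U (pi xi) -> f xi = 0 >]].

Fact support_pred_submod U : submod_closed (support_pred U).
Proof.
split=> [|a f h /asboolP zf /asboolP zh]; apply/asboolP => xi nU //.
change (a * f xi + h xi = 0).
by rewrite zf // zh // mulr0 addr0.
Qed.

HB.instance Definition _ U :=
  GRing.isSubmodClosed.Build k (Xi -> k^o) (support_pred U)
    (support_pred_submod U).

Record fsections U := FSections {
  fval :> Xi -> k^o;
  fvalP : fval \in support_pred U }.

HB.instance Definition _ U := [isSub for @fval U].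
HB.instance Definition _ U := [Choice of fsections U by <:].
HB.instance Definition _ U := [SubChoice_isSubLmodule of fsections U by <:].

Lemma fval0 U (s : fsections U) xi : ~ oset U (pi xi) -> s xi = 0.
Proof. by have /asboolP := fvalP s; apply. Qed.

Definition cut (U : opens X) (f : Xi -> k^o) : Xi -> k^o :=
  fun xi => if `[< oset U (pi xi) >] then f xi else 0.

Fact cut_subproof U f : cut U f \in support_pred U.
Proof. by apply/asboolP => xi nU; rewrite /cut asboolF. Qed.

Definition fres U V (h : V `<=` U) (s : fsections U) : fsections V :=
  FSections (cut_subproof V s).

Fact fres_linear U V (h : V `<=` U) : linear (fres h).
Proof.
move=> a s t; apply: val_inj; apply/funext => xi.
change (cut V (a *: fval s + fval t) xi = a * cut V s xi + cut V t xi).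
by rewrite /cut; case: asboolP => // _; rewrite mulr0 addr0.
Qed.

HB.instance Definition _ U V (h : V `<=` U) :=
  GRing.isLinear.Build k (fsections U) (fsections V) _ (fres h) (fres_linear h).

Lemma fresE U V (h : V `<=` U) (s : fsections U) xi : oset V (pi xi) ->
  fres h s xi = s xi.
Proof. by move=> Vx; rewrite /= /cut asboolT. Qed.

Lemma fsection_eq U (s t : fsections U) :
  (forall xi, oset U (pi xi) -> s xi = t xi) -> s = t.
Proof.
move=> st; apply: val_inj; apply/funext => xi.
have [/st//|nU] := pselect (oset U (pi xi)).
by change (s xi = t xi); rewrite !fval0.
Qed.

Lemma fres_id U (h : U `<=` U) (s : fsections U) : fres h s = s.
Proof. by apply: fsection_eq => xi Ux; rewrite fresE. Qed.

Lemma fres_comp (U V W : opens X) (hVU : V `<=` U) (hWV : W `<=` V)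
  (hWU : W `<=` U) (s : fsections U) : fres hWV (fres hVU s) = fres hWU s.
Proof. by apply: fsection_eq => xi Wx; rewrite !fresE //; exact: hWV. Qed.

Lemma fsep (U : opens X) (I : Type) (W : I -> opens X) (hW : forall i, W i `<=` U) :
  U `<=` \bigcup_i W i ->
  forall s : fsections U, (forall i, fres (hW i) s = 0) -> s = 0.
Proof.
move=> UW s s0; apply: fsection_eq => xi /UW[i _ Wx].
by rewrite -(fresE (hW i)) // s0.
Qed.

Lemma fglue (U : opens X) (I : Type) (W : I -> opens X) (hW : forall i, W i `<=` U) :
  U `<=` \bigcup_i W i ->
  forall s : (forall i, fsections (W i)),
  (forall i j (O : opens X) (hi : O `<=` W i) (hj : O `<=` W j),
     fres hi (s i) = fres hj (s j)) ->
  exists t : fsections U, forall i, fres (hW i) t = s i.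
Proof.
move=> UW s sE.
pose t : Xi -> k^o := fun xi =>
  if pselect (exists i, oset (W i) (pi xi)) is left h then s (sval (cid h)) xi else 0.
have tP : t \in support_pred U.
  apply/asboolP => xi nU; rewrite /t; case: pselect => // -[i Wi].
  by case: nU; exact: hW Wi.
exists (FSections tP) => i; apply: fsection_eq => xi Wx; rewrite fresE //= /t.
case: pselect => [h|]; last by case; exists i.
case: cid => j /= Wj.
have hi : opensI (W i) (W j) `<=` W i by move=> y [].
have hj : opensI (W i) (W j) `<=` W j by move=> y [].
by rewrite -(fresE hj) // -(sE _ _ _ hi hj) fresE.
Qed.

Definition fsheaf : sheaf k X :=
  @Sheaf k X (fun U => fsections U) (fun U V h => fres h)
    fres_id fres_comp fsep fglue.

(** A morphism into this sheaf amounts to one functional on the stalk at [pi xi] for each [xi]. As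
    [m] is injective on stalks, the functional given by [f] on the germs of [A] extends to the germs
    of [B]. *)
Lemma fsheaf_injective : injective_sheaf fsheaf.
Proof.
move=> A B m mono f.
pose D xi (V : opens X) (s : B V) (a : k) := oset V (pi xi) ->
  exists (V0 : opens X) (h : V0 `<=` V) (t : A V0),
  [/\ oset V0 (pi xi), m V0 t = res B h s & (f V0 t : fsections V0) xi = a].
have Dext xi : exists eta, germ_functional (pi xi) eta /\
    forall V s a, oset V (pi xi) -> D xi V s a -> eta V s = a.
  have [] := @germ_extension k X B (pi xi) (D xi); last by move=> eta ? ?; exists eta.
  - move=> V Vx; exists V, (@subset_refl _ V), 0; split=> //; rewrite !linear0 //.
  - move=> V c u v a b Du Dv Vx.
    have [U1 [h1 [t1 [U1x e1 <-]]]] := Du Vx.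
    have [U2 [h2 [t2 [U2x e2 <-]]]] := Dv Vx.
    have i1 : opensI U1 U2 `<=` U1 by move=> y [].
    have i2 : opensI U1 U2 `<=` U2 by move=> y [].
    have iV := subset_trans i1 h1.
    exists (opensI U1 U2), iV, (c *: res A i1 t1 + res A i2 t2); split=> //.
      rewrite !linearP !shom_res e1 e2 (res_comp h1 i1 iV) (res_comp h2 i2 iV).
      exact: erefl.
    rewrite linearP !shom_res.
    change (c * fres i1 (f U1 t1) xi + fres i2 (f U2 t2) xi =
      c * (f U1 t1 : fsections U1) xi + (f U2 t2 : fsections U2) xi).
    by rewrite !fresE.
  - move=> U V h s a Ds Vx.
    have [V0 [h0 [t [V0x e <-]]]] := Ds (h _ Vx).
    have i1 : opensI V0 V `<=` V0 by move=> y [].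
    have i2 : opensI V0 V `<=` V by move=> y [].
    exists (opensI V0 V), i2, (res A i1 t); split=> //.
      by rewrite shom_res e (res_comp h0 i1 (subset_trans i1 h0)) (res_comp h i2 (subset_trans i1 h0)).
    rewrite shom_res; exact: fresE.
  - move=> V a Vx /(_ Vx)[V0 [h0 [t [V0x e <-]]]].
    suff -> : t = 0 by rewrite linear0.
    by apply: mono; rewrite e !linear0.
pose eta xi := sval (cid (Dext xi)).
have etaP xi := svalP (cid (Dext xi)); rewrite -/(eta _) in etaP.
pose g0 (U : opens X) (s : B U) : Xi -> k^o :=
  fun xi => if `[< oset U (pi xi) >] then eta xi U s else 0.
have g0P U s : g0 U s \in support_pred U.
  by apply/asboolP => xi nU; rewrite /g0 asboolF.
pose g1 U (s : B U) : fsections U := FSections (g0P U s).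
have g1lin U : linear (g1 U).
  move=> c u v; apply: fsection_eq => xi Ux.
  change (g0 U (c *: u + v) xi = c * g0 U u xi + g0 U v xi).
  rewrite /g0 asboolT //; have [[l _] _] := etaP xi; exact: l.
pose g2 U : {linear B U -> fsheaf U} :=
  HB.pack (g1 U) (GRing.isLinear.Build k (B U) (fsections U) _ (g1 U) (g1lin U)).
have g2res (U V : opens X) (h : V `<=` U) (s : B U) :
    g2 V (res B h s) = res fsheaf h (g2 U s).
  apply: fsection_eq => xi Vx.
  change (g0 V (res B h s) xi = fres h (g1 U s) xi).
  rewrite fresE //= /g0 !asboolT //; last exact: h.
  by have [[_ r] _] := etaP xi; exact: r.
exists (SheafHom g2res) => U s; apply: fsection_eq => xi Ux.
change (g0 U (m U s) xi = (f U s : fsections U) xi).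
rewrite /g0 asboolT //; have [_ r] := etaP xi; apply: r => // _.
by exists U, (@subset_refl _ U), s; split=> //; rewrite res_id.
Qed.

End FunctionSheaf.

Section GermResolution.
Variables (k : fieldType) (X : topologicalType).

Section Step.
Variables (F G : sheaf k X) (f : sheaf_hom F G).
Implicit Types U V W : opens X.

(** Functionals on the stalks of the cokernel of [f]. Over a field they separate its elements, so
    evaluation on them has kernel exactly the image of [f]. *)
Definition cogerm : Type := {x : X & {eta : forall V : opens X, G V -> k |
  germ_functional x eta /\
  forall (V : opens X) (t : F V), oset V x -> eta V (f V t) = 0}}.

Definition cogerm_base (xi : cogerm) : X := projT1 xi.

Definition cogerm_eval (U : opens X) (s : G U) : cogerm -> k^o :=
  fun xi => if `[< oset U (cogerm_base xi) >] then sval (projT2 xi) U s else 0.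

Fact cogerm_eval_subproof U (s : G U) : cogerm_eval s \in support_pred (k:=k) cogerm_base U.
Proof. by apply/asboolP => xi nU; rewrite /cogerm_eval asboolF. Qed.

Definition cogerm_map U (s : G U) : fsections k cogerm_base U :=
  FSections (cogerm_eval_subproof s).

Fact cogerm_map_linear U : linear (@cogerm_map U).
Proof.
move=> c u v; apply: fsection_eq => xi Ux.
change (cogerm_eval (c *: u + v) xi = c * cogerm_eval u xi + cogerm_eval v xi).
by rewrite /cogerm_eval asboolT //; case: xi Ux => x [eta [[lin r] z]] /= Ux; exact: lin.
Qed.

HB.instance Definition _ U :=
  GRing.isLinear.Build k (G U) (fsections k cogerm_base U) _ (@cogerm_map U)
    (@cogerm_map_linear U).

Fact cogerm_map_res (U V : opens X) (h : V `<=` U) (s : G U) :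
  cogerm_map (res G h s) = res (fsheaf k cogerm_base) h (cogerm_map s).
Proof.
apply: fsection_eq => xi Vx.
change (cogerm_eval (res G h s) xi = fres h (cogerm_map s) xi).
rewrite fresE //= /cogerm_eval !asboolT //; last exact: h.
by case: xi Vx => x [eta [[lin r] z]] /= Vx; exact: r.
Qed.

Definition cogerm_hom : sheaf_hom G (fsheaf k cogerm_base) :=
  @SheafHom k X G (fsheaf k cogerm_base) (fun U => @cogerm_map U) cogerm_map_res.

Lemma cogerm_exact (U : opens X) (s : G U) :
  cogerm_hom U s = 0 <-> in_image f s.
Proof.
split=> [s0 x Ux|im]; last first.
  apply: fsection_eq => xi Ux; change (cogerm_eval s xi = 0).
  rewrite /cogerm_eval asboolT //; case: xi Ux => x [eta [[lin r] z]] /= Ux.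
  have [V [h [Vx [t e]]]] := im _ Ux.
  by rewrite -(r _ _ h) // -e z.
apply: contrapT => nim.
(* If [s] is not in the image near [x], its germ is independent of the germs coming from [F], so a
   functional may be 1 on the former and 0 on the latter. *)
pose D (V : opens X) (t : G V) (a : k) := oset V x ->
  exists (W : opens X) (hV : W `<=` V) (hU : W `<=` U) (u : F W),
  oset W x /\ res G hV t = a *: res G hU s + f W u.
have [] := @germ_extension k X G x D.
- move=> V Vx.
  have i1 : opensI V U `<=` V by move=> y [].
  have i2 : opensI V U `<=` U by move=> y [].
  by exists (opensI V U), i1, i2, 0; rewrite !linear0 scale0r addr0.
- move=> V c u v a b Du Dv Vx.
  have [W1 [h1 [g1 [u1 [W1x e1]]]]] := Du Vx.
  have [W2 [h2 [g2 [u2 [W2x e2]]]]] := Dv Vx.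
  have i1 : opensI W1 W2 `<=` W1 by move=> y [].
  have i2 : opensI W1 W2 `<=` W2 by move=> y [].
  exists (opensI W1 W2), (subset_trans i1 h1), (subset_trans i1 g1),
    (c *: res F i1 u1 + res F i2 u2); split=> //.
  rewrite linearP -(res_comp h1 i1) e1 -(res_comp h2 i2 (subset_trans i1 h1)) e2.
  rewrite !linearP !shom_res (res_comp g1 i1 (subset_trans i1 g1)).
  rewrite (res_comp g2 i2 (subset_trans i1 g1)).
  rewrite /= scalerA mulrC scalerDl -!addrA; congr (_ + _).
  by rewrite addrCA.
- move=> V W h t a Dt Wx.
  have [W1 [h1 [g1 [u1 [W1x e1]]]]] := Dt (h _ Wx).
  have i1 : opensI W1 W `<=` W1 by move=> y [].
  have i2 : opensI W1 W `<=` W by move=> y [].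
  exists (opensI W1 W), i2, (subset_trans i1 g1), (res F i1 u1); split=> //.
  rewrite (res_comp h i2 (subset_trans i1 h1)) -(res_comp h1 i1) e1 linearP.
  by rewrite !shom_res (res_comp g1 i1 (subset_trans i1 g1)).
- move=> V a Vx /(_ Vx)[W [h [g [u [Wx e]]]]].
  apply: contrapT => /eqP a0; apply: nim; exists W, g; split=> //.
  exists (- a^-1 *: u); rewrite linearZ /=.
  move/eqP: e; rewrite linear0 eq_sym addrC addr_eq0 => /eqP ->.
  by rewrite scalerN scaleNr opprK scalerA mulVf // scale1r.
move=> eta eg etaD.
have z (V : opens X) (t : F V) : oset V x -> eta V (f V t) = 0.
  move=> Vx; apply: etaD => // _.
  have i1 : opensI V U `<=` V by move=> y [].
  have i2 : opensI V U `<=` U by move=> y [].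
  exists (opensI V U), i1, i2, (res F i1 t); split=> //.
  by rewrite scale0r add0r shom_res.
pose xi : cogerm := existT _ x (exist _ eta (conj eg z)).
have : cogerm_map s xi = 0 by rewrite [cogerm_map s]s0.
rewrite /= /cogerm_eval asboolT //= => /eqP; apply/negP.
rewrite (etaD U s 1) ?oner_eq0 // => _.
exists U, (@subset_refl _ U), (@subset_refl _ U), 0.
by rewrite linear0 addr0 scale1r.
Qed.

End Step.

Variable F : sheaf k X.

Fact zero_hom_res (U V : opens X) (h : V `<=` U) (s : F U) :
  (\0 : {linear F V -> F V}) (res F h s) = res F h ((\0 : {linear F U -> F U}) s).
Proof. by rewrite /= linear0. Qed.

Definition zero_hom : sheaf_hom F F := SheafHom zero_hom_res.

(** The source sheaf and the index set both change from one term of the resolution to the next;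
    bundling them allows the construction to be iterated. *)
Record stage := Stage {
  stage_src : sheaf k X;
  stage_pts : Type;
  stage_pi : stage_pts -> X;
  stage_hom : sheaf_hom stage_src (fsheaf k stage_pi) }.

Definition next_stage (S : stage) : stage :=
  Stage (cogerm_hom (stage_hom S)).

(** The iteration starts from the zero endomorphism of [F]: its image is zero, so the first map out
    of [F] is a monomorphism and serves as augmentation. *)
Definition stages (j : nat) : stage :=
  iter j next_stage (Stage (cogerm_hom zero_hom)).

Definition germ_term (j : nat) : sheaf k X := fsheaf k (@stage_pi (stages j)).

Definition germ_diff (j : nat) : sheaf_hom (germ_term j) (germ_term j.+1) :=
  stage_hom (stages j.+1).

Definition germ_aug : sheaf_hom F (germ_term 0) := stage_hom (stages 0).

Lemma germ_aug_mono : sheaf_mono germ_aug.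
Proof.
move=> U s t /eqP; rewrite -subr_eq0 -linearB => /eqP /cogerm_exact im.
apply/eqP; rewrite -subr_eq0; apply/eqP.
have P (x : {x | oset U x}) : {V : opens X | V `<=` U & oset V (sval x) /\
    forall h : V `<=` U, res F h (s - t) = 0}.
  apply: cid2; have [V [h [Vx [u e]]]] := im _ (svalP x).
  by exists V => //; split=> // h'; rewrite (res_irr h' h) -e.
apply: (sheaf_separated (W := fun x => s2val (P x)) (hW := fun x => s2valP (P x))).
  by move=> x Ux; exists (exist _ x Ux) => //; have [] := s2valP' (P (exist _ x Ux)).
by move=> x; have [_] := s2valP' (P x); apply.
Qed.

Definition germ_resolution : injective_resolution F :=
  @InjectiveResolution k X F germ_term germ_diff germ_aug
    (fun j => @fsheaf_injective k X _ _) germ_aug_mono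
    (fun U s => cogerm_exact germ_aug s)
    (fun j U s => cogerm_exact (germ_diff j) s).

End GermResolution.

(** * Double complexes *)

Section QuotientDimension.
Variable k : fieldType.

Definition quotient_dim (V : lmodType k) (Z B : V -> Prop) (h : nat) : Prop :=
  exists b : 'I_h -> V, (forall i, Z (b i)) /\
    forall z, Z z -> exists! c : 'rV[k]_h, B (z - \sum_(i < h) c 0 i *: b i).

Lemma quotient_dim0 (V : lmodType k) (Z B : V -> Prop) :
  (forall z, Z z -> B z) -> quotient_dim Z B 0.
Proof.
move=> ZB; exists (fun=> 0); split; first by case.
move=> z /ZB Bz; exists 0; split; first by rewrite big_ord0 subr0.
by move=> c _; apply/rowP; case.
Qed.

Lemma quotient_dim0_sub (V : lmodType k) (Z B : V -> Prop) :
  quotient_dim Z B 0 -> forall z, Z z -> B z.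
Proof. by move=> [b [_ H]] z /H[c [+ _]]; rewrite big_ord0 subr0. Qed.

(** A linear relation takes the place of an isomorphism between the quotients. It need be neither
    functional nor injective, only total on cycles from both sides and compatible with
    boundaries. *)
Lemma quotient_dim_transfer (V V' : lmodType k) (Z B : V -> Prop)
    (Z' B' : V' -> Prop) (rho : V -> V' -> Prop) h :
  (forall (a : k) u u' v v', rho u u' -> rho v v' -> rho (a *: u + v) (a *: u' + v')) ->
  (forall z, Z z -> exists2 z', Z' z' & rho z z') ->
  (forall z', Z' z' -> exists2 z, Z z & rho z z') ->
  (forall z z', rho z z' -> B z <-> B' z') ->
  quotient_dim Z B h -> quotient_dim Z' B' h.
Proof.
move=> rlin ZZ' Z'Z BB' [b [Zb H]].
have /boolp.choice[b' b'P] : forall i, exists x, Z' x /\ rho (b i) x.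
  by move=> i; have [x] := ZZ' _ (Zb i); exists x.
exists b'; split=> [i|z' /Z'Z[z Zz r]]; first by have [] := b'P i.
have E (c : 'rV_h) : B (z - \sum_(i < h) c 0 i *: b i) <->
    B' (z' - \sum_(i < h) c 0 i *: b' i).
  apply: BB'; rewrite -!sumrN.
  suff S (r' : seq 'I_h) : rho (\sum_(i <- r') - (c 0 i *: b i) + z)
      (\sum_(i <- r') - (c 0 i *: b' i) + z').
    by have := S (index_enum 'I_h); rewrite ![_ + z]addrC ![_ + z']addrC.
  elim: r' => [|i r' IH]; first by rewrite !big_nil !add0r.
  rewrite !big_cons -!addrA -!scaleNr; apply: rlin => //.
  by have [] := b'P i.
have [c [Bc cu]] := H z Zz; exists c; split; first exact/E.
by move=> c' /E/cu.
Qed.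

End QuotientDimension.

(** * Cech differentials and the comparison of double complexes *)

Section CechDifferential.
Variables (k : fieldType) (J : Type).

Section Delta.
Variables (V : lmodType k) (e : J -> {linear V -> V}).

(* The alternating sum of the faces of c: omitting the entry j of a tuple is
   followed by the restriction e j. *)
Fixpoint delta (c : seq J -> V) (s : seq J) : V :=
  if s is j :: s' then e j (c s') - delta (fun u => c (j :: u)) s' else 0.

Lemma delta_ext c c' s :
  (forall u, (size u).+1 = size s -> c u = c' u) -> delta c s = delta c' s.
Proof.
elim: s c c' => //= j s IH c c' E; rewrite E //; congr (_ - _).
by apply: IH => u su; apply: E; rewrite /= su.
Qed.

Lemma deltaP (a : k) c c' s :
  delta (fun u => a *: c u + c' u) s = a *: delta c s + delta c' s.
Proof.
elim: s c c' => [|j s IH] c c' /=; first by rewrite scaler0 addr0.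
by rewrite IH linearP opprD scalerBr !addrA; congr (_ - _); rewrite addrAC.
Qed.

Lemma delta0 s : delta (fun=> 0) s = 0.
Proof. by elim: s => //= j s ->; rewrite linear0 subr0. Qed.

Lemma deltaB c c' s : delta (fun u => c u - c' u) s = delta c s - delta c' s.
Proof.
have := deltaP (-1) c' c s; rewrite scaleN1r [- _ + _]addrC => <-.
by apply: delta_ext => u _; rewrite scaleN1r addrC.
Qed.

Hypothesis eC : forall i j v, e i (e j v) = e j (e i v).

Lemma delta_face j c s : delta (fun u => e j (c u)) s = e j (delta c s).
Proof.
elim: s c => [|i s IH] c /=; first by rewrite linear0.
by rewrite IH linearB eC.
Qed.

Lemma delta_delta c s : delta (delta c) s = 0.
Proof.
elim: s c => //= j s IH c.
by rewrite deltaB delta_face IH subr0 subrr.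
Qed.

Section Support.
Variable P : seq J -> V -> Prop.
Hypothesis P_lin : forall s (a : k) u v, P s u -> P s v -> P s (a *: u + v).
Hypothesis P_ins : forall s1 j s2 v, P (s1 ++ s2) v -> P (s1 ++ j :: s2) (e j v).

(** The induction absorbs the head of the tuple into [P], which is why [P] has to be stable under
    insertion at any position and not only in front. *)
Lemma delta_support m c : (forall u, size u = m -> P u (c u)) ->
  forall s, size s = m.+1 -> P s (delta c s).
Proof.
move=> Pc s; elim: s m P P_lin P_ins c Pc => // j s IH m Q Ql Qi c Qc [sm] /=.
rewrite addrC -scaleN1r.
case: s sm IH => [|i s] sm IH.
  rewrite /= scaler0 add0r; apply: (Qi [::] j [::]); exact: Qc.
case: m Qc sm => // m Qc [sm].
apply: (Ql (j :: i :: s)); last by apply: (Qi [::] j (i :: s)); apply: Qc; rewrite /= sm.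
apply: (IH m (fun u => Q (j :: u))); rewrite /= ?sm //.
- by move=> u a v w; exact: Ql.
- by move=> s1 i' s2 v; exact: (Qi (j :: s1)).
- by move=> u su; apply: Qc; rewrite /= su.
Qed.

End Support.

End Delta.

Section DeltaMap.
Variables (V V' : lmodType k) (e : J -> {linear V -> V}) (e' : J -> {linear V' -> V'}).

(** The hypotheses leave out the empty tuple and tuples shorter than [m], because the relation
    between two resolutions is available only on nonempty tuples. *)
Lemma delta_rel (R : seq J -> V -> V' -> Prop) m c c' :
  (forall s (a : k) u u' v v', s <> [::] -> R s u u' -> R s v v' -> R s (a *: u + v) (a *: u' + v')) ->
  (forall s1 j s2 u u', (size (s1 ++ s2) >= m)%N -> R (s1 ++ s2) u u' -> R (s1 ++ j :: s2) (e j u) (e' j u')) ->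
  (forall u, size u = m -> R u (c u) (c' u)) ->
  forall s, size s = m.+1 -> R s (delta e c s) (delta e' c' s).
Proof.
move=> Rl Ri Rc s; elim: s m R Rl Ri c c' Rc => // j s IH m R Rl Ri c c' Rc [sm] /=.
have R1 : R (j :: s) (e j (c s)) (e' j (c' s)).
  by apply: (Ri [::]); rewrite /= ?sm //; exact: Rc.
case: s sm IH R1 => [|i s] sm IH R1.
  by rewrite /= !subr0.
rewrite ![_ - delta _ _ _]addrC -!scaleN1r.
case: m Rc Ri sm => // m Rc Ri [sm].
apply: (Rl (j :: i :: s)) => //; apply: (IH m (fun u => R (j :: u))); rewrite /= ?sm //.
- by move=> u a v v' w w' _; exact: Rl.
- by move=> s1 i' s2 v v' sz; exact: (Ri (j :: s1)).
- by move=> u su; apply: Rc; rewrite /= su.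
Qed.

End DeltaMap.

End CechDifferential.

(** For each [q] one module contains the values of cochains on all tuples; [din s] cuts out those
    that live over the intersection indexed by [s], the empty tuple standing for the global terms.
    The differential may depend on [s] and is controlled only on [din s]. *)
Record double_complex (k : fieldType) (J : Type) := DoubleComplex {
  dterm :> nat -> lmodType k;
  dface : forall q, J -> {linear dterm q -> dterm q};
  din : forall q, seq J -> dterm q -> Prop;
  ddiff : forall q, seq J -> dterm q -> dterm q.+1;
  dfaceC : forall q i j v, dface q i (dface q j v) = dface q j (dface q i v);
  din0 : forall q s, din s (0 : dterm q);
  din_lin : forall q s (a : k) (u v : dterm q), din s u -> din s v -> din s (a *: u + v);
  din_ins : forall q s1 j s2 (v : dterm q), din (s1 ++ s2) v -> din (s1 ++ j :: s2) (dface q j v);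
  din_diff : forall q s (v : dterm q), din s v -> din s (ddiff s v);
  ddiff_lin : forall q s (a : k) (u v : dterm q), din s u -> din s v ->
    ddiff s (a *: u + v) = a *: ddiff s u + ddiff s v;
  ddiff_ins : forall q s1 j s2 (v : dterm q), din (s1 ++ s2) v ->
    ddiff (s1 ++ j :: s2) (dface q j v) = dface q.+1 j (ddiff (s1 ++ s2) v);
  ddiff_diff : forall q s (v : dterm q), din s v -> ddiff s (ddiff s v) = 0 }.

Section DoubleComplex.
Variables (k : fieldType) (J : Type) (K : double_complex k J).

(** The rows include the global terms: for [m = 0] these embed into the cochains, and for [m = 1]
    compatible families glue. *)
Definition row_exact q : Prop := forall m (c : seq J -> K q),
  (forall s, size s = m -> din s (c s)) ->
  (forall s, size s = m.+1 -> delta (dface K q) c s = 0) ->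
  exists b, (forall u, (size u).+1 = m -> din u (b u)) /\
    forall s, size s = m -> c s = delta (dface K q) b s.

Definition column_exact q : Prop := forall s (z : K q.+1), s <> [::] ->
  din s z -> ddiff s z = 0 -> exists2 b : K q, din s b & ddiff s b = z.

Definition dcycle q s (v : K q) : Prop := din s v /\ ddiff s v = 0.

Definition augmentation_boundary q : K q -> Prop :=
  match q return K q -> Prop with
  | 0 => fun z => z = 0
  | q'.+1 => fun z => exists2 a : K q', din [::] a & ddiff [::] a = z
  end.

(* m is the length of the tuples, so that the Cech degree is m - 1. *)
Definition cech_cocycle q m (c : seq J -> K q) : Prop :=
  (forall s, size s = m -> dcycle s (c s)) /\
  (forall s, size s = m.+1 -> delta (dface K q) c s = 0).

(** For [m = 1] the only [u] is the empty tuple, and its value must be a boundary of the global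
    complex. With this convention the quotient in Cech degree 0 is the cohomology of the global
    terms, and the staircase is uniform down to its last step. *)
Definition cech_coboundary q m (c : seq J -> K q) : Prop :=
  exists b, (forall u, (size u).+1 = m -> dcycle u (b u) /\
                       (u = [::] -> augmentation_boundary (b u))) /\
    forall s, size s = m -> c s = delta (dface K q) b s.

Lemma ddiff0 q s : ddiff s (0 : K q) = 0.
Proof.
have := ddiff_lin (-1) (din0 K q s) (din0 K q s).
by rewrite scaler0 addr0 scaleN1r addNr.
Qed.

Lemma delta_din q m (c : seq J -> K q) : (forall u, size u = m -> din u (c u)) ->
  forall s, size s = m.+1 -> din s (delta (dface K q) c s).
Proof. by apply: delta_support; [exact: din_lin|exact: din_ins]. Qed.

Lemma delta_ddiff q m (c : seq J -> K q) : (forall u, size u = m -> din u (c u)) ->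
  forall s, size s = m.+1 ->
  ddiff s (delta (dface K q) c s) = delta (dface K q.+1) (fun u => ddiff u (c u)) s.
Proof.
move=> Pc s ss.
pose R s (u : K q) (u' : K q.+1) := din s u /\ ddiff s u = u'.
have [] // : R s (delta (dface K q) c s) (delta (dface K q.+1) (fun u => ddiff u (c u)) s).
apply: (delta_rel (m := m)) => //.
- by move=> s0 a u u' v v' _ [Pu <-] [Pv <-]; split; [exact: din_lin|exact: ddiff_lin].
- by move=> s1 j s2 u u' _ [Pu <-]; split; [exact: din_ins|exact: ddiff_ins].
- by move=> u su; split=> //; exact: Pc.
Qed.

Lemma dinB q s (u v : K q) : din s u -> din s v -> din s (u - v).
Proof. by move=> Pu Pv; rewrite addrC -scaleN1r; exact: din_lin. Qed.

Lemma ddiffB q s (u v : K q) : din s u -> din s v -> ddiff s (u - v) = ddiff s u - ddiff s v.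
Proof. by move=> Pu Pv; rewrite ![_ - _]addrC -!scaleN1r; exact: ddiff_lin. Qed.

Definition aug_rel q (z : K q) (c : seq J -> K q) : Prop :=
  din [::] z /\ forall s, size s = 1 -> c s = delta (dface K q) (fun=> z) s.

Lemma row_exact0 q (z : K q) : row_exact q -> din [::] z ->
  (forall s, size s = 1 -> delta (dface K q) (fun=> z) s = 0) -> z = 0.
Proof.
move=> ex Pz z0; have [|b [_ E]] := ex 0 (fun=> z) _ z0; first by case.
by rewrite (E [::]).
Qed.

Lemma aug_coboundary q (z : K q) c : row_exact q -> row_exact q.+1 ->
  aug_rel z c -> augmentation_boundary z <-> cech_coboundary 1 c.
Proof.
move=> ex exS [Pz cz]; split=> [Bz|[b [bP cb]]].
  exists (fun=> z); split=> // -[|//] _; split=> //; split=> //.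
  clear cz; case: q z {ex exS} c Pz Bz => [|q] z c Pz /=; first by move=> ->; rewrite ddiff0.
  by move=> [a Pa <-]; rewrite ddiff_diff.
have [[Pb _] Bb] := bP [::] erefl.
suff -> : z = b [::] by exact: Bb.
apply/eqP; rewrite -subr_eq0; apply/eqP; apply: row_exact0 => //.
  exact: dinB.
case=> // j [|//] _; have := cz [:: j] erefl; rewrite cb //=.
by rewrite !subr0 linearB => ->; rewrite subrr.
Qed.

Lemma aug_cocycle q (c : seq J -> K q) : row_exact q -> row_exact q.+1 ->
  cech_cocycle 1 c -> exists2 z, dcycle [::] z & aug_rel z c.
Proof.
move=> ex exS [cP c0].
have [|b [Pb cb]] := ex 1%N c _ c0; first by move=> s /cP[].
have Pb0 : din [::] (b [::]) by exact: Pb.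
have dE s : size s = 1%N -> c s = delta (dface K q) (fun=> b [::]) s.
  by move=> s1; rewrite cb //; apply: delta_ext; case=> //; rewrite s1.
exists (b [::]); last by split.
split=> //; apply: row_exact0 => //; first exact: din_diff.
move=> s s1; rewrite -(@delta_ext _ _ _ _ (fun u => ddiff u (b u))); last first.
  by case=> //; rewrite s1.
rewrite -(@delta_ddiff _ 0) //; last by case.
rewrite (@delta_ext _ _ _ _ _ (fun=> b [::])) -?dE //; last by case=> //; rewrite s1.
by have [] := cP s s1.
Qed.

Lemma aug_cocycleR q (z : K q) : dcycle [::] z ->
  exists2 c, cech_cocycle 1 c & aug_rel z c.
Proof.
move=> [Pz z0]; exists (delta (dface K q) (fun=> z)) => //; split=> s ss; last first.
  exact/delta_delta/dfaceC.
pose zc (u : seq J) := if u is [::] then z else 0.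
have E : delta (dface K q) (fun=> z) s = delta (dface K q) zc s.
  by apply: delta_ext; case=> //=; rewrite ss.
have Pzc u : size u = 0 -> din u (zc u) by case: u.
split; rewrite E; first by apply: (@delta_din _ 0).
rewrite (@delta_ddiff _ 0) // -[RHS](delta0 (dface K q.+1) s); apply: delta_ext.
by case; rewrite ?ss.
Qed.

(** One step of the staircase: two differentials of the same cochain [b], the horizontal one in [a]
    and the vertical one in [c]. *)
Definition shift_rel q m (a : seq J -> K q) (c : seq J -> K q.+1) : Prop :=
  exists b : seq J -> K q,
    (forall s, size s = m.+1 -> din s (b s) /\ c s = ddiff s (b s)) /\
    forall s, size s = m.+2 -> a s = delta (dface K q) b s.

Lemma shift_coboundary q m a (c : seq J -> K q.+1) : row_exact q ->
  shift_rel m a c -> cech_coboundary m.+2 a -> cech_coboundary m.+1 c.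
Proof.
move=> ex [b [bP ab]] [a' [a'P aa']].
have [s sm|s sm|b' [Pb' bE]] := ex m.+1 (fun u => b u - a' u).
- by apply: dinB; [have [] := bP s sm|have [[]] := a'P s (congr1 _ sm)].
- by rewrite deltaB -ab // -aa' // subrr.
exists (fun u => ddiff u (b' u)); split=> [u su|s sm].
  have Pu := Pb' _ su; split; first by split; [exact: din_diff|exact: ddiff_diff].
  by move=> u0; exists (b' u); rewrite -?u0.
rewrite -(@delta_ddiff _ m) //; last by move=> u su; apply: Pb'; rewrite su.
have [Pb ->] := bP s sm; have [[Pa a0] _] := a'P s (congr1 _ sm).
by rewrite -bE // ddiffB // a0 subr0.
Qed.

Lemma shift_coboundaryR q m a (c : seq J -> K q.+1) : column_exact q ->
  shift_rel m a c -> cech_coboundary m.+1 c -> cech_coboundary m.+2 a.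
Proof.
move=> ex [b [bP ab]] [c' [c'P cc']].
have /boolp.choice[b' b'P] : forall u, exists x : K q, (size u).+1 = m.+1 ->
    din u x /\ ddiff u x = c' u.
  move=> u; have [su|] := pselect ((size u).+1 = m.+1); last by exists 0.
  have [[Pu du] Bu] := c'P u su.
  case: u su Pu du Bu => [|j u] su Pu du Bu.
    by have [a' Pa' <-] := Bu erefl; exists a'.
  by have [//|x Px <-] := ex (j :: u) _ _ Pu du; exists x.
have Pb' u : size u = m -> din u (b' u) by move=> su; have [] := b'P u (congr1 _ su).
exists (fun u => b u - delta (dface K q) b' u); split=> [u [su]|s sm].
  split; last by move=> u0; move: su; rewrite u0.
  have [Pb cb] := bP u su; have Pd := delta_din Pb' su.
  split; first exact: dinB.
  rewrite ddiffB // -cb (delta_ddiff Pb') // cc' //.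
  rewrite (@delta_ext _ _ _ _ _ c') ?subrr // => v; rewrite su => sv.
  by have [] := b'P v sv.
by rewrite deltaB delta_delta ?subr0 ?ab //; exact: dfaceC.
Qed.

Lemma shift_cocycle q m (a : seq J -> K q) : row_exact q ->
  cech_cocycle m.+2 a -> exists2 c, cech_cocycle m.+1 c & shift_rel m a c.
Proof.
move=> ex [aP a0].
have [|b [Pb ab]] := ex m.+2 a _ a0; first by move=> s /aP[].
have Pb1 u : size u = m.+1 -> din u (b u) by move=> su; apply: Pb; rewrite su.
exists (fun u => ddiff u (b u)); last by exists b; split=> // s sm; split=> //; exact: Pb1.
split=> s sm; first by split; [exact/din_diff/Pb1|exact/ddiff_diff/Pb1].
by rewrite -(delta_ddiff Pb1) // -ab //; have [] := aP s sm.
Qed.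

Lemma lift_cocycle q m (c : seq J -> K q.+1) (b : seq J -> K q) :
  cech_cocycle m.+1 c ->
  (forall s, size s = m.+1 -> din s (b s) /\ c s = ddiff s (b s)) ->
  cech_cocycle m.+2 (delta (dface K q) b) /\ shift_rel m (delta (dface K q) b) c.
Proof.
move=> [cP c0] bP; split; last by exists b.
have Pb u : size u = m.+1 -> din u (b u) by move=> su; have [] := bP u su.
split=> s sm; last exact/delta_delta/dfaceC.
split; first exact: delta_din sm.
rewrite (delta_ddiff Pb) // (@delta_ext _ _ _ _ _ c) ?c0 // => u.
by rewrite sm => -[su]; have [] := bP u su.
Qed.

Lemma shift_cocycleR q m (c : seq J -> K q.+1) : column_exact q ->
  cech_cocycle m.+1 c -> exists2 a, cech_cocycle m.+2 a & shift_rel m a c.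
Proof.
move=> ex cc; have [cP c0] := cc.
have /boolp.choice[b bP] : forall s, exists x : K q, size s = m.+1 ->
    din s x /\ c s = ddiff s x.
  move=> s; have [ss|] := pselect (size s = m.+1); last by exists 0.
  have [Pc dc] := cP s ss.
  have [|x Px <-] := ex s _ _ Pc dc; first by move=> s0; rewrite s0 in ss.
  by exists x.
by have [? ?] := lift_cocycle cc bP; exists (delta (dface K q) b).
Qed.

(** The staircase leads from Cech degree [j] in row 0 to Cech degree 0 in row [j], where exactness
    of the row turns cocycles into global cycles. The step from row [q] to row [q + 1] uses the
    columns at [q], hence the bound [q < j]. *)
Theorem augmented_dim j h : (forall q, row_exact q) ->
  (forall q, (q < j)%N -> column_exact q) ->
  quotient_dim (@cech_cocycle 0 j.+1) (@cech_coboundary 0 j.+1) h <->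
  quotient_dim (@dcycle j [::]) (@augmentation_boundary j) h.
Proof.
move=> rex cex.
have S q m h' : column_exact q ->
    quotient_dim (@cech_cocycle q m.+2) (@cech_coboundary q m.+2) h' <->
    quotient_dim (@cech_cocycle q.+1 m.+1) (@cech_coboundary q.+1 m.+1) h'.
  move=> ce; have Rl (a : k) u u' v v' : @shift_rel q m u u' -> shift_rel m v v' ->
      shift_rel m (a *: u + v) (a *: u' + v').
    move=> [b [bP ub]] [b' [b'P vb]]; exists (fun s => a *: b s + b' s); split=> s ss.
      have [P1 E1] := bP s ss; have [P2 E2] := b'P s ss; split; first exact: din_lin.
      by rewrite ddiff_lin // -E1 -E2.
    by rewrite deltaP -ub // -vb.
  split; apply: quotient_dim_transfer.
  - exact: Rl.
  - by move=> z; exact: shift_cocycle.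
  - by move=> z; exact: shift_cocycleR.
  - by move=> z z' r; split; [exact: shift_coboundary r|exact: shift_coboundaryR r].
  - by instantiate (1 := fun c a => shift_rel m a c) => a u u' v v' /=; exact: Rl.
  - by move=> z; exact: shift_cocycleR.
  - by move=> z; exact: shift_cocycle.
  - by move=> z z' r; split; [exact: shift_coboundaryR r|exact: shift_coboundary r].
have chain q m : (q + m = j)%N ->
    quotient_dim (@cech_cocycle 0 j.+1) (@cech_coboundary 0 j.+1) h <->
    quotient_dim (@cech_cocycle q m.+1) (@cech_coboundary q m.+1) h.
  elim: q m => [|q IH] m; first by rewrite add0n => ->.
  rewrite addSnnS => qm; rewrite (IH m.+1) //; apply: S; apply: cex.
  by rewrite -qm addnS ltnS leq_addr.
rewrite (chain j 0%N); last by rewrite addn0.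
have Rl (a : k) u u' v v' : @aug_rel j u u' -> aug_rel v v' ->
    aug_rel (a *: u + v) (a *: u' + v').
  move=> [Pu uE] [Pv vE]; split; first exact: din_lin.
  by move=> s s1; rewrite deltaP -uE // -vE.
split; apply: quotient_dim_transfer.
- by instantiate (1 := fun c a => aug_rel a c) => a u u' v v' /=; exact: Rl.
- by move=> z; exact: aug_cocycle.
- by move=> z; exact: aug_cocycleR.
- by move=> z z' r; have := aug_coboundary (rex j) (rex j.+1) r; tauto.
- exact: Rl.
- by move=> z; exact: aug_cocycleR.
- by move=> z; exact: aug_cocycle.
- by move=> z z' r; exact: aug_coboundary (rex j) (rex j.+1) r.
Qed.

(** For an induction on the degree, in which the columns are known to be exact only below [j]: at
    [j] itself the given lifts [b] of [z] over the members of the cover take the place of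
    exactness. *)
Lemma lift_boundary j (z : K j.+1) (b : seq J -> K j) :
  (forall q, row_exact q) -> (forall q, (q < j)%N -> column_exact q) ->
  quotient_dim (@cech_cocycle 0 j.+2) (@cech_coboundary 0 j.+2) 0 ->
  dcycle [::] z ->
  (forall s, size s = 1 -> din s (b s) /\ delta (dface K j.+1) (fun=> z) s = ddiff s (b s)) ->
  augmentation_boundary z.
Proof.
move=> rex cex van zc bP.
have [c cc r] := aug_cocycleR zc.
apply/(aug_coboundary (rex _) (rex _) r).
have [|ca sr] := @lift_cocycle _ 0 c b cc.
  by move=> s ss; have [? E] := bP s ss; split=> //; have [_ ->] := r.
apply: (shift_coboundary (rex j) sr).
suff : quotient_dim (@cech_cocycle j 2) (@cech_coboundary j 2) 0.
  by move=> /quotient_dim0_sub; apply.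
have chain q m : (q + m = j)%N -> quotient_dim (@cech_cocycle q m.+2) (@cech_coboundary q m.+2) 0.
  elim: q m => [|q IH] m; first by rewrite add0n => ->.
  rewrite addSnnS => qm; have := IH m.+1 qm.
  move=> /quotient_dim0_sub V; apply: quotient_dim0 => c' cc'.
  have ce : column_exact q by apply: cex; rewrite -qm addnS ltnS leq_addr.
  have [a ac ar] := shift_cocycleR ce cc'.
  exact: shift_coboundary (rex q) ar (V _ ac).
by apply: chain; rewrite addn0.
Qed.

End DoubleComplex.

Section Transfer.
Variables (k : fieldType) (J : Type).

(** Nothing is asked at the empty tuple, so an identification made locally, over the members of a
    cover, suffices. *)
Definition kernel_iso (K K' : double_complex k J) (theta : seq J -> K 0 -> K' 0 -> Prop) : Prop :=
  [/\ forall s (a : k) u u' v v', s <> [::] ->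
        theta s u u' -> theta s v v' -> theta s (a *: u + v) (a *: u' + v'),
      forall s u, s <> [::] -> dcycle s u -> exists2 u', dcycle s u' & theta s u u',
      forall s u', s <> [::] -> dcycle s u' -> exists2 u, dcycle s u & theta s u u',
      forall s u u', s <> [::] -> theta s u u' -> u = 0 <-> u' = 0
    & forall s1 j s2 u u', s1 ++ s2 <> [::] -> theta (s1 ++ s2) u u' ->
        theta (s1 ++ j :: s2) (dface K 0 j u) (dface K' 0 j u')].

Definition kernel_rel (K K' : double_complex k J) (theta : seq J -> K 0 -> K' 0 -> Prop)
    m (c : seq J -> K 0) (c' : seq J -> K' 0) : Prop :=
  forall s, size s = m.+1 -> [/\ dcycle s (c s), dcycle s (c' s) & theta s (c s) (c' s)].

Lemma kernel_iso_sym K K' theta : @kernel_iso K K' theta ->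
  @kernel_iso K' K (fun s u u' => theta s u' u).
Proof.
move=> [lin t1 t2 t0 tins]; split=> //.
- by move=> s a u u' v v' s0; exact: lin.
- by move=> s u u' s0 /t0 H; have := H s0; tauto.
- by move=> s1 j s2 u u'; exact: tins.
Qed.

Lemma dcycle_lin (K : double_complex k J) q s (a : k) (u v : K q) :
  dcycle s u -> dcycle s v -> dcycle s (a *: u + v).
Proof.
move=> [Pu u0] [Pv v0]; split; first exact: din_lin.
by rewrite ddiff_lin // u0 v0 scaler0 addr0.
Qed.

Lemma size_neq0 (T : Type) (s : seq T) m : size s = m.+1 -> s <> [::].
Proof. by case: s. Qed.

Lemma kernel_delta K K' theta m c c' : @kernel_iso K K' theta ->
  (forall s, size s = m.+1 -> theta s (c s) (c' s)) ->
  forall s, size s = m.+2 -> theta s (delta (dface K 0) c s) (delta (dface K' 0) c' s).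
Proof.
move=> [lin _ _ _ tins] tc; apply: delta_rel => // s1 j s2 u u' sz.
by apply: tins => s0; rewrite s0 in sz.
Qed.

Lemma kernel_cocycle K K' theta m c : @kernel_iso K K' theta -> cech_cocycle m.+1 c ->
  exists2 c', cech_cocycle m.+1 c' & kernel_rel theta m c c'.
Proof.
move=> iso [cP c0]; have [lin t1 t2 t0 tins] := iso.
have /boolp.choice[c' c'P] : forall s, exists x : K' 0, size s = m.+1 ->
    dcycle s x /\ theta s (c s) x.
  move=> s; have [ss|] := pselect (size s = m.+1); last by exists 0.
  by have [x dx tx] := t1 s _ (size_neq0 ss) (cP s ss); exists x.
have c'0 s : size s = m.+2 -> delta (dface K' 0) c' s = 0.
  move=> ss; have tc u : size u = m.+1 -> theta u (c u) (c' u).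
    by move=> su; have [] := c'P u su.
  by have /(t0 _ _ _ (size_neq0 ss)) := kernel_delta iso tc ss; rewrite c0 // => -[->].
exists c'; first by split=> // s ss; have [] := c'P s ss.
by move=> s ss; have [? ?] := c'P s ss; split=> //; exact: cP.
Qed.

Lemma kernel_coboundary K K' theta m c c' : @kernel_iso K K' theta ->
  kernel_rel theta m c c' -> cech_coboundary m.+1 c -> cech_coboundary m.+1 c'.
Proof.
move=> iso cc' [b [bP cb]]; have [lin t1 t2 t0 tins] := iso.
case: m => [|m] in c c' cc' b bP cb *.
  exists (fun=> 0); split=> [u su|s ss].
    by split=> //; split; [exact: din0|exact: ddiff0].
  rewrite delta0; have [_ _ t] := cc' s ss.
  apply/(t0 _ _ _ (size_neq0 ss) t); rewrite cb //.
  case: s ss {t} => // j [|//] _ /=; rewrite subr0.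
  by have [_ /(_ erefl) ->] := bP [::] erefl; rewrite linear0.
have /boolp.choice[b' b'P] : forall s, exists x : K' 0, size s = m.+1 ->
    dcycle s x /\ theta s (b s) x.
  move=> s; have [ss|] := pselect (size s = m.+1); last by exists 0.
  have [db _] := bP s (congr1 _ ss).
  by have [x dx tx] := t1 s _ (size_neq0 ss) db; exists x.
exists b'; split=> [u [su]|s ss].
  by have [? _] := b'P u su; split=> // u0; rewrite u0 in su.
have tb u : size u = m.+1 -> theta u (b u) (b' u).
  by move=> su; have [] := b'P u su.
have [_ _ tc] := cc' s ss; have s0 := size_neq0 ss.
have := lin s (-1) _ _ _ _ s0 (kernel_delta iso tb ss) tc.
move=> /(t0 _ _ _ s0) [+ _]; rewrite cb // scaleN1r addNr => /(_ erefl) /eqP.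
by rewrite scaleN1r addrC subr_eq0 => /eqP.
Qed.

Lemma cech_transfer K K' theta m h : @kernel_iso K K' theta ->
  quotient_dim (@cech_cocycle _ _ K 0 m.+1) (@cech_coboundary _ _ K 0 m.+1) h ->
  quotient_dim (@cech_cocycle _ _ K' 0 m.+1) (@cech_coboundary _ _ K' 0 m.+1) h.
Proof.
move=> iso; have iso' := kernel_iso_sym iso.
apply: (quotient_dim_transfer (rho := kernel_rel theta m)).
- move=> a u u' v v' uu' vv' s ss.
  have [du du' tu] := uu' s ss; have [dv dv' tv] := vv' s ss.
  have [lin _ _ _ _] := iso.
  by split; [exact: dcycle_lin|exact: dcycle_lin|exact: lin (size_neq0 ss) _ _].
- by move=> z; exact: kernel_cocycle.
- move=> z' /(kernel_cocycle iso')[z zc zz']; exists z => // s /zz'[].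
  by split.
- move=> z z' r; split; first exact: kernel_coboundary r.
  by apply: kernel_coboundary iso' _ => s /r[].
Qed.

End Transfer.

Section FunctionCut.
Variables (k : fieldType) (T : Type).

Definition fcut (A : T -> Prop) (f : T -> k^o) : T -> k^o :=
  fun t => if `[< A t >] then f t else 0.

Fact fcut_linear A : linear (fcut A).
Proof.
move=> a f g; apply/funext => t.
change (fcut A (a *: f + g) t = a * fcut A f t + fcut A g t).
by rewrite /fcut; case: asboolP => // _; rewrite mulr0 addr0.
Qed.

HB.instance Definition _ A :=
  GRing.isLinear.Build k (T -> k^o) (T -> k^o) _ (fcut A) (fcut_linear A).

Lemma fcutC A B f : fcut A (fcut B f) = fcut B (fcut A f).
Proof. by apply/funext => t; rewrite /fcut; case: asboolP => //; case: asboolP. Qed.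

Definition face (J : Type) (sub : J -> T -> Prop) (j : J) : {linear (T -> k^o) -> (T -> k^o)} :=
  fcut (sub j).

Variables (J : finType) (sub : J -> T -> Prop).

Lemma delta_weighted (c : J -> seq J -> (T -> k^o)) (w : J -> T -> k) s t :
  delta (face sub) (fun u t => \sum_j w j t * c j u t) s t =
  \sum_j w j t * delta (face sub) (c j) s t.
Proof.
elim: s c => [|i s IH] c.
  by rewrite /= [LHS]/(0 : k) big1 // => j _; rewrite mulr0.
change (fcut (sub i) (fun t => \sum_j w j t * c j s t) t -
  delta (face sub) (fun u t => \sum_j w j t * c j (i :: u) t) s t =
  \sum_j w j t * (fcut (sub i) (c j s) t - delta (face sub) (fun u => c j (i :: u)) s t)).
rewrite (IH (fun j u => c j (i :: u))) /fcut.
case: asboolP => _.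
  by rewrite -sumrB; apply: eq_bigr => j _; rewrite mulrBr.
by rewrite sub0r -sumrN; apply: eq_bigr => j _; rewrite sub0r mulrN.
Qed.

Definition contract (w : J -> T -> k) (c : seq J -> (T -> k^o)) (u : seq J) : T -> k^o :=
  fun t => \sum_j w j t * c (j :: u) t.

(** The cocycle condition on [j :: s] writes [c s] on [sub j] as the differential of [c] with [j]
    put in front. Averaging with weights supported there gives the contraction by a partition of
    unity. *)
Lemma delta_contract w c s t :
  (forall j t, ~ sub j t -> w j t = 0) ->
  (forall j, delta (face sub) c (j :: s) = 0) ->
  delta (face sub) (contract w c) s t = (\sum_j w j t) * c s t.
Proof.
move=> w0 c0; rewrite (delta_weighted (fun j u => c (j :: u))) mulr_suml.
apply: eq_bigr => j _.
have [st|/w0->] := pselect (sub j t); last by rewrite !mul0r.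
have /(congr1 (fun f : T -> k^o => f t)) := c0 j.
change (fcut (sub j) (c s) t - delta (face sub) (fun u => c (j :: u)) s t = 0 -> 
  w j t * delta (face sub) (fun u => c (j :: u)) s t = w j t * c s t).
by rewrite /fcut asboolT // => /eqP; rewrite subr_eq0 => /eqP <-.
Qed.

End FunctionCut.

Section OpenCover.
Variables (X : topologicalType) (J : eqType) (W0 : opens X) (W : J -> opens X).

Definition meets (s : seq J) : opens X := foldr (fun j U => opensI (W j) U) W0 s.

Lemma meetsP s x : oset (meets s) x <-> oset W0 x /\ forall j, j \in s -> oset (W j) x.
Proof.
elim: s => [|i s IH] /=; first by split=> [|[]].
split=> [[Wi /IH[? H]]|[W0x H]].
  by split=> // j; rewrite inE => /predU1P[->//|/H].
by split; [apply: H; rewrite mem_head|apply/IH; split=> // j js; apply: H; rewrite inE js orbT].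
Qed.

Lemma meets_insP s1 j s2 x :
  oset (meets (s1 ++ j :: s2)) x <-> oset (W j) x /\ oset (meets (s1 ++ s2)) x.
Proof.
rewrite !meetsP; split=> [[W0x H]|[Wj [W0x H]]].
  split; first by apply: H; rewrite mem_cat mem_head orbT.
  by split=> // i; rewrite mem_cat => ii; apply: H; rewrite mem_cat inE orbCA ii orbT.
split=> // i; rewrite mem_cat inE orbCA => /predU1P[->//|ii].
by apply: H; rewrite mem_cat.
Qed.

Lemma meets_ins s1 j s2 : meets (s1 ++ j :: s2) `<=` meets (s1 ++ s2).
Proof. by move=> x /meets_insP[]. Qed.

End OpenCover.

Lemma opens_eq (X : topologicalType) (U V : opens X) :
  (forall x, oset U x <-> oset V x) -> U = V.
Proof.
case: U V => [U oU] [V oV] /= UV.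
have E : U = V by apply/seteqP; split=> x /UV.
by rewrite E in oU *; congr Opens; exact: Prop_irrelevance.
Qed.

(** * Cech cochains with values in the injective resolution *)

Section ResolutionComplex.
Variables (k : fieldType) (X : topologicalType) (F : sheaf k X).
Variables (J : finType) (W0 : opens X) (W : J -> opens X).

Local Notation Wn := (meets W0 W).
Local Notation Xi q := (stage_pts (stages F q)).
Local Notation pi q := (@stage_pi k X (stages F q)).
Local Notation R q := (germ_term F q).
Local Notation fsec q U := (fsections k (pi q) U).

Definition rsub q (j : J) (xi : Xi q) : Prop := oset (W j) (pi q xi).

Definition rin q (s : seq J) (f : Xi q -> k^o) : Prop :=
  forall xi, ~ oset (Wn s) (pi q xi) -> f xi = 0.

Lemma rinP q s f : @rin q s f -> f \in support_pred (k := k) (pi q) (Wn s).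
Proof. by move=> h; apply/asboolP. Qed.

Definition rsection q s (f : Xi q -> k^o) (h : rin s f) : fsec q (Wn s) :=
  FSections (rinP h).

(** The differential acts on sections over [Wn s]; functions with larger support receive the default
    value 0. *)
Definition rdif q s (f : Xi q -> k^o) : Xi q.+1 -> k^o :=
  if pselect (rin s f) is left h then fval (germ_diff F q (Wn s) (rsection h) : fsec q.+1 (Wn s))
  else 0.

Lemma rdifE q s (sg : fsec q (Wn s)) :
  rdif s (fval sg) = fval (germ_diff F q (Wn s) sg : fsec q.+1 (Wn s)).
Proof.
rewrite /rdif; case: pselect => [h|]; last by case=> xi; exact: fval0.
by congr (fval (germ_diff F q (Wn s) _ : fsec q.+1 (Wn s))); apply: val_inj.
Qed.

Lemma rin_fval q s (sg : fsec q (Wn s)) : rin s (fval sg).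
Proof. by move=> xi; exact: fval0. Qed.

Lemma rinE q s f : @rin q s f -> exists sg : fsec q (Wn s), f = fval sg.
Proof. by move=> h; exists (rsection h). Qed.

Lemma rface_res q s1 j s2 (sg : fsec q (Wn (s1 ++ s2))) :
  face k (@rsub q) j (fval sg) = fval (fres (@meets_ins X J W0 W s1 j s2) sg).
Proof.
apply/funext => xi; rewrite /= /fcut /cut /rsub.
have [Wx|nW] := pselect (oset (Wn (s1 ++ j :: s2)) (pi q xi)).
  by rewrite !asboolT //; have /meets_insP[] := Wx.
rewrite (asboolF nW); case: asboolP => // Wj; apply: fval0 => Wx.
by apply: nW; apply/meets_insP.
Qed.

Lemma fval_lin q U (a : k) (u v : fsec q U) : fval (a *: u + v) = a *: fval u + fval v.
Proof. by []. Qed.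

Fact rface_comm q i j v : face k (@rsub q) i (face k (@rsub q) j v) = face k (@rsub q) j (face k (@rsub q) i v) :> (_ -> k^o).
Proof. exact: fcutC. Qed.

Fact rin_zero q s : rin s (0 : Xi q -> k^o). Proof. by []. Qed.

Fact rin_lin q s (a : k) (u v : Xi q -> k^o) : rin s u -> rin s v -> rin s (a *: u + v).
Proof.
move=> Pu Pv xi nx; change (a * u xi + v xi = 0).
by rewrite Pu // Pv // mulr0 addr0.
Qed.

Fact rin_ins q s1 j s2 (v : Xi q -> k^o) : rin (s1 ++ s2) v -> rin (s1 ++ j :: s2) (face k (@rsub q) j v).
Proof. by move=> /rinE[sg ->]; rewrite rface_res; exact: rin_fval. Qed.

Fact rin_diff q s (v : Xi q -> k^o) : rin s v -> rin s (rdif s v).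
Proof. by move=> /rinE[sg ->]; rewrite rdifE; exact: rin_fval. Qed.

Fact rdiff_lin q s (a : k) (u v : Xi q -> k^o) : rin s u -> rin s v ->
  rdif s (a *: u + v) = a *: rdif s u + rdif s v.
Proof.
move=> /rinE[sg ->] /rinE[tg ->].
by rewrite -(fval_lin a sg tg) !rdifE -fval_lin; congr (fval _); exact: linearP.
Qed.

Fact rdiff_ins q s1 j s2 (v : Xi q -> k^o) : rin (s1 ++ s2) v ->
  rdif (s1 ++ j :: s2) (face k (@rsub q) j v) = face k (@rsub q.+1) j (rdif (s1 ++ s2) v).
Proof.
move=> /rinE[sg ->]; rewrite rface_res !rdifE rface_res.
congr (fval _); exact: (shom_res (germ_diff F q) (@meets_ins X J W0 W s1 j s2) sg).
Qed.

Lemma germ_dd q U (s : R q U) : germ_diff F q.+1 U (germ_diff F q U s) = 0.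
Proof.
apply/cogerm_exact => x Ux; exists U, (@subset_refl _ U); split=> //.
by exists s; rewrite res_id.
Qed.

Fact rdiff_diff q s (v : Xi q -> k^o) : rin s v -> rdif s (rdif s v) = 0.
Proof. by move=> /rinE[sg ->]; rewrite !rdifE germ_dd. Qed.

Definition resolution_complex : double_complex k J :=
  @DoubleComplex k J (fun q => Xi q -> k^o) (fun q => face k (@rsub q)) rin rdif
    rface_comm rin_zero rin_lin rin_ins rin_diff rdiff_lin rdiff_ins rdiff_diff.

Hypothesis W0W : forall x, oset W0 x -> exists j, oset (W j) x.

(** The terms consist of arbitrary functions, so a discontinuous partition of unity is allowed: each
    point chooses one member of the cover that contains it. *)
Lemma resolution_row_exact q : row_exact resolution_complex q.
Proof.
move=> m c cP c0.
pose w (j : J) (xi : Xi q) : k :=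
  if pselect (oset W0 (pi q xi)) is left h then (j == sval (cid (W0W h)))%:R else 0.
have w0 j xi : ~ rsub j xi -> w j xi = 0.
  rewrite /w; case: pselect => // h nj; case: cid => i /= Wi.
  by case: eqVneq => // ji; case: nj; rewrite /rsub ji.
have w1 xi : oset W0 (pi q xi) -> \sum_j w j xi = 1.
  rewrite /w; case: pselect => // h _; rewrite (bigD1 (sval (cid (W0W h)))) //=.
  by rewrite eqxx big1 ?addr0 // => i /negPf ->.
exists (contract w c); split=> [u su xi nx|s ss].
  rewrite /contract big1 // => j _.
  have [Wj|/w0->] := pselect (rsub j xi); last by rewrite mul0r.
  rewrite (cP (j :: u)) ?mulr0 //= => -[_]; exact: nx.
apply/funext => xi; rewrite delta_contract //; last by move=> j; apply: c0; rewrite /= ss.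
have [W0x|nW] := pselect (oset W0 (pi q xi)); first by rewrite w1 // mul1r.
by rewrite (cP s ss) ?mulr0 // => /meetsP[/nW].
Qed.

End ResolutionComplex.

(** * Acyclic open sets and the criteria of Leray and Cartan *)

Section Acyclicity.
Variables (k : fieldType) (X : topologicalType) (F : sheaf k X).

Definition acyclic_at q (U : opens X) : Prop :=
  forall z : germ_term F q.+1 U, germ_diff F q.+1 U z = 0 ->
  exists r : germ_term F q U, germ_diff F q U r = z.

Definition acyclic (U : opens X) : Prop := forall q, acyclic_at q U.

Lemma acyclic_column (J : finType) (W0 : opens X) (W : J -> opens X) q :
  (forall s, s <> [::] -> acyclic_at q (meets W0 W s)) ->
  column_exact (resolution_complex F W0 W) q.
Proof.
move=> ac s z s0 /rinE[sg ->]; rewrite /= rdifE => d0.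
have [|r rE] := ac s s0 sg; first by apply: val_inj.
by exists (fval r); [exact: rin_fval|rewrite /= rdifE rE].
Qed.

Lemma cohomology_dimP (J : finType) (W : J -> opens X) j h :
  quotient_dim (@dcycle _ _ (resolution_complex F (whole X) W) j [::])
    (@augmentation_boundary _ _ (resolution_complex F (whole X) W) j) h ->
  cohomology_dim F j h.
Proof.
move=> [b [bP H]]; exists (germ_resolution F).
have /boolp.choice[b' b'P] : forall i, exists x : germ_term F j (whole X),
    b i = fval (x : fsections k (@stage_pi k X (stages F j)) (whole X)).
  by move=> i; have [/rinE[sg ->] _] := bP i; exists sg.
exists b'; split.
  move=> i; have [_] := bP i; rewrite b'P /= (rdifE (s := [::])) => E.
  by apply: val_inj.
move=> z z0.
have [|c [cB cu]] := H (fval (z : fsections k (@stage_pi k X (stages F j)) (whole X))).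
  split; first exact: (rin_fval (s := [::])).
  by rewrite /= (rdifE (s := [::])) (z0 : germ_diff F j (whole X) z = 0).
have E (c' : 'rV_h) : augmentation_boundary (K := resolution_complex F (whole X) W)
    (fval (z : fsections k (@stage_pi k X (stages F j)) (whole X)) - \sum_(i < h) c' 0 i *: b i) <->
    @coboundaries _ _ _ (germ_resolution F) j (z - \sum_(i < h) c' 0 i *: b' i).
  have -> : fval (z : fsections k (@stage_pi k X (stages F j)) (whole X)) - \sum_(i < h) c' 0 i *: b i =
      fval (z - \sum_(i < h) c' 0 i *: b' i : fsections k (@stage_pi k X (stages F j)) (whole X)).
    rewrite -[RHS]/(val _) raddfB; congr (_ - _); rewrite [RHS]raddf_sum.
    by apply: eq_bigr => i _; rewrite b'P.
  move: (z - _) => y; case: j {b bP H b' b'P z z0 c cB cu c'} y => [|j] y /=.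
    split=> [y0|->//]; exact: val_inj.
  split=> [[a /rinE[sg ->]]|[a _ <-]].
    rewrite (rdifE (s := [::])) => e; exists sg => //; exact: val_inj.
  by exists (fval (a : fsections k (@stage_pi k X (stages F j)) (whole X)));
    [exact: (rin_fval (s := [::]))|rewrite (rdifE (s := [::]))].
by exists c; split; [exact/E|move=> c' /E/cu].
Qed.

End Acyclicity.

(** Local lifts along a monomorphism are unique, so they agree on overlaps and glue. *)
Lemma mono_in_image (k : fieldType) (X : topologicalType) (F G : sheaf k X)
    (f : sheaf_hom F G) (U : opens X) (s : G U) :
  sheaf_mono f -> in_image f s -> exists t, f U t = s.
Proof.
move=> mono im.
have P (x : {x | oset U x}) : {V : opens X | V `<=` U & oset V (sval x) /\
    exists t : F V, forall h : V `<=` U, f V t = res G h s}.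
  apply: cid2; have [V [h [Vx [u e]]]] := im _ (svalP x).
  by exists V => //; split=> //; exists u => h'; rewrite (res_irr h' h) -e.
pose W x := s2val (P x); pose hW x : W x `<=` U := s2valP (P x).
have tP x : {t : F (W x) | forall h : W x `<=` U, f (W x) t = res G h s}.
  by apply: cid; have [] := s2valP' (P x).
have UW : U `<=` \bigcup_x W x.
  by move=> x Ux; exists (exist _ x Ux) => //; have [] := s2valP' (P (exist _ x Ux)).
have [|t tE] := sheaf_glue hW UW (s := fun x => sval (tP x)).
  move=> i j O hi hj; apply: (mono O).
  rewrite !shom_res (svalP (tP i) (hW i)) (svalP (tP j) (hW j)).
  by rewrite (res_comp (hW i) hi (subset_trans hi (hW i))) (res_comp (hW j) hj (subset_trans hi (hW i))).
exists t; apply/eqP; rewrite -subr_eq0; apply/eqP.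
apply: (sheaf_separated (hW := hW)) => // x.
by rewrite linearB -shom_res tE (svalP (tP x) (hW x)) subrr.
Qed.

Section Leray.
Variables (k : fieldType) (X : topologicalType) (F : sheaf k X).

Definition cech_vanish (J : finType) (W0 : opens X) (W : J -> opens X) : Prop :=
  forall m, quotient_dim
    (@cech_cocycle _ _ (resolution_complex F W0 W) 0 m.+2)
    (@cech_coboundary _ _ (resolution_complex F W0 W) 0 m.+2) 0.

Lemma leray_acyclic (J : finType) (W0 : opens X) (W : J -> opens X) :
  (forall x, oset W0 x -> exists j, oset (W j) x) ->
  (forall s, s <> [::] -> acyclic F (meets W0 W s)) ->
  cech_vanish W0 W -> acyclic F W0.
Proof.
move=> cov ac van q z z0.
have rex := resolution_row_exact (F := F) cov.
have cex q' : (q' < q.+1)%N -> column_exact (resolution_complex F W0 W) q'.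
  by move=> _; apply: acyclic_column => s s0; exact: ac.
have /augmented_dim-/(_ rex cex)/quotient_dim0_sub V := van q.
pose zz : fsections k (@stage_pi k X (stages F q.+1)) (meets W0 W [::]) := z.
have [|a /rinE[sg ->]] := V (fval zz).
  split; first exact: rin_fval.
  by rewrite /= (rdifE zz) (z0 : germ_diff F q.+1 (meets W0 W [::]) zz = 0).
by rewrite /= rdifE => e; exists sg; apply: val_inj.
Qed.

(** Induction on the degree. A cocycle is locally a boundary, so it is a boundary on the members of
    some cover provided by the hypothesis. Their intersections belong to [B] and are acyclic in
    lower degrees, and the vanishing of Cech cohomology lets the local primitives be corrected to a
    global one. *)
Lemma cartan_acyclic (B : opens X -> Prop) :
  (forall (W0 : opens X) (Q : opens X -> Prop), B W0 ->
     (forall x, oset W0 x -> exists U : opens X, [/\ oset U x, U `<=` W0 & Q U]) ->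
     (forall U V : opens X, U `<=` V -> Q V -> Q U) ->
     exists N (W : 'I_N -> opens X),
     [/\ forall j, Q (W j),
         forall x, oset W0 x -> exists j, oset (W j) x,
         forall s, B (meets W0 W s) & cech_vanish W0 W]) ->
  forall U, B U -> acyclic F U.
Proof.
move=> ref U BU q; move: U BU; have [m] := ubnP q.
elim: m q => // m IH q qm W0 BW z z0.
(* [Q] says that [z] becomes a boundary on [V], a property inherited by smaller open sets. *)
pose Q (V : opens X) := V `<=` W0 /\ forall h : V `<=` W0, exists r : germ_term F q V,
  germ_diff F q V r = res (germ_term F q.+1) h z.
have [|U V UV [VW H]|N [W [QW cov BWs van]]] := ref W0 Q BW.
- have /cogerm_exact im := z0.
  move=> x /im[V [h [Vx [r rE]]]]; exists V; split=> //; split=> // h'.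
  by exists r; rewrite (res_irr h' h).
- split=> [|h]; first exact: subset_trans VW.
  by have [r rE] := H VW; exists (res _ UV r); rewrite shom_res rE (res_comp VW UV h).
have rex0 : forall j, exists r : germ_term F q (meets W0 W [:: j]),
    forall h : meets W0 W [:: j] `<=` W0,
    germ_diff F q _ r = res (germ_term F q.+1) h z.
  move=> j; have [WjW H] := QW j; have [r rE] := H WjW.
  have i : meets W0 W [:: j] `<=` W j by move=> x [].
  exists (res _ i r) => h.
  by rewrite shom_res rE (res_comp WjW i h).
pose r j := sval (cid (rex0 j)).
have rP j (h : meets W0 W [:: j] `<=` W0) :
    germ_diff F q _ (r j) = res (germ_term F q.+1) h z := svalP (cid (rex0 j)) h.
have rex := resolution_row_exact (F := F) cov.
pose zz : fsections k (@stage_pi k X (stages F q.+1)) (meets W0 W [::]) := z.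
pose b (s : seq 'I_N) : stage_pts (stages F q) -> k^o :=
  if s is [:: j] then fval (r j : fsections k _ (meets W0 W [:: j])) else 0.
have := @lift_boundary _ _ (resolution_complex F W0 W) q (fval zz) b rex.
have cex q' : (q' < q)%N -> column_exact (resolution_complex F W0 W) q'.
  by move=> qq; apply: acyclic_column => s s0; apply: IH => //; exact: leq_trans qq _.
move=> /(_ cex (van _)) [].
- split; first exact: rin_fval.
  by rewrite /= (rdifE zz) (z0 : germ_diff F q.+1 (meets W0 W [::]) zz = 0).
- case=> // j [|//] _; split; first exact: rin_fval.
  have i : meets W0 W [:: j] `<=` W0 by move=> x [].
  rewrite [RHS](rdifE (s := [:: j]) (r j)) (rP j i) /= subr0.
  apply/funext => xi; rewrite /= /fcut /cut /rsub /=.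
  case: asboolP => [Wj|nW]; case: asboolP => [[Wj' W0x]|nI] //.
    by apply: fval0 => W0x; apply: nI.
- move=> a /rinE[sg ->]; rewrite /= rdifE => e; exists sg; exact: val_inj.
Qed.

End Leray.

Section PlainComplex.
Variables (k : fieldType) (T : Type) (J : Type) (sub : J -> T -> Prop).
Variable P : seq J -> (T -> k^o) -> Prop.
Hypothesis P0 : forall s, P s 0.
Hypothesis P_lin : forall s (a : k) u v, P s u -> P s v -> P s (a *: u + v).
Hypothesis P_ins : forall s1 j s2 v, P (s1 ++ s2) v -> P (s1 ++ j :: s2) (face k sub j v).

(** A presheaf of functions viewed as a double complex: with zero vertical differential every
    element of [P s] is a cycle, so row 0 is the Cech complex of [P]. *)
Definition plain_complex : double_complex k J.
Proof.
refine (@DoubleComplex k J (fun=> T -> k^o) (fun=> face k sub) (fun=> P)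
  (fun _ _ _ => 0) _ _ _ _ _ _ _ _) => //.
- by move=> _ i j v; exact: fcutC.
- by move=> *; rewrite scaler0 addr0.
- by move=> *; rewrite linear0.
Defined.

Lemma plain_vanish m :
  (forall c, (forall s, size s = m.+2 -> P s (c s)) ->
     (forall s, size s = m.+3 -> delta (face k sub) c s = 0) ->
     exists b, (forall u, size u = m.+1 -> P u (b u)) /\
       forall s, size s = m.+2 -> c s = delta (face k sub) b s) ->
  quotient_dim (@cech_cocycle _ _ plain_complex 0 m.+2)
    (@cech_coboundary _ _ plain_complex 0 m.+2) 0.
Proof.
move=> H; apply: quotient_dim0 => c [cP c0].
have [s ss|b [Pb cb]] := H c _ c0; first by have [] := cP s ss.
exists b; split=> // u [su]; split; first by split=> //; exact: Pb.
by move=> u0; rewrite u0 in su.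
Qed.

End PlainComplex.

(** * Laurent monomials and the Nullstellensatz *)

Section InfiniteField.
Variable k : closedFieldType.

Lemma fresh_element (s : seq k) : exists t, t \notin s.
Proof.
pose p : {poly k} := \prod_(a <- s) ('X - a%:P) + 1.
have [->|sn] := eqVneq s [::]; first by exists 0.
have : size p != 1.
  rewrite size_polyDl ?size_prod_XsubC ?size_poly1 //; first by case: (s) sn.
  by case: (s) sn.
move=> /closed_rootP[t /rootP pt]; exists t; apply/negP => ts.
move: pt; rewrite hornerD hornerC horner_prod (big_rem t) //= hornerXsubC subrr.
by rewrite mul0r add0r => /eqP; rewrite oner_eq0.
Qed.

Lemma expr_neq1 m : exists2 t : k, t != 0 & t ^+ m.+1 != 1.
Proof.
have [c] := fresh_element [:: 0; 1]; rewrite !inE negb_or => /andP[c0 c1].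
have : size ('X^(m.+1) - c%:P) != 1 by rewrite size_XnsubC.
move=> /closed_rootP[t /rootP]; rewrite hornerD hornerXn hornerN hornerC.
move=> /eqP; rewrite subr_eq0 => /eqP tc; exists t; last by rewrite tc.
by apply: contra_neq c0 => t0; rewrite -tc t0 expr0n.
Qed.

Lemma exprz_neq (a b : int) : a != b -> exists2 t : k, t != 0 & t ^ a != t ^ b.
Proof.
move=> ab; wlog lab : a b ab / (a < b)%R.
  move=> W; have := ab; rewrite neq_lt => /orP[lab|lba]; first exact: W.
  have [|t t0 H] := W b a _ lba; first by rewrite eq_sym.
  by exists t => //; rewrite eq_sym.
have [m mE] : exists m : nat, b = a + m.+1%:Z.
  by exists (`|b - a|%N.-1); lia.
have [t t0 t1] := expr_neq1 m; exists t => //.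
rewrite mE expfzDr // -[X in X == _]mulr1; apply: contra_neq t1.
by move=> /mulfI -> //; rewrite expfz_neq0.
Qed.

Section Monomials.
Variable I : finType.

Definition monomial (e : {ffun I -> int}) (z : I -> k) : k := \prod_i z i ^ e i.

Lemma monomialM e (z w : I -> k) : (forall i, z i != 0) -> (forall i, w i != 0) ->
  monomial e (fun i => z i * w i) = monomial e z * monomial e w.
Proof.
move=> z0 w0; rewrite /monomial -big_split; apply: eq_bigr => i _.
by rewrite exprzMl // unitfE.
Qed.

Lemma monomial_neq0 e (z : I -> k) : (forall i, z i != 0) -> monomial e z != 0.
Proof. by move=> z0; apply/prodf_neq0 => i _; rewrite expfz_neq0. Qed.

Lemma monomial_neq e e' : e != e' ->
  exists2 w : I -> k, (forall i, w i != 0) & monomial e w != monomial e' w.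
Proof.
move=> ee; have [i ii] : exists i, e i != e' i.
  apply/existsP; apply: contraR ee => /existsPn H; apply/eqP/ffunP => i.
  by apply/eqP; have := H i; rewrite negbK.
have [t t0 tt] := exprz_neq ii.
exists (fun j => if j == i then t else 1).
  by move=> j; case: ifP => // _; rewrite oner_eq0.
rewrite /monomial (bigD1 i) //= [X in _ != X](bigD1 i) //= eqxx.
by rewrite !big1 ?mulr1 // => j /negPf ->; rewrite exp1rz.
Qed.

(* Dedekind's independence of characters, on the torus. *)
Lemma monomial_independent (A : eqType) (r : seq A) (ex : A -> {ffun I -> int}) (c : A -> k) :
  uniq r -> {in r &, injective ex} ->
  (forall z : I -> k, (forall i, z i != 0) -> \sum_(a <- r) c a * monomial (ex a) z = 0) ->
  forall a, a \in r -> c a = 0.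
Proof.
elim: r c => // b r IH c /andP[br ur] inj H.
have cr a : a \in r -> c a = 0.
  move=> ar; have ab : ex a != ex b.
    apply: contraNneq br => /inj; rewrite !inE ar eqxx orbT => /(_ isT isT) <-.
    by [].
  have [w w0 wab] := monomial_neq ab.
  have inj' : {in r &, injective ex}.
    by move=> x y xr yr; apply: inj; rewrite inE ?xr ?yr orbT.
  suff /eqP : c a * (monomial (ex a) w - monomial (ex b) w) = 0.
    by rewrite mulf_eq0 subr_eq0 (negPf wab) orbF => /eqP.
  apply: (IH (fun a => c a * (monomial (ex a) w - monomial (ex b) w))) ar => // z z0.
  have zw0 i : z i * w i != 0 by rewrite mulf_neq0.
  have E1 := H _ zw0; have E2 := H z z0; rewrite !big_cons in E1 E2.
  transitivity ((\sum_(a <- r) c a * monomial (ex a) (fun i => z i * w i)) -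
      monomial (ex b) w * \sum_(a <- r) c a * monomial (ex a) z).
    rewrite mulr_sumr -sumrB; apply: eq_bigr => x _.
    by rewrite monomialM //; ring.
  move/eqP: E1; rewrite addrC addr_eq0 => /eqP ->.
  move/eqP: E2; rewrite addrC addr_eq0 => /eqP ->.
  by rewrite monomialM //; ring.
move=> a; rewrite inE => /predU1P[->|]; last exact: cr.
have := H (fun=> 1) (fun=> oner_neq0 _); rewrite big_cons big1_seq ?addr0.
  by move=> /eqP; rewrite mulf_eq0 (negPf (monomial_neq0 _ (fun=> oner_neq0 _))) orbF => /eqP.
by move=> x /= xr; rewrite cr // mul0r.
Qed.

End Monomials.

End InfiniteField.

Section PolynomialFunctions.
Variable k : closedFieldType.
Local Notation mp n := (mpoly.mpoly n k).
Local Notation mvar i := (mpoly.mpolyX k (mpoly.mnm1 i)).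
Local Notation mcst n c := (mpoly.mpolyC n c).

Lemma mpoly_closed n (P : mp n -> Prop) :
  (forall c, P (mcst n c)) -> (forall i, P (mvar i)) ->
  (forall p q, P p -> P q -> P (p + q)) -> (forall p q, P p -> P q -> P (p * q)) ->
  forall p, P p.
Proof.
move=> PC PX PD PM p; rewrite [p]mpoly.mpolyE.
have P0 : P 0 by have := PC 0; rewrite mpoly.mpolyC0.
have P1 : P 1 by exact: PC.
apply: (big_ind P P0 PD) => m _; rewrite -mpoly.mul_mpolyC; apply: (PM) => //.
rewrite mpoly.mpolyXE_id; apply: (big_ind P P1 PM) => i _.
by elim: (m i) => [|j IH]; rewrite ?expr0 // exprS; apply: (PM).
Qed.

Lemma mpoly_rmorph_eq n (S : comNzRingType) (f g : {rmorphism mp n -> S}) :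
  (forall c, f (mcst n c) = g (mcst n c)) -> (forall i, f (mvar i) = g (mvar i)) -> f =1 g.
Proof.
move=> fC fX; apply: mpoly_closed => // p q E E'; first by rewrite !rmorphD E E'.
by rewrite !rmorphM E E'.
Qed.

Definition mnm_exp n (m : mpoly.multinom n) : {ffun 'I_n -> int} := [ffun i => (m i)%:Z].

Lemma mnm_exp_inj n : injective (@mnm_exp n).
Proof.
move=> m m' /ffunP E; apply/mpoly.mnmP => i.
by have := E i; rewrite !ffunE => -[].
Qed.

Lemma meval_monomials n (p : mp n) z :
  mpoly.meval z p = \sum_(m <- mpoly.msupp p) mpoly.mcoeff m p * monomial (mnm_exp m) z.
Proof.
rewrite mpoly.mevalE; apply: eq_bigr => m _; congr (_ * _).
by apply: eq_bigr => i _; rewrite ffunE.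
Qed.

Lemma meval_eq0 n (p : mp n) :
  (forall z, (forall i, z i != 0) -> mpoly.meval z p = 0) -> p = 0.
Proof.
move=> H; apply/mpoly.mpolyP => m; rewrite mpoly.mcoeff0.
have [mp|/mpoly.memN_msupp_eq0->//] := boolP (m \in mpoly.msupp p).
apply: (@monomial_independent _ _ _ (mpoly.msupp p) (@mnm_exp n) (fun m => mpoly.mcoeff m p)) => //.
- by move=> x y _ _; exact: mnm_exp_inj.
by move=> z z0; rewrite -meval_monomials H.
Qed.

End PolynomialFunctions.

Section Elimination.

(* N is the norm of g modulo f, that is, the determinant of the
   multiplication by g on A[X]/(f). *)
Lemma monic_elimination (A : comNzRingType) (k : fieldType) (f g : {poly A}) :
  f \is monic ->
  exists N a b, N%:P = a * f + b * g /\
    forall psi : {rmorphism A -> k}, map_poly psi g = 1 -> psi N = 1.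
Proof.
move=> fm; case sf : (size f) => [|[|m]].
- by move/eqP: sf; rewrite size_poly_eq0 => /eqP f0; move: fm; rewrite f0 monicE lead_coef0 eq_sym oner_eq0.
- exists 1, 1, 0; rewrite mul0r addr0 mul1r; split; last by move=> psi _; exact: rmorph1.
  have /eqP/size_poly1P[c _ fc] := sf; move: fm; rewrite fc monicE lead_coefC => /eqP ->.
  by [].
pose q i := Pdiv.Ring.rdivp (g * 'X^i) f; pose r i := Pdiv.Ring.rmodp (g * 'X^i) f.
have E i : g * 'X^i = q i * f + r i by exact: Pdiv.RingMonic.rdivp_eq.
have sr i : (size (r i) <= m.+1)%N.
  by rewrite -ltnS -sf; apply: Pdiv.Ring.ltn_rmodpN0; exact: monic_neq0.
pose M : 'M[A]_m.+1 := \matrix_(i, j) (r i)`_j.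
pose Mp := map_mx polyC M.
pose tau : 'cV[{poly A}]_m.+1 := \col_j 'X^j.
pose Q : 'cV[{poly A}]_m.+1 := \col_i (q i).
have MT : Mp *m tau = g *: tau - f *: Q.
  apply/colP => i; rewrite !mxE E [f * _]mulrC addrAC subrr add0r.
  have -> : r i = \poly_(j < m.+1) (r i)`_j.
    apply/polyP => j; rewrite coef_poly; case: ltnP => // /(leq_trans (sr i)).
    by move=> ?; rewrite nth_default.
  rewrite poly_def; apply: eq_bigr => j _; by rewrite !mxE mul_polyC.
(* Cramer's rule: the adjugate turns the relation into one for [\det Mp], and the entry of [tau] at
   0 is 1. *)
have DT : (\det Mp) *: tau = g *: (\adj Mp *m tau) - f *: (\adj Mp *m Q).
  by rewrite -mul_scalar_mx -mul_adj_mx -mulmxA MT mulmxBr -!scalemxAr.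
move: (\adj Mp *m tau) (\adj Mp *m Q) DT => u v DT.
exists (\det M), (- v 0 0), (u 0 0); split.
  have := congr1 (fun B : 'cV_m.+1 => B 0 0) DT.
  by rewrite !mxE expr0 mulr1 det_map_mx => ->; ring.
move=> psi g1; have fm' : map_poly psi f \is monic by exact: monic_map.
have sf' : size (map_poly psi f) = m.+2 by rewrite size_map_poly_id0 ?sf // (monicP fm) rmorph1 oner_eq0.
rewrite -det_map_mx; suff -> : map_mx psi M = 1%:M by rewrite det1.
apply/matrixP => i j; rewrite !mxE.
have := congr1 (map_poly psi) (E i); rewrite rmorphM rmorphD rmorphM /= map_polyXn g1 mul1r.
(* Once [g] specialises to 1, ['X^i] has degree below that of [f] and is its own remainder, so the
   matrix specialises to the identity. *)
move=> Ei; have q0 : map_poly psi (q i) = 0.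
  apply: contraTeq (leqnn m.+1) => q0; rewrite -ltnNge.
  have : (size (map_poly psi (q i) * map_poly psi f)%R <= m.+1)%N.
    have -> : map_poly psi (q i) * map_poly psi f = 'X^i - map_poly psi (r i).
      by rewrite Ei addrK.
    rewrite (leq_trans (size_polyD _ _)) // geq_max size_polyXn ltn_ord size_polyN.
    exact: leq_trans (size_poly _ _) (sr i).
  rewrite size_Mmonic // sf' addnS /= => sz.
  by move: q0 sz; rewrite -size_poly_gt0; move: (size _) => x; lia.
move: Ei; rewrite q0 mul0r add0r => /(congr1 (fun p : {poly k} => p`_j)).
by rewrite coef_map coefXn eq_sym => <-.
Qed.

End Elimination.

Section Nullstellensatz.
Variable k : closedFieldType.
Local Notation mp n := (mpoly.mpoly n k).
Local Notation mvar i := (mpoly.mpolyX k (mpoly.mnm1 i)).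
Local Notation mcst n c := (mpoly.mpolyC n c).

Definition is_ideal (R : comNzRingType) (I : R -> Prop) : Prop :=
  [/\ I 0, forall a b, I a -> I b -> I (a + b) & forall a b, I b -> I (a * b)].

Section Shear.
Variables (n : nat) (z : 'I_n.+1 -> k).

(* The linear change of variables X_i -> X_i + z_i T for i < n, X_n -> z_n T;
   it makes a polynomial monic in T, up to a constant, for general z. *)
Definition shear_var (i : 'I_n.+1) : {poly mp n} :=
  (if unlift ord_max i is Some j then (mvar j)%:P else 0) + (mcst n (z i))%:P * 'X.

Definition shear (p : mp n.+1) : {poly mp n} :=
  mpoly.mmap (polyC \o @mpoly.mpolyC n k) shear_var p.

HB.instance Definition _ := GRing.RMorphism.copy shear
  (mpoly.mmap (polyC \o @mpoly.mpolyC n k) shear_var).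

Definition unshear_coef (p : mp n) : mp n.+1 :=
  mpoly.mmap (@mpoly.mpolyC n.+1 k)
    (fun j => mvar (lift ord_max j) - mcst n.+1 (z (lift ord_max j) / z ord_max) * mvar ord_max) p.

HB.instance Definition _ := GRing.RMorphism.copy unshear_coef
  (mpoly.mmap (@mpoly.mpolyC n.+1 k)
    (fun j => mvar (lift ord_max j) - mcst n.+1 (z (lift ord_max j) / z ord_max) * mvar ord_max)).

Definition unshear (H : {poly mp n}) : mp n.+1 :=
  (map_poly unshear_coef H).[mcst n.+1 (z ord_max)^-1 * mvar ord_max].

Fact unshear_zmod : zmod_morphism unshear.
Proof. by move=> p q; rewrite /unshear rmorphB hornerD hornerN. Qed.

Fact unshear_monoid : monoid_morphism unshear.
Proof.
by split=> [|p q]; rewrite /unshear ?rmorph1 ?hornerC // rmorphM hornerM.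
Qed.

HB.instance Definition _ := GRing.isZmodMorphism.Build _ _ unshear unshear_zmod.
HB.instance Definition _ := GRing.isMonoidMorphism.Build _ _ unshear unshear_monoid.

Lemma shearK p : z ord_max != 0 -> unshear (shear p) = p.
Proof.
move=> z0.
have -> : unshear (shear p) = (unshear \o shear) p by [].
rewrite -[RHS]/(idfun p); move: p; apply: mpoly_rmorph_eq => [c|i] /=.
  by rewrite /shear mpoly.mmapC /unshear /= map_polyC /= hornerC /unshear_coef mpoly.mmapC.
rewrite /shear mpoly.mmapX mpoly.mmap1U /shear_var /unshear rmorphD rmorphM /= !map_polyC map_polyX.
rewrite hornerD hornerM hornerX hornerC /=.
rewrite {2}/unshear_coef mpoly.mmapC.
case: unliftP => [j ->|->]; rewrite ?map_polyC hornerC.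
  rewrite /= /unshear_coef mpoly.mmapX mpoly.mmap1U mulrA -mpoly.mpolyCM.
  by rewrite subrK.
by rewrite raddf0 add0r /= mulrA -mpoly.mpolyCM divff // mpoly.mpolyC1 mul1r.
Qed.

Lemma shear_eval (a : 'I_n -> k) (r : k) p :
  (map_poly (mpoly.meval a) (shear p)).[r] =
  mpoly.meval (fun i => (if unlift ord_max i is Some j then a j else 0) + z i * r) p.
Proof.
have -> : (map_poly (mpoly.meval a) (shear p)).[r] =
  (horner_eval r \o map_poly (mpoly.meval a) \o shear) p by [].
move: p; apply: mpoly_rmorph_eq => [c|i] /=.
  by rewrite /shear mpoly.mmapC /horner_eval /= map_polyC /= hornerC !mpoly.mevalC.
rewrite /shear mpoly.mmapX mpoly.mmap1U /shear_var /horner_eval rmorphD rmorphM /= !map_polyC map_polyX.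
rewrite hornerD hornerM hornerX !hornerC /= mpoly.mevalC mpoly.mevalXU.
by case: unliftP => [j _|_]; rewrite /= ?map_polyC hornerC /= ?mpoly.mevalXU ?mpoly.meval0.
Qed.

Definition top (d : nat) (p : {poly mp n}) (c : k) : Prop :=
  (size p <= d.+1)%N /\ p`_d = mcst n c.

Lemma topM d d' p p' c c' : top d p c -> top d' p' c' -> top (d + d') (p * p') (c * c').
Proof.
move=> [sp pd] [sp' pd']; split.
  by rewrite (leq_trans (size_polyMleq _ _)) //; lia.
rewrite coefM mpoly.mpolyCM -pd -pd'.
rewrite (bigD1 (inord d)) //= inordK ?ltnS ?leq_addr // addKn big1 ?addr0 //.
move=> i; rewrite -val_eqE /= inordK ?ltnS ?leq_addr // => id.
have [di|di] := leqP i d; last by rewrite nth_default ?mul0r // (leq_trans sp).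
rewrite [X in _ * X]nth_default ?mulr0 //.
rewrite (leq_trans sp') // ltn_subRL; move: id di; lia.
Qed.

Lemma shear_monomial m : top (mpoly.mdeg m) (shear (mpoly.mpolyX k m)) (\prod_i z i ^+ m i).
Proof.
have T1 : top 0 1 1 by split; rewrite ?size_poly1 // coef1 mpoly.mpolyC1.
have tv i : top 1 (shear_var i) (z i).
  split; last first.
    by rewrite /shear_var coefD coefCM coefX mulr1; case: unliftP => [j _|_];
      rewrite ?coefC ?coef0 add0r.
  rewrite /shear_var (leq_trans (size_polyD _ _)) // geq_max.
  apply/andP; split; first by case: unliftP => [j _|_]; rewrite ?size_poly0 // (leq_trans (size_polyC_leq1 _)).
  by rewrite mul_polyC (leq_trans (size_scale_leq _ _)) // size_polyX.
have tX i j : top j (shear_var i ^+ j) (z i ^+ j).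
  elim: j => [|j IH]; first by rewrite !expr0.
  by rewrite !exprS -add1n; exact: topM.
rewrite /shear mpoly.mmapX /mpoly.mmap1 mpoly.mdegE.
elim: (index_enum _) => [|i s IH]; first by rewrite !big_nil.
by rewrite !big_cons; exact: topM.
Qed.

End Shear.

(** The leading coefficient in the new variable is the top homogeneous part of [f] evaluated at [z].
    By independence of monomials it is nonzero at some [z] without zero coordinates, as required for
    inverting the shear. *)
Lemma shear_monic n (f : mp n.+1) : f != 0 ->
  exists z : 'I_n.+1 -> k, z ord_max != 0 /\ exists2 c : k, c != 0 &
    mcst n c *: shear z f \is monic.
Proof.
move=> f0; pose D := (mpoly.msize f).-1.
have degD m : m \in mpoly.msupp f -> (mpoly.mdeg m <= D)%N.
  by move=> /mpoly.msize_mdeg_lt; rewrite -ltnS /D; case: (mpoly.msize f).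
pose r := [seq m <- mpoly.msupp f | mpoly.mdeg m == D].
pose top_value z := \sum_(m <- r) mpoly.mcoeff m f * monomial (mnm_exp m) z.
have [z z0 Tz] : exists2 z : 'I_n.+1 -> k, (forall i, z i != 0) & top_value z != 0.
  apply: contrapT => nz.
  have lr : mpoly.mlead f \in r.
    by rewrite mem_filter mpoly.mlead_supp // andbT /D -mpoly.mlead_deg.
  have : mpoly.mcoeff (mpoly.mlead f) f = 0.
    apply: (@monomial_independent _ _ _ r (@mnm_exp n.+1) (fun m => mpoly.mcoeff m f)) lr.
    - by rewrite filter_uniq // mpoly.msupp_uniq.
    - by move=> x y _ _; exact: mnm_exp_inj.
    - by move=> z z0; apply: contrapT => /eqP Tz; apply: nz; exists z.
  by apply/eqP; rewrite -mpoly.mcoeff_msupp mpoly.mlead_supp.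
have [sf fD] : top D (shear z f) (top_value z).
  split.
    rewrite [X in shear z X]mpoly.mpolyE raddf_sum (leq_trans (size_sum _ _ _)) //; apply/bigmax_leqP_seq => m mf _ /=.
    rewrite -mpoly.mul_mpolyC rmorphM /= [shear z (mcst _ _)]mpoly.mmapC /= mul_polyC.
    rewrite (leq_trans (size_scale_leq _ _)) //; have [sm _] := shear_monomial z m.
    by rewrite (leq_trans sm) // ltnS degD.
  rewrite [X in shear z X]mpoly.mpolyE raddf_sum coef_sum.
  rewrite /top_value big_filter raddf_sum /= [RHS]big_mkcond.
  rewrite !big_seq; apply: eq_bigr => m mf.
  rewrite -mpoly.mul_mpolyC rmorphM /= [shear z (mcst _ _)]mpoly.mmapC /= mul_polyC coefZ.
  have [sm Em] := shear_monomial z m; case: eqVneq => [<-|mD].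
    rewrite Em -mpoly.mpolyCM; congr (mcst n (_ * _)).
    by apply: eq_bigr => i _; rewrite ffunE.
  rewrite nth_default ?mulr0 // (leq_trans sm) // ltn_neqAle mD; exact: degD.
have lf : lead_coef (shear z f) = mcst n (top_value z).
  rewrite lead_coefE -fD; congr (_`_ _); apply/eqP; rewrite eqn_leq.
  apply/andP; split; first by case: size sf.
  rewrite -ltnS prednK; last first.
    rewrite size_poly_gt0; apply: contraNneq Tz => S0.
    by rewrite S0 coef0 in fD; move: fD => /esym/eqP; rewrite mpoly.mpolyC_eq0.
  rewrite ltnNge; apply/negP => /(nth_default 0) /eqP.
  by rewrite fD mpoly.mpolyC_eq0 (negPf Tz).
exists z; split=> //; exists (top_value z)^-1; first by rewrite invr_eq0.
by rewrite monicE lead_coefZ lf -mpoly.mpolyCM mulVf // mpoly.mpolyC1.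
Qed.

(** By induction the elements of the ideal free of the last variable have a common zero [a].
    Specialised at [a], the ideal becomes a proper ideal of polynomials in one variable, and a root
    of its generator is the remaining coordinate. *)
Lemma weak_nullstellensatz n (I : mp n -> Prop) : is_ideal I -> ~ I 1 ->
  exists v, forall h, I h -> mpoly.meval v h = 0.
Proof.
elim: n I => [|n IH] I [I0 ID IM] I1.
  exists (fun=> 0) => h Ih; apply: contrapT => /eqP h0; apply: I1.
  have hE : h = mcst 0 (mpoly.mcoeff (mpoly.mnm0) h).
    apply/mpoly.mpolyP => m; rewrite mpoly.mcoeffC.
    have -> : m = (mpoly.mnm0) by apply/mpoly.mnmP; case.
    by rewrite eqxx mulr1.
  rewrite hE mpoly.mevalC in h0.
  have := IM (mcst 0 (mpoly.mcoeff (mpoly.mnm0) h)^-1) h Ih.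
  by rewrite {2}hE -mpoly.mpolyCM mulVf // mpoly.mpolyC1.
have [[f If f0]|nf] := pselect (exists2 f, I f & f != 0); last first.
  exists (fun=> 0) => h Ih; suff -> : h = 0 by rewrite mpoly.meval0.
  by apply: contrapT => /eqP h0; apply: nf; exists h.
have [z [zm [c c0 fm]]] := shear_monic f0.
pose It (H : {poly mp n}) := I (unshear z H).
have ItM a b : It b -> It (a * b) by move=> Ib; rewrite /It rmorphM; exact: IM.
have ItD a b : It a -> It b -> It (a + b) by move=> Ia Ib; rewrite /It rmorphD; exact: ID.
have It0 : It 0 by rewrite /It rmorph0.
have Itf : It (mcst n c *: shear z f) by rewrite -mul_polyC; apply: ItM; rewrite /It shearK.
have [||a aP] := IH (fun p => It p%:P).
- split; first by rewrite polyC0.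
    by move=> p q Ip Iq; rewrite polyCD; exact: ItD.
  by move=> p q Iq; rewrite polyCM; exact: ItM.
- by rewrite /It rmorph1.
pose psi : {rmorphism mp n -> k} := mpoly.meval a.
(* A nonzero specialisation of least size generates the specialised ideal. *)
pose Jp (s : nat) := `[< exists H, [/\ It H, map_poly psi H != 0 & size (map_poly psi H) = s] >].
have Jex : exists s, Jp s.
  exists (size (map_poly psi (mcst n c *: shear z f))); apply/asboolP.
  exists (mcst n c *: shear z f); split=> //.
  by apply: monic_neq0; exact: monic_map.
have [s /asboolP[H0 [IH0 H00 sH0]] smin] := ex_minnP Jex.
(* A constant generator would, by elimination against the monic element, produce an element of the
   ideal free of the last variable with value 1 at [a]. *)
have s1 : size (map_poly psi H0) != 1%N.
  apply/negP => /size_poly1P[e e0 HE].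
  have [N [u [w [NE Npsi]]]] := monic_elimination k ((mcst n e^-1)%:P * H0) fm.
  have IN : It N%:P by rewrite NE; apply: (ItD); apply: (ItM) => //; apply: (ItM).
  have := Npsi psi; rewrite rmorphM /= map_polyC /= HE [psi _]mpoly.mevalC -polyCM mulVf //.
  by move=> /(_ erefl) /eqP; rewrite [psi N]aP // eq_sym oner_eq0.
have [r /rootP rr] := closed_rootP _ s1.
exists (fun i => (if unlift ord_max i is Some j then a j else 0) + z i * r) => h Ih.
rewrite -shear_eval; have Ish : It (shear z h) by rewrite /It shearK.
have : map_poly psi H0 %| map_poly psi (shear z h).
  apply/modp_eq0P; apply: contrapT => /eqP md.
  pose q := map_poly (@mpoly.mpolyC n k) (map_poly psi (shear z h) %/ map_poly psi H0).
  have qE : map_poly psi q = map_poly psi (shear z h) %/ map_poly psi H0.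
    rewrite /q -map_poly_comp; apply: map_poly_id => x _ /=; exact: mpoly.mevalC.
  have mE : map_poly psi (shear z h - q * H0) = map_poly psi (shear z h) %% map_poly psi H0.
    by rewrite rmorphB rmorphM /= qE {1}[map_poly psi (shear z h)](Pdiv.Field.divp_eq _ (map_poly psi H0)) addrAC subrr add0r.
  have := smin (size (map_poly psi (shear z h) %% map_poly psi H0)).
  rewrite -sH0 leqNgt Pdiv.Field.ltn_modp H00 => F; suff : false by []; apply: F.
  apply/asboolP; exists (shear z h - q * H0); rewrite mE; split=> //.
  by apply: ItD => //; rewrite -mulNr; exact: ItM.
move=> /Pdiv.Field.dvdpP[q qE]; rewrite -/psi qE hornerM.
by rewrite [X in _ * X]rr mulr0.
Qed.

End Nullstellensatz.

Section AffineFunctions.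
Variables (k : closedFieldType) (n : nat).
Local Notation mp n := (mpoly.mpoly n k).
Local Notation mvar i := (mpoly.mpolyX k (mpoly.mnm1 i)).
Local Notation mcst n c := (mpoly.mpolyC n c).
Local Notation ev p u := (mpoly.meval u p).

Lemma mevalXn (p : mp n) m u : ev (p ^+ m) u = ev p u ^+ m.
Proof. exact: rmorphXn. Qed.

(* Rabinowitsch: (u, t) |-> u, t = 1 / q(u). *)
Theorem nullstellensatz (I : mp n -> Prop) (q : mp n) : is_ideal I ->
  (forall u, ev q u != 0 -> exists2 h, I h & ev h u != 0) ->
  exists M, I (q ^+ M).
Proof.
move=> [I0 ID IM] H.
pose ext (u : 'I_n -> k) (t : k) : 'I_n.+1 -> k :=
  fun i => if unlift ord_max i is Some j then u j else t.
(* Polynomials in [u] and [t] whose values on the graph [t = 1 / q(u)] agree with an element of [I]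
   after clearing powers of [q]. This ideal contains [q t - 1] and [I], so it has no zero. *)
pose J (G : mp n.+1) := exists M h, I h /\
  forall u, ev q u != 0 -> ev q u ^+ M * ev G (ext u (ev q u)^-1) = ev h u.
have hom (G : mp n.+1) : exists M g, forall u, ev q u != 0 ->
    ev q u ^+ M * ev G (ext u (ev q u)^-1) = ev g u.
  elim/mpoly_closed: G => [c|i|G G' [M [g E]] [M' [g' E']]|G G' [M [g E]] [M' [g' E']]].
  - by exists 0%N, (mcst n c) => u _; rewrite !mpoly.mevalC expr0 mul1r.
  - case: (unliftP ord_max i) => [j ->|->].
      by exists 0%N, (mvar j) => u _; rewrite expr0 mul1r !mpoly.mevalXU /ext liftK.
    exists 1%N, 1 => u qu; rewrite mpoly.mevalXU /ext unlift_none mpoly.meval1.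
    by rewrite expr1 divff.
  - exists (M + M')%N, (q ^+ M' * g + q ^+ M * g') => u qu.
    rewrite !mpoly.mevalD !mpoly.mevalM !mevalXn -E // -E' // exprD; ring.
  - exists (M + M')%N, (g * g') => u qu.
    rewrite !mpoly.mevalM -E // -E' // exprD; ring.
have Jid : is_ideal J.
  split.
  - by exists 0%N, 0; split=> // u _; rewrite !mpoly.meval0 mulr0.
  - move=> G G' [M [h [Ih E]]] [M' [h' [Ih' E']]].
    exists (M + M')%N, (q ^+ M' * h + q ^+ M * h'); split.
      by apply: ID; apply: IM.
    move=> u qu; rewrite !mpoly.mevalD !mpoly.mevalM !mevalXn -E // -E' // exprD; ring.
  - move=> G G' [M [h [Ih E]]]; have [M' [g E']] := hom G.
    exists (M + M')%N, (g * h); split; first exact: IM.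
    move=> u qu; rewrite !mpoly.mevalM -E // -E' // exprD; ring.
have [[M [h [Ih E]]]|nJ] := pselect (J 1).
  exists M.+1; have -> : q ^+ M.+1 = q * h; last exact: IM.
  apply/eqP; rewrite -subr_eq0; apply/eqP; apply: meval_eq0 => z _.
  rewrite mpoly.mevalB mpoly.mevalM mevalXn.
  have [->|qz] := eqVneq (ev q z) 0; first by rewrite exprS !mul0r subrr.
  by rewrite -E // mpoly.meval1 mulr1 exprS subrr.
have [v vP] := weak_nullstellensatz Jid nJ; exfalso.
pose u i := v (lift ord_max i).
have qv : ev q u * v ord_max = 1.
  pose qw : mp n.+1 := mpoly.mmap (@mpoly.mpolyC n.+1 k) (fun i => mvar (lift ord_max i)) q.
  have qwE w : ev qw w = ev q (fun i => w (lift ord_max i)).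
    have -> : ev qw w = (mpoly.meval w \o mpoly.mmap (@mpoly.mpolyC n.+1 k) (fun i => mvar (lift ord_max i))) q by [].
    move: (q); apply: mpoly_rmorph_eq => [c|i] /=; first by rewrite mpoly.mmapC /= !mpoly.mevalC.
    by rewrite mpoly.mmapX mpoly.mmap1U !mpoly.mevalXU.
  have : ev (qw * mvar ord_max - 1) v = 0.
    apply: vP; exists 0%N, 0; split=> // w qw0.
    rewrite expr0 mul1r mpoly.mevalB mpoly.mevalM qwE mpoly.meval1 mpoly.mevalXU mpoly.meval0.
    rewrite (@mpoly.meval_eq _ _ _ w); last by move=> i; rewrite /ext liftK.
    by rewrite /ext unlift_none divff ?subrr.
  rewrite mpoly.mevalB mpoly.mevalM qwE mpoly.meval1 mpoly.mevalXU => /eqP.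
  by rewrite subr_eq0 => /eqP.
have qu : ev q u != 0 by apply: contra_eq_neq qv => ->; rewrite mul0r eq_sym oner_eq0.
have [h Ih hu] := H u qu.
pose hw : mp n.+1 := mpoly.mmap (@mpoly.mpolyC n.+1 k) (fun i => mvar (lift ord_max i)) h.
have hwE w : ev hw w = ev h (fun i => w (lift ord_max i)).
  have -> : ev hw w = (mpoly.meval w \o mpoly.mmap (@mpoly.mpolyC n.+1 k) (fun i => mvar (lift ord_max i))) h by [].
  move: (h); apply: mpoly_rmorph_eq => [c|i] /=; first by rewrite mpoly.mmapC /= !mpoly.mevalC.
  by rewrite mpoly.mmapX mpoly.mmap1U !mpoly.mevalXU.
have : ev hw v = 0.
  apply: vP; exists 0%N, h; split=> // w qw0; rewrite expr0 mul1r hwE.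
  by apply: mpoly.meval_eq => i; rewrite /ext liftK.
by rewrite hwE => /eqP; rewrite (negPf hu).
Qed.

Lemma nullstellensatz_finite N (h : 'I_N -> mp n) (q : mp n) :
  (forall u, ev q u != 0 -> exists j, ev (h j) u != 0) ->
  exists M a, q ^+ M = \sum_j a j * h j.
Proof.
move=> H; have [||M [a E]] := @nullstellensatz (fun p => exists a, p = \sum_j a j * h j) q.
- split.
  + by exists (fun=> 0); rewrite big1 // => j _; rewrite mul0r.
  + move=> _ _ [a ->] [b ->]; exists (fun j => a j + b j).
    by rewrite -big_split; apply: eq_bigr => j _; rewrite mulrDl.
  + move=> c _ [a ->]; exists (fun j => c * a j).
    by rewrite mulr_sumr; apply: eq_bigr => j _; rewrite mulrA.
- move=> u /H[j hj]; exists (h j) => //; exists (fun i => (i == j)%:R).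
  rewrite (bigD1 j) //= eqxx mul1r big1 ?addr0 // => i /negPf ->.
  by rewrite mul0r.
- by exists M, a.
Qed.

(** A power of [q] lies in the ideal generated by [F], and its expression there involves only
    finitely many members of [F]. *)
Lemma quasi_compact (F : mp n -> Prop) (q : mp n) :
  (forall u, ev q u != 0 -> exists2 h, F h & ev h u != 0) ->
  exists N (h : 'I_N -> mp n), (forall j, F (h j)) /\
    forall u, ev q u != 0 -> exists j, ev (h j) u != 0.
Proof.
move=> H; pose I (p : mp n) := exists2 l : seq (mp n * mp n),
  (forall x, x \in l -> F x.2) & p = \sum_(x <- l) x.1 * x.2.
have [||M [l lF E]] := @nullstellensatz I q.
- split.
  + by exists [::]; rewrite ?big_nil.
  + move=> _ _ [l lF ->] [l' l'F ->]; exists (l ++ l'); last by rewrite big_cat.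
    by move=> x; rewrite mem_cat => /orP[/lF|/l'F].
  + move=> c _ [l lF ->]; exists [seq (c * x.1, x.2) | x <- l].
      by move=> x /mapP[y yl ->]; exact: lF yl.
    by rewrite big_map mulr_sumr; apply: eq_bigr => x _; rewrite mulrA.
- move=> u /H[h Fh hu]; exists h => //; exists [:: (1, h)]; last by rewrite big_seq1 mul1r.
  by move=> x; rewrite inE => /eqP ->.
exists (size l), (fun j => (tnth (in_tuple l) j).2); split.
  by move=> j; apply: lF; exact: mem_tnth.
move=> u qu; apply: contrapT => nj.
have : ev (q ^+ M) u = 0.
  rewrite E raddf_sum big_seq big1 // => x xl /=; rewrite mpoly.mevalM.
  have /tnthP[j jE] : x \in in_tuple l by [].
  have [->|hj] := eqVneq (ev x.2 u) 0; first by rewrite mulr0.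
  by case: nj; exists j; rewrite -jE.
by rewrite mevalXn => /eqP; rewrite expf_eq0 (negPf qu) andbF.
Qed.

(** The polynomials [h] for which [h f] is polynomial on [q != 0] form an ideal, to which the
    Nullstellensatz applies. *)
Lemma global_fraction (f : ('I_n -> k) -> k) (q : mp n) :
  (forall u, ev q u != 0 -> exists P Q : mp n, ev Q u != 0 /\
     forall u', ev q u' != 0 -> ev Q u' != 0 -> f u' = ev P u' / ev Q u') ->
  exists P M, forall u, ev q u != 0 -> f u = ev P u / ev q u ^+ M.
Proof.
move=> H; have [||M [P PE]] := @nullstellensatz
    (fun h => exists P : mp n, forall u, ev q u != 0 -> ev h u * f u = ev P u) q.
- split.
  + by exists 0 => u _; rewrite !mpoly.meval0 mul0r.
  + move=> a b [P PE] [P' PE']; exists (P + P') => u qu.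
    by rewrite !mpoly.mevalD mulrDl PE // PE'.
  + move=> a b [P PE]; exists (a * P) => u qu.
    by rewrite !mpoly.mevalM -mulrA PE.
- move=> u qu; have [P [Q [Qu E]]] := H u qu.
  (* The local fraction says nothing about [f] at the zeros of [Q]; multiplying by [Q * Q] makes the
     identity with [Q * P] hold there too, since both sides vanish. *)
  exists (Q * Q); last by rewrite mpoly.mevalM mulf_neq0.
  exists (Q * P) => u' qu'; rewrite !mpoly.mevalM.
  have [->|Q'] := eqVneq (ev Q u') 0; first by rewrite !mul0r.
  by rewrite E //; field.
exists P, M => u qu; rewrite -PE // mevalXn mulrC mulKf //.
by rewrite expf_neq0.
Qed.

End AffineFunctions.

(** * Frames and rational functions *)

Section Frames.
Variables (k : closedFieldType) (n : nat).
Implicit Types (V : flag k n) (g b : 'M[k]_n).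

Lemma unitmx_kernel (A : 'M[k]_n) : (forall w : 'rV_n, w *m A = 0 -> w = 0) -> A \in unitmx.
Proof.
move=> H; rewrite -row_free_unit -kermx_eq0; apply/rowV0P => w /sub_kermxP; exact: H.
Qed.

Lemma memv_take (V : flag k n) g (i : 'I_n.+1) u : adapted V g -> (i <= n)%N ->
  u \in V i -> exists c : 'rV[k]_n, u = c *m g /\ forall j : 'I_n, (i <= j)%N -> c 0 j = 0.
Proof.
move=> Vg _; rewrite (adapted_span i Vg) => uV.
exists (u *m invmx g); split; first by rewrite mulmxKV //; case: Vg.
move=> j ij; suff S (w : 'rV[k]_n) : w \in <<take i [seq row j g | j <- enum 'I_n]>>%VS ->
    (w *m invmx g) 0 j = 0 by exact: S.
move=> /coord_span ->; rewrite mulmx_suml summxE big1 // => l _.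
rewrite -scalemxAl mxE; set x := _`_l.
have : x \in take i [seq row j g | j <- enum 'I_n].
  apply: mem_nth; rewrite size_take size_map -cardE; exact: ltn_ord l.
rewrite -map_take => /mapP[a at_ ->]; rewrite -row_mul mulmxV; last by case: Vg.
rewrite row1 mxE eqxx /=; have ai : (a < i)%N.
  move: at_; rewrite -(mem_map val_inj) map_take val_enum_ord take_iota mem_iota add0n.
  by move=> /=; rewrite ltn_min => /andP[].
by rewrite (_ : j == a = false) ?mulr0 //; apply/eqP => ja; rewrite ja leqNgt ai in ij.
Qed.

Lemma adapted_trig V g g' : adapted V g -> adapted V g' ->
  exists2 b, b \in unitmx /\ is_trig_mx b & g = b *m g'.
Proof.
move=> Vg Vg'; have ug : g \in unitmx by case: Vg.
have ug' : g' \in unitmx by case: Vg'.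
exists (g *m invmx g'); last by rewrite mulmxKV.
split; first by rewrite unitmx_mul ug unitmx_inv.
apply/is_trig_mxP => i j ij.
have ii : (i.+1 < n.+1)%N by rewrite ltnS.
have rV : row i g \in V (Ordinal ii) by have [_] := Vg; apply.
have [//|c [cE c0]] := memv_take Vg' _ rV.
have -> : (g *m invmx g') i j = c 0 j; last exact: c0.
have := congr1 (fun x => (x *m invmx g') 0 j) cE.
by rewrite mulmxK // -row_mul mxE.
Qed.

Lemma flag_of_frame g : g \in unitmx -> exists V, adapted V g.
Proof.
move=> ug; pose rows := [seq row j g | j <- enum 'I_n].
pose Vf := [ffun i : 'I_n.+1 => <<take i rows>>%VS].
have sz : size rows = n by rewrite size_map size_enum_ord.
have fr : free rows.
  have dT : \dim {:'rV[k]_n} = n by rewrite dimvf; exact: mul1n.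
  apply: (@basis_free _ _ fullv); rewrite basisEdim sz dT leqnn andbT.
  apply/subvP => u _; rewrite -[u](mulmxKV ug).
  rewrite mulmx_sum_row; apply: memv_suml => j _; rewrite memvZ // memv_span //.
  by apply: map_f; rewrite mem_enum.
have Vp : is_flag Vf.
  apply/andP; split; apply/forallP => i.
    rewrite ffunE; apply/eqP; have /eqnP -> : free (take i rows).
      by move: fr; rewrite -{1}(cat_take_drop i rows) => /catl_free.
    by rewrite size_take sz; case: ltnP => // ni; apply/eqP; rewrite eqn_leq ni -ltnS ltn_ord.
  apply/forallP => j; apply/implyP => ij; rewrite !ffunE; apply: sub_span => x.
  by rewrite -[take i rows](take_takel _ ij) => /mem_take.
exists (Flag Vp); split=> // i j ji; rewrite /= ffunE memv_span //.
have -> : row j g = nth 0 (take i rows) j.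
  by rewrite nth_take // (nth_map j) ?size_enum_ord // nth_ord_enum.
by rewrite mem_nth // size_take sz; case: ifP.
Qed.

Lemma frame_of_flag V : exists g, adapted V g.
Proof.
have /andP[/forallP dV /forallP mV] := flagP V.
have H (j : 'I_n) : exists v, v \in V (lift ord0 j) /\ v \notin V (widen_ord (leqnSn n) j).
  apply: contrapT => nH.
  have : (V (lift ord0 j) <= V (widen_ord (leqnSn n) j))%VS.
    apply/subvP => v vV; apply: contrapT => /negP nv; apply: nH; by exists v.
  by move=> /dimvS; rewrite (eqP (dV _)) (eqP (dV _)) /= /bump /= ltnn.
have /boolp.choice[v vP] := H.
pose g := \matrix_j v j.
have gV (i : 'I_n.+1) (j : 'I_n) : (j < i)%N -> row j g \in V i.
  move=> ji; rewrite rowK; have [vV _] := vP j.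
  have /forallP /(_ i) /implyP := mV (lift ord0 j); rewrite lift0 => /(_ ji) /subvP; exact.
exists g; split=> //; apply: unitmx_kernel => w w0.
apply/rowP => j; rewrite [RHS]mxE; apply: contrapT => /eqP wj.
have [m mj mmax] := @arg_maxnP _ j (fun i : 'I_n => w 0 i != 0) val wj.
have [_ /negP] := vP m; apply.
have wE : v m = - (w 0 m)^-1 *: \sum_(i < n | i != m) w 0 i *: v i.
  have := w0; rewrite mulmx_sum_row (bigD1 m) //= rowK => /eqP; rewrite addr_eq0 => /eqP E.
  rewrite -[v m]scale1r -(mulVf mj) -scalerA E scalerN scaleNr; congr (- (_ *: _)).
  by apply: eq_bigr => i _; rewrite rowK.
rewrite wE memvZ // memv_suml // => i im.
have [->|wi] := eqVneq (w 0 i) 0; first by rewrite scale0r mem0v.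
rewrite memvZ //; have := gV (widen_ord (leqnSn n) m) i; rewrite rowK; apply.
by rewrite /= ltn_neqAle im; exact: mmax.
Qed.

(* The rows of Yof g are the columns of g^-1, starting from the last one:
   row r is dual to v_(n-1-r), and V_(n-r) is cut out by the first r rows. *)
Definition Yof g : nat -> 'I_n -> k :=
  fun r j => if insub r is Some i then invmx g j (rev_ord i) else 0.

Lemma YofE g (i j : 'I_n) : Yof g i j = invmx g j (rev_ord i).
Proof. by rewrite /Yof valK. Qed.

Definition frame_of (Y : nat -> 'I_n -> k) : 'M[k]_n :=
  invmx (\matrix_(j, c) Y (rev_ord c) j).

Implicit Types (Y : nat -> 'I_n -> k) (d : nat -> k).

(** Triangular changes of the rows with diagonal [d] in which rows up to [r] are only rescaled: the
    freedom in the frame that is left after [r] steps of elimination. *)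
Definition tri_from (r : nat) d Y Y' : Prop := forall a, (a < n)%N ->
  exists c : nat -> k, forall j, Y' a j = d a * Y a j + \sum_(r <= l < a) c l * Y l j.

Definition tri := tri_from 0.

Lemma tri_trans d d' Y Y' Y'' : tri d Y Y' -> tri d' Y' Y'' ->
  tri (fun a => d' a * d a) Y Y''.
Proof.
move=> T T' a an; have [c' c'E] := T' a an; have [c cE] := T a an.
have /boolp.choice[C CE] : forall l, exists cl : nat -> k, (l < a)%N ->
    forall j, Y' l j = d l * Y l j + \sum_(0 <= m < l) cl m * Y m j.
  move=> l; case: (ltnP l a) => [la|]; last by exists (fun=> 0).
  by have [cl clE] := T l (ltn_trans la an); exists cl.
exists (fun m => d' a * c m + c' m * d m + \sum_(m.+1 <= l < a) c' l * C l m) => j.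
rewrite c'E cE mulrDr mulrA -addrA; congr (_ + _).
have -> : \sum_(0 <= l < a) c' l * Y' l j =
    \sum_(0 <= l < a) c' l * d l * Y l j + \sum_(0 <= l < a) \sum_(0 <= m < l) c' l * C l m * Y m j.
  rewrite -big_split; apply: eq_big_nat => l /andP[_ la] /=.
  rewrite (CE l la) mulrDr mulrA mulr_sumr; congr (_ + _).
  by apply: eq_bigr => m _; rewrite mulrA.
have -> : \sum_(0 <= l < a) \sum_(0 <= m < l) c' l * C l m * Y m j =
    \sum_(0 <= m < a) (\sum_(m.+1 <= l < a) c' l * C l m) * Y m j.
  elim: (a) => [|a' IH]; first by rewrite !big_geq.
  rewrite big_nat_recr //= IH [RHS]big_nat_recr //= [\sum_(a'.+1 <= l < a'.+1) _]big_geq // mul0r addr0.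
  rewrite -big_split; apply: eq_big_nat => m /andP[_ ma] /=.
  by rewrite big_nat_recr //= mulrDl.
rewrite mulr_sumr addrA -!big_split; apply: eq_bigr => m _ /=; ring.
Qed.

Definition trig_diag (b : 'M[k]_n) : nat -> k :=
  fun a => if insub a is Some i then b (rev_ord i) (rev_ord i) else 0.

Lemma trig_diagE b (i : 'I_n) : trig_diag b i = b (rev_ord i) (rev_ord i).
Proof. by rewrite /trig_diag valK. Qed.

Lemma trig_diag_neq0 b a : b \in unitmx -> is_trig_mx b -> (a < n)%N -> trig_diag b a != 0.
Proof.
move=> ub tb an; rewrite /trig_diag insubT /=; move: ub; rewrite unitmxE (det_trig tb) unitfE.
by move=> /prodf_neq0; apply.
Qed.

(** Inversion turns left multiplication of frames into right multiplication of [g^-1]. Since [Yof]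
    lists its columns from the last one, a lower triangular [b] adds to each row multiples of
    earlier rows only. *)
Lemma trig_tri b g g' : b \in unitmx -> is_trig_mx b -> g \in unitmx -> g' \in unitmx ->
  g = b *m g' -> tri (trig_diag b) (Yof g) (Yof g').
Proof.
move=> ub tb ug ug' gE.
have iE : invmx g' = invmx g *m b.
  by rewrite -[LHS](mulKmx ug) [X in _ *m (X *m _)]gE mulmxK.
move=> a an.
pose C (l : nat) : k := if insub l is Some i then b (rev_ord i) (rev_ord (Ordinal an)) else 0.
exists C => j.
rewrite -[a]/(val (Ordinal an)) !YofE trig_diagE iE mxE.
rewrite (reindex_inj rev_ord_inj) /= (bigD1 (Ordinal an)) //= mulrC; congr (_ + _).
rewrite (bigID (fun i : 'I_n => (i < a)%N)) /= addrC big1 ?add0r; last first.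
  move=> i /andP[ia]; rewrite -leqNgt => ai.
  have ai' : (a < i)%N.
    by rewrite ltn_neqAle ai andbT; apply: contra ia => /eqP ia; apply/eqP/val_inj.
  rewrite (is_trig_mxP tb) ?mulr0 //=.
  by have := ltn_ord i; lia.
rewrite big_mkord (big_ord_widen n (fun l => C l * Yof g l j) (ltnW an)).
apply: eq_big => [i|i _]; first by rewrite andbC; case: ltnP => //= ia; apply/eqP => E; rewrite E ltnn in ia.
by rewrite YofE /C valK mulrC.
Qed.

Lemma adapted_tri V g g' : adapted V g -> adapted V g' ->
  exists2 d, (forall a, (a < n)%N -> d a != 0) & tri d (Yof g) (Yof g').
Proof.
move=> Vg Vg'; have [b [ub tb] gE] := adapted_trig Vg Vg'.
exists (trig_diag b); first by move=> a; exact: trig_diag_neq0.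
by apply: trig_tri => //; [case: Vg|case: Vg'].
Qed.

Lemma tri_frame d g g' : g \in unitmx -> g' \in unitmx -> tri d (Yof g) (Yof g') ->
  exists2 b, [/\ b \in unitmx, is_trig_mx b & g = b *m g'] &
    forall i : 'I_n, b (rev_ord i) (rev_ord i) = d i.
Proof.
move=> ug ug' T; have /boolp.choice[c cE] : forall a : 'I_n, exists c : nat -> k,
    forall j, Yof g' a j = d a * Yof g a j + \sum_(0 <= l < a) c l * Yof g l j.
  by move=> a; exact: T.
pose b := \matrix_(i, j) (if i == j then d (rev_ord j)
  else if (j < i)%N then c (rev_ord j) (rev_ord i) else 0 : k).
have iE : invmx g' = invmx g *m b.
  apply/matrixP => j i; rewrite -[i]rev_ordK -YofE cE mxE.
  rewrite (reindex_inj rev_ord_inj) (bigD1 (rev_ord i)) //; congr (_ + _).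
    by rewrite YofE mxE eqxx rev_ordK mulrC.
  rewrite [RHS](bigID (fun l : 'I_n => (l < rev_ord i)%N)).
  rewrite [RHS]addrC [X in _ = X + _]big1 ?add0r; last first.
    move=> l /andP[li]; rewrite -leqNgt => il; rewrite mxE ifN; last first.
      by apply: contra li => /eqP E; rewrite -(rev_ordK l) E !rev_ordK.
    rewrite ifN ?mulr0 // -leqNgt /=.
    by have := ltn_ord l; have := ltn_ord i; move: il => /=; lia.
  rewrite big_mkord (big_ord_widen _ (fun l => c (rev_ord i) l * Yof g l j) (ltnW (ltn_ord _))).
  apply: eq_big => [l|l li]; first by rewrite andbC; case: ltnP => //= H; apply/esym/eqP => E; rewrite E ltnn in H.
  rewrite YofE mxE ifN; last by apply/eqP => /rev_ord_inj E; rewrite E ltnn in li.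
  rewrite !rev_ordK ifT 1?mulrC //.
  by move: li => /=; have := ltn_ord l; have := ltn_ord i; lia.
have gE : g = b *m g'.
  by rewrite -[RHS](mulKVmx ug) [invmx g *m _]mulmxA -iE mulVmx // mulmx1.
exists b; last by move=> i; rewrite mxE eqxx rev_ordK.
split=> //.
  suff -> : b = g *m invmx g' by rewrite unitmx_mul ug unitmx_inv.
  by rewrite gE mulmxK.
apply/is_trig_mxP => i j ij; rewrite mxE ifN; last by apply/eqP => E; rewrite E ltnn in ij.
by rewrite ltnNge (ltnW ij).
Qed.

End Frames.

Section RationalFunctions.
Variables (k : closedFieldType) (n : nat).
Local Notation mp := (mpoly.mpoly (n * n) k).
Implicit Types (O : 'M[k]_n -> Prop) (g : 'M[k]_n) (h : 'M[k]_n -> k).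

Definition rational_at O g h : Prop :=
  exists P Q : mp, mx_eval Q g != 0 /\
    forall g', O g' -> mx_eval Q g' != 0 -> h g' = mx_eval P g' / mx_eval Q g'.

Lemma mx_eval1 g : mx_eval (mpoly.mpolyC _ 1) g = 1.
Proof. exact: mx_evalC. Qed.

Lemma rational_cst O g c : rational_at O g (fun=> c).
Proof.
exists (mpoly.mpolyC _ c), (mpoly.mpolyC _ 1); rewrite mx_eval1 oner_neq0; split=> // g' _ _.
by rewrite mx_evalC mx_eval1 divr1.
Qed.

Lemma rational_poly O g (P : mp) : rational_at O g (mx_eval P).
Proof.
exists P, (mpoly.mpolyC _ 1); rewrite mx_eval1 oner_neq0; split=> // g' _ _.
by rewrite mx_eval1 divr1.
Qed.

Lemma rational_ext O g h h' : (forall g', O g' -> h g' = h' g') ->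
  rational_at O g h -> rational_at O g h'.
Proof.
by move=> E [P [Q [Qg H]]]; exists P, Q; split=> // g' Og' Qg'; rewrite -E // H.
Qed.

Lemma rational_sub O O' g h : (forall g', O' g' -> O g') ->
  rational_at O g h -> rational_at O' g h.
Proof. by move=> S [P [Q [Qg H]]]; exists P, Q; split=> // g' /S Og'; exact: H. Qed.

Lemma rationalD O g h h' : rational_at O g h -> rational_at O g h' ->
  rational_at O g (fun x => h x + h' x).
Proof.
move=> [P [Q [Qg H]]] [P' [Q' [Qg' H']]]; exists (P * Q' + P' * Q), (Q * Q').
split=> [|x Ox]; rewrite !(mx_evalM, mx_evalD); first by rewrite mulf_neq0.
by rewrite mulf_eq0 negb_or => /andP[q q']; rewrite H // H' // addf_div.
Qed.

Lemma rationalM O g h h' : rational_at O g h -> rational_at O g h' ->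
  rational_at O g (fun x => h x * h' x).
Proof.
move=> [P [Q [Qg H]]] [P' [Q' [Qg' H']]]; exists (P * P'), (Q * Q').
split=> [|x Ox]; rewrite !mx_evalM; first by rewrite mulf_neq0.
by rewrite mulf_eq0 negb_or => /andP[q q']; rewrite H // H' // mulf_div.
Qed.

Lemma rationalN O g h : rational_at O g h -> rational_at O g (fun x => - h x).
Proof.
move=> H; apply: rational_ext (rationalM (rational_cst O g (-1)) H) => x _.
by rewrite mulN1r.
Qed.

Lemma rationalB O g h h' : rational_at O g h -> rational_at O g h' ->
  rational_at O g (fun x => h x - h' x).
Proof. by move=> H H'; exact: rationalD H (rationalN H'). Qed.

Lemma rationalV O g h : O g -> h g != 0 -> rational_at O g h -> rational_at O g (fun x => (h x)^-1).
Proof.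
move=> Og hg [P [Q [Qg H]]]; exists (Q * Q), (P * Q).
have Pg : mx_eval P g != 0 by apply: contraNneq hg => P0; rewrite H // P0 mul0r.
split=> [|x Ox]; rewrite !mx_evalM; first by rewrite mulf_neq0.
by rewrite mulf_eq0 negb_or => /andP[p q]; rewrite H //; field; rewrite p q.
Qed.

Lemma rational_div O g h h' : O g -> h' g != 0 -> rational_at O g h -> rational_at O g h' ->
  rational_at O g (fun x => h x / h' x).
Proof. by move=> Og hg H H'; apply: rationalM => //; exact: rationalV. Qed.

Lemma rational_sum O g (I : Type) (s : seq I) (P : pred I) (F : I -> 'M[k]_n -> k) :
  (forall i, P i -> rational_at O g (F i)) -> rational_at O g (fun x => \sum_(i <- s | P i) F i x).
Proof.
move=> H; elim: s => [|i s IH].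
  by apply: rational_ext (rational_cst O g 0) => x _; rewrite big_nil.
case Pi : (P i).
  by apply: rational_ext (rationalD (H i Pi) IH) => x _; rewrite big_cons Pi.
by apply: rational_ext IH => x _; rewrite big_cons Pi.
Qed.

Lemma rational_prod O g (I : Type) (s : seq I) (P : pred I) (F : I -> 'M[k]_n -> k) :
  (forall i, P i -> rational_at O g (F i)) -> rational_at O g (fun x => \prod_(i <- s | P i) F i x).
Proof.
move=> H; elim: s => [|i s IH].
  by apply: rational_ext (rational_cst O g 1) => x _; rewrite big_nil.
case Pi : (P i).
  by apply: rational_ext (rationalM (H i Pi) IH) => x _; rewrite big_cons Pi.
by apply: rational_ext IH => x _; rewrite big_cons Pi.
Qed.

Lemma rationalX O g h m : rational_at O g h -> rational_at O g (fun x => h x ^+ m).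
Proof.
move=> H; elim: m => [|m IH]; first exact: rational_cst.
by apply: rational_ext (rationalM H IH) => x _; rewrite exprS.
Qed.

Lemma rational_exprz O g h (e : int) : O g -> (0 <= e)%R || (h g != 0) -> rational_at O g h ->
  rational_at O g (fun x => h x ^ e).
Proof.
case: e => m Og /= hg H; first exact: rationalX.
by apply: rational_ext (rationalV Og _ (rationalX m.+1 H)) => //; rewrite expf_neq0.
Qed.

Lemma mx_eval_var i j g : mx_eval (mpoly.mpolyX k (mpoly.mnm1 (mxvec_index i j))) g = g i j.
Proof. by rewrite /mx_eval mpoly.mevalXU mxvecE. Qed.

Lemma rational_entry O g i j : rational_at O g (fun x => x i j).
Proof.
apply: rational_ext (rational_poly O g (mpoly.mpolyX k (mpoly.mnm1 (mxvec_index i j)))) => x _.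
exact: mx_eval_var.
Qed.

Lemma rational_det O g m (M : 'M[k]_n -> 'M[k]_m) :
  (forall i j, rational_at O g (fun x => M x i j)) -> rational_at O g (fun x => \det (M x)).
Proof.
move=> H; apply: rational_sum => s _; apply: rationalM; first exact: rational_cst.
by apply: rational_prod => i _; exact: H.
Qed.

Lemma rational_inv O g (M : 'M[k]_n -> 'M[k]_n) i j :
  O g -> (forall x, O x -> M x \in unitmx) ->
  (forall i j, rational_at O g (fun x => M x i j)) -> rational_at O g (fun x => invmx (M x) i j).
Proof.
move=> Og uM H; have D := rational_det H.
have cof : rational_at O g (fun x => (-1) ^+ (j + i) * \det (row' j (col' i (M x)))).
  apply: rationalM; first exact: rational_cst.
  by apply: rational_det => a b; apply: rational_ext (H (lift j a) (lift i b)) => x _; rewrite !mxE.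
apply: rational_ext (rationalM (rationalV Og _ D) cof).
  by move=> x Ox; rewrite /invmx uM // !mxE.
by have := uM g Og; rewrite unitmxE unitfE.
Qed.

Lemma rational_comp O g (G : 'M[k]_n -> 'M[k]_n) (P : mp) :
  (forall i j, rational_at O g (fun x => G x i j)) -> rational_at O g (fun x => mx_eval P (G x)).
Proof.
move=> H; elim/mpoly_closed: P => [c|l|p q Hp Hq|p q Hp Hq].
- by apply: rational_ext (rational_cst O g c) => x _; rewrite mx_evalC.
- case/mxvec_indexP: l => i j; apply: rational_ext (H i j) => x _; exact/esym/mx_eval_var.
- by apply: rational_ext (rationalD Hp Hq) => x _; rewrite mx_evalD.
- by apply: rational_ext (rationalM Hp Hq) => x _; rewrite mx_evalM.
Qed.

Lemma rational_local O g h (Q : mp) : mx_eval Q g != 0 ->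
  rational_at (fun x => O x /\ mx_eval Q x != 0) g h -> rational_at O g h.
Proof.
move=> Qg [P [Q' [Qg' H]]]; exists (P * Q), (Q' * Q).
split=> [|x Ox]; rewrite !mx_evalM; first by rewrite mulf_neq0.
rewrite mulf_eq0 negb_or => /andP[q' q]; rewrite H //.
by rewrite -mulf_div divff // mulr1.
Qed.

Lemma rational_neq0 O g h : O g -> h g != 0 -> rational_at O g h ->
  exists Q : mp, mx_eval Q g != 0 /\ forall x, O x -> mx_eval Q x != 0 -> h x != 0.
Proof.
move=> Og hg [P [Q [Qg H]]]; exists (P * Q); split=> [|x Ox]; rewrite mx_evalM.
  by rewrite mulf_neq0 //; apply: contraNneq hg => P0; rewrite H // P0 mul0r.
by rewrite mulf_eq0 negb_or => /andP[p q]; rewrite H // mulf_neq0 // invr_eq0.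
Qed.

End RationalFunctions.

Section FrameSets.
Variables (k : closedFieldType) (n : nat).
Local Notation mp := (mpoly.mpoly (n * n) k).
Implicit Types (A : 'M[k]_n -> Prop) (g : 'M[k]_n).

Definition flag_invariant A : Prop := forall g g' d,
  g \in unitmx -> g' \in unitmx -> (forall a, (a < n)%N -> d a != 0) ->
  tri d (Yof g) (Yof g') -> A g -> A g'.

Definition frame_open A : Prop := forall g, g \in unitmx -> A g ->
  exists Q : mp, mx_eval Q g != 0 /\
    forall g', g' \in unitmx -> mx_eval Q g' != 0 -> A g'.

Definition flags_of A : set (flag k n) := [set V | exists2 g, adapted V g & A g].

Definition opens_of A : opens (flag k n) :=
  if pselect (open (flags_of A)) is left h then Opens h else whole _.

Lemma over_opens_of A g : flag_invariant A -> frame_open A ->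
  over (opens_of A) g <-> g \in unitmx /\ A g.
Proof.
move=> inv op.
have oA : open (flags_of A).
  move=> V g' [g0 Vg0 Ag0] Vg'; have [d d0 T] := adapted_tri Vg0 Vg'.
  have Ag' : A g' by apply: inv d0 T Ag0; [case: Vg0|case: Vg'].
  have [Q [Qg' QA]] := op g' (proj1 Vg') Ag'; exists Q; split=> // V1 g1 V1g1 Qg1.
  by exists g1 => //; apply: QA => //; case: V1g1.
rewrite /opens_of; case: pselect => // oA'; split.
  move=> [V [g0 Vg0 Ag0] Vg]; have ug : g \in unitmx by case: Vg.
  split=> //; have [d d0 T] := adapted_tri Vg0 Vg.
  by apply: inv d0 T Ag0 => //; case: Vg0.
move=> [ug Ag]; have [V Vg] := flag_of_frame ug.
by exists V => //; exists g.
Qed.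

Lemma over_open (U : opens (flag k n)) g : over U g ->
  exists Q : mp, mx_eval Q g != 0 /\
    forall g', g' \in unitmx -> mx_eval Q g' != 0 -> over U g'.
Proof.
move=> [V UV Vg]; have [Q [Qg QU]] := (oset_open U : zariski_open _) V g UV Vg.
exists Q; split=> // g' ug' Qg'; have [V' V'g'] := flag_of_frame ug'.
by exists V' => //; exact: QU V'g' Qg'.
Qed.

Lemma over_unit (U : opens (flag k n)) g : over U g -> g \in unitmx.
Proof. by move=> [V _ []]. Qed.

Lemma oset_over (U : opens (flag k n)) V : oset U V <-> exists2 g, adapted V g & over U g.
Proof.
split=> [UV|[g Vg [V' UV' V'g]]]; last by rewrite (adapted_inj Vg V'g).
by have [g Vg] := frame_of_flag V; exists g => //; exists V.
Qed.

Lemma opens_over_eq (U U' : opens (flag k n)) :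
  (forall g, over U g <-> over U' g) -> U = U'.
Proof.
move=> E; apply: opens_eq => V.
by split=> /oset_over[g Vg /E Ug]; apply/oset_over; exists g.
Qed.

Section Sections.
Variable lambda : seq int.

Lemma section_tri (U : opens (flag k n)) f g g' d : is_section lambda U f ->
  g \in unitmx -> over U g' -> tri d (Yof g) (Yof g') ->
  f g' = \prod_(i < n) d i ^ lambda`_i * f g.
Proof.
move=> [_ eq_f _] ug Ug' T; have ug' := over_unit Ug'.
have [b [ub tb ->] bd] := tri_frame ug ug' T.
rewrite eq_f // mulrA -big_split big1 ?mul1r // => i _ /=.
rewrite bd -expfzDr ?subrr ?addrN //; last first.
  by have := trig_diag_neq0 ub tb (ltn_ord i); rewrite trig_diagE bd.
Qed.

Lemma section_of (U : opens (flag k n)) f :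
  (forall g g' d, over U g -> over U g' -> (forall a, (a < n)%N -> d a != 0) ->
     tri d (Yof g) (Yof g') -> f g' = \prod_(i < n) d i ^ lambda`_i * f g) ->
  (forall g, over U g -> rational_at (over U) g f) ->
  (forall g, ~ over U g -> f g = 0) -> is_section lambda U f.
Proof.
move=> eqf ratf zf; split=> // b g ub tb Ug.
have Ubg := over_mul ub tb Ug.
have T := trig_tri ub tb (over_unit Ubg) (over_unit Ug) erefl.
have d0 a : (a < n)%N -> trig_diag b a != 0 by exact: trig_diag_neq0.
rewrite (eqf _ _ _ Ubg Ug d0 T) mulrA -big_split big1 ?mul1r // => i _ /=.
by rewrite trig_diagE -expfzDr ?addNr //; rewrite -trig_diagE d0.
Qed.

End Sections.

End FrameSets.

(** * Gaussian elimination and cells *)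

Section Elimination.
Variables (k : closedFieldType) (n : nat).
Implicit Types (Y : nat -> 'I_n -> k) (d : nat -> k) (i j : 'I_n) (piv : seq 'I_n)
  (ss : seq ('I_n * seq 'I_n)).

Definition elim1 (r : nat) i Y : nat -> 'I_n -> k :=
  fun a j => if (r < a)%N then Y a j - Y a i / Y r i * Y r j else Y a j.

Fixpoint elim (r : nat) piv Y : nat -> 'I_n -> k :=
  if piv is i :: piv' then elim r.+1 piv' (elim1 r i Y) else Y.

Definition pivots ss : seq 'I_n := [seq s.1 | s <- ss].
Definition levels ss : seq (seq 'I_n) := [seq s.1 :: s.2 | s <- ss].

(** Each entry of [ss] lists a pivot column and further columns in which the reduced row must not
    vanish. These are intersections of coordinate open sets, taken successively in the projective
    spaces of rows. *)
Fixpoint cond (r : nat) ss Y : bool :=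
  if ss is s :: ss' then all (fun j => Y r j != 0) (s.1 :: s.2) && cond r.+1 ss' (elim1 r s.1 Y)
  else true.

Lemma elim_cat r p p' Y : elim r (p ++ p') Y = elim (r + size p) p' (elim r p Y).
Proof.
elim: p r Y => [|i p IH] r Y /=; first by rewrite addn0.
by rewrite IH addSnnS.
Qed.

Lemma elim_row r piv Y a : (a <= r)%N -> elim r piv Y a = Y a.
Proof.
elim: piv r Y => //= i piv IH r Y ar; rewrite IH; last exact: leqW.
by apply/funext => j; rewrite /elim1 ltnNge ar.
Qed.

Lemma cond_cat r ss ss' Y :
  cond r (ss ++ ss') Y = cond r ss Y && cond (r + size ss) ss' (elim r (pivots ss) Y).
Proof.
elim: ss r Y => [|s ss IH] r Y /=; first by rewrite addn0.
by rewrite IH addSnnS !andbA.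
Qed.

Lemma condP r ss Y : reflect (forall q, (q < size ss)%N -> forall j, j \in nth [::] (levels ss) q ->
  elim r (pivots ss) Y (r + q) j != 0) (cond r ss Y).
Proof.
elim: ss r Y => [|s ss IH] r Y; first by apply: (iffP idP).
apply: (iffP andP) => [[/allP H0 /IH H] [|q] qs j js|H].
- by rewrite addn0 elim_row //; exact: H0.
- by rewrite /= -addSnnS; exact: H.
split; first by apply/allP => j js; have := H 0 isT j js; rewrite addn0 elim_row.
by apply/IH => q qs j js; rewrite addSnnS; exact: H q.+1 qs j js.
Qed.

Lemma tri_row r d Y Y' a j : tri_from r d Y Y' -> (a < n)%N -> (a <= r)%N ->
  Y' a j = d a * Y a j.
Proof. by move=> T an ar; have [c ->] := T a an; rewrite big_geq ?addr0. Qed.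

Lemma tri_elim1 r i d Y Y' : (r < n)%N -> Y r i != 0 -> d r != 0 ->
  tri_from r d Y Y' -> tri_from r.+1 d (elim1 r i Y) (elim1 r i Y').
Proof.
move=> rn Yi dr T a an.
have [ar|ra] := leqP a r.
  exists (fun=> 0) => j; rewrite big1 ?addr0; last by move=> l _; rewrite mul0r.
  by rewrite /elim1 ltnNge ar /= (tri_row _ T).
have [c cE] := T a an; exists c => j.
rewrite /elim1 ra !cE !(tri_row _ T rn (leqnn r)).
rewrite !(big_ltn ra).
have -> : \sum_(r.+1 <= l < a) c l * (if (r < l)%N then Y l j - Y l i / Y r i * Y r j else Y l j) =
   \sum_(r.+1 <= l < a) c l * Y l j - (\sum_(r.+1 <= l < a) c l * Y l i) / Y r i * Y r j.
  rewrite !mulr_suml -sumrB; apply: eq_big_nat => l /andP[rl _].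
  by rewrite rl mulrBr !mulrA.
by field; rewrite dr Yi.
Qed.

(** After elimination a change of frame merely rescales the reduced rows, the next row included.
    Hence nonvanishing conditions on them define sets of flags. *)
Lemma cond_tri r ss d Y Y' : (r + size ss <= n)%N -> (forall a, (a < n)%N -> d a != 0) ->
  tri_from r d Y Y' -> cond r ss Y ->
  cond r ss Y' /\ tri_from (r + size ss) d (elim r (pivots ss) Y) (elim r (pivots ss) Y').
Proof.
elim: ss r Y Y' => [|s ss IH] r Y Y' rn d0 T; first by rewrite addn0.
rewrite /= in rn *; have rn' : (r < n)%N by rewrite (leq_trans _ rn) // addnS ltnS leq_addr.
move=> /andP[/andP[p0 H] C].
have rn2 : (r.+1 + size ss <= n)%N by rewrite addSnnS.
have [C' T'] := IH r.+1 _ _ rn2 d0 (tri_elim1 rn' p0 (d0 _ rn') T) C.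
rewrite C' andbT addnS -addSn; split=> //.
rewrite (tri_row _ T) // mulf_neq0 ?d0 //=.
by apply: sub_all H => j Yj /=; rewrite (tri_row _ T) // mulf_neq0 ?d0.
Qed.

Lemma elim_tri r piv Y : tri (fun=> 1) (elim r piv Y) Y.
Proof.
elim: piv r Y => [|i piv IH] r Y /=.
  move=> a _; exists (fun=> 0) => j; rewrite mul1r big1 ?addr0 // => l _; exact: mul0r.
suff T : tri (fun=> 1) (elim1 r i Y) Y.
  have := tri_trans (IH r.+1 (elim1 r i Y)) T.
  by congr (tri _ _ _); apply/funext => a; rewrite mulr1.
move=> a an; have [ar|ra] := leqP a r.
  exists (fun=> 0) => j; rewrite big1 ?addr0; last by move=> l _; exact: mul0r.
  by rewrite /elim1 ltnNge ar mul1r.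
exists (fun l => if l == r then Y a i / Y r i else 0) => j.
rewrite big_mkord (bigD1 (Ordinal ra)) //= eqxx big1 ?addr0; last first.
  by move=> l; rewrite -val_eqE /= => /negPf ->; exact: mul0r.
by rewrite /elim1 ra ltnn mul1r subrK.
Qed.

Lemma elim_zero r piv Y a i : (forall b, (r <= b)%N -> Y b i = 0) -> (r <= a)%N ->
  elim r piv Y a i = 0.
Proof.
elim: piv r Y => [|i' piv IH] r Y Y0 ra /=; first exact: Y0.
have [E|ne] := eqVneq a r.
  by rewrite elim_row ?E ?leqnn // /elim1 ltnn Y0.
apply: IH; last by rewrite ltn_neqAle eq_sym ne.
by move=> b rb; rewrite /elim1 rb !Y0 ?leqnn ?mulr0 ?mul0r ?subr0 // ltnW.
Qed.

Lemma elim_pivot r ss Y q a : cond r ss Y -> (q < size ss)%N -> (r + q < a)%N ->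
  forall i, nth i (pivots ss) q = i -> elim r (pivots ss) Y a i = 0.
Proof.
elim: ss r q Y => // s ss IH r [|q] Y /= /andP[/andP[p0 _] C] qs qa i.
  move=> <-; apply: elim_zero; last by rewrite addn0 in qa.
  by move=> b rb; rewrite /elim1 rb divfK ?subrr.
by apply: IH => //; rewrite addSnnS.
Qed.

Lemma elim_id r piv Y : (forall q a, (q < size piv)%N -> (r + q < a)%N ->
  forall i, nth i piv q = i -> Y a i = 0) -> elim r piv Y = Y.
Proof.
elim: piv r Y => // i piv IH r Y H /=.
have E : elim1 r i Y = Y.
  apply/funext => a; apply/funext => j; rewrite /elim1; case: ifP => // ra.
  by rewrite (H 0 a isT _ i) ?addn0 // !mul0r subr0.
rewrite E; apply: IH => q a qs qa i'; apply: (H q.+1) => //.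
by rewrite -addSnnS.
Qed.

Lemma rational_elim (O : 'M[k]_n -> Prop) g (Yf : 'M[k]_n -> nat -> 'I_n -> k) r ss :
  O g -> (forall a j, rational_at O g (fun x => Yf x a j)) -> cond r ss (Yf g) ->
  (exists Q : mpoly.mpoly (n * n) k, mx_eval Q g != 0 /\
     forall x, O x -> mx_eval Q x != 0 -> cond r ss (Yf x)) /\
  forall a j, rational_at O g (fun x => elim r (pivots ss) (Yf x) a j).
Proof.
elim: ss r Yf => [|s ss IH] r Yf Og R /=.
  by split=> //; exists (mpoly.mpolyC _ 1); split=> //; rewrite mx_eval1 oner_neq0.
move=> /andP[/andP[p0 H] C].
have R1 a j : rational_at O g (fun x => elim1 r s.1 (Yf x) a j).
  rewrite /elim1; case: (r < a)%N => //.
  exact: rationalB (R a j) (rationalM (rational_div Og p0 (R a s.1) (R r s.1)) (R r j)).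
have [[Q [Qg QC]] RE] := IH r.+1 _ Og R1 C; split=> //.
have : forall l, all (fun j => Yf g r j != 0) l -> exists Q : mpoly.mpoly (n * n) k,
    mx_eval Q g != 0 /\ forall x, O x -> mx_eval Q x != 0 -> all (fun j => Yf x r j != 0) l.
  elim=> [|j l IHl] /=.
    by exists (mpoly.mpolyC _ 1); split=> //; rewrite mx_eval1 oner_neq0.
  move=> /andP[j0 /IHl[Q1 [Q1g H1]]]; have [Q2 [Q2g H2]] := rational_neq0 Og j0 (R r j).
  exists (Q1 * Q2); split=> [|x Ox]; rewrite mx_evalM; first by rewrite mulf_neq0.
  by rewrite mulf_eq0 negb_or => /andP[q1 q2]; rewrite H1 // H2.
move=> /(_ (s.1 :: s.2)) []; first by rewrite /= p0.
move=> Q1 [Q1g H1]; exists (Q1 * Q); split=> [|x Ox]; rewrite mx_evalM; first by rewrite mulf_neq0.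
rewrite mulf_eq0 negb_or => /andP[q1 q]; rewrite QC // andbT.
exact: H1 q1.
Qed.

Lemma rational_Yof (O : 'M[k]_n -> Prop) g a j : O g -> (forall x, O x -> x \in unitmx) ->
  rational_at O g (fun x => Yof x a j).
Proof.
move=> Og Ou; rewrite /Yof; case: insubP => [i _ _|_]; last exact: rational_cst.
by apply: rational_inv => // i' j'; exact: rational_entry.
Qed.

Definition reduced ss (g : 'M[k]_n) : nat -> 'I_n -> k := elim 0 (pivots ss) (Yof g).

(** The columns in [s] constrain the row following those of [ss] without a pivot being chosen in it;
    with one column in [s] these are the members of a cover of the cell of [ss]. *)
Definition cell ss (s : seq 'I_n) : opens (flag k n) :=
  opens_of (fun g => cond 0 ss (Yof g) && all (fun j => reduced ss g (size ss) j != 0) s).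

Lemma over_cell ss s g : (size ss < n)%N \/ (size ss <= n)%N /\ s = [::] ->
  over (cell ss s) g <->
  [/\ g \in unitmx, cond 0 ss (Yof g) & all (fun j => reduced ss g (size ss) j != 0) s].
Proof.
move=> sn; have sn' : (size ss <= n)%N by case: sn => [/ltnW|[]].
rewrite over_opens_of; first by split=> [[? /andP[]]|[? ? ?]] //; split=> //; apply/andP.
  move=> g1 g2 d u1 u2 d0 T /andP[C H].
  have [C' T'] := cond_tri (r := 0) sn' d0 T C; rewrite C' /=.
  case: sn => [sn|[_ ->//]]; apply: sub_all H => j; rewrite /reduced => H.
  by rewrite (tri_row _ T') // mulf_neq0 // d0.
move=> g1 u1 /andP[C H].
have RY a j : rational_at (fun x => x \in unitmx) g1 (fun x => Yof x a j) by exact: rational_Yof.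
have [[Q [Qg QC]] R] := rational_elim u1 RY C.
case: s H {sn} => [|j0 s0] H.
  by exists Q; split=> // g' u' Q'; rewrite /= andbT; exact: QC.
have : cond (size ss) [:: (j0, s0)] (elim 0 (pivots ss) (Yof g1)) by rewrite /= andbT.
move=> /(rational_elim u1 R)[[Q' [Qg' QC']] _].
exists (Q * Q'); split=> [|x ux]; rewrite mx_evalM; first by rewrite mulf_neq0.
rewrite mulf_eq0 negb_or => /andP[q q']; rewrite QC //=.
by have := QC' x ux q'; rewrite /= andbT.
Qed.

End Elimination.

(** * Sections of line bundles on the big cells *)

Section LineBundleComplex.
Variables (k : closedFieldType) (n : nat) (lambda : seq int).
Local Notation X := (flag k n).
Local Notation L := (line_bundle k n lambda).

Lemma over_opensI (U U' : opens X) g : over (opensI U U') g <-> over U g /\ over U' g.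
Proof.
split=> [[V [UV UV'] Vg]|[[V UV Vg] [V' UV' V'g]]]; first by split; exists V.
by exists V => //; split=> //; rewrite (adapted_inj Vg V'g).
Qed.

Lemma is_section_lin (U : opens X) (a : k) (f h : 'M[k]_n -> k^o) :
  is_section lambda U f -> is_section lambda U h -> is_section lambda U (a *: f + h).
Proof.
move=> /asboolP sf /asboolP sh; apply/asboolP.
by have [_ H] := section_pred_submod lambda U; exact: H.
Qed.

Lemma is_section0 (U : opens X) : is_section lambda U (0 : 'M[k]_n -> k^o).
Proof. by apply/asboolP; have [H _] := section_pred_submod lambda U. Qed.

Lemma is_section_restrict (U V : opens X) f : V `<=` U ->
  is_section lambda U f -> is_section lambda V (restrict V f).
Proof.
move=> h sf; pose s := Sections (lambda := lambda) (U := U) (section_val := f) (asboolT sf).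
by apply/asboolP; exact: (restrict_subproof h s).
Qed.

Lemma is_section_val (U : opens X) (s : sections lambda U) : is_section lambda U s.
Proof. by apply/asboolP; exact: section_valP. Qed.

Section Cover.
Variables (J : finType) (W0 : opens X) (W : J -> opens X).
Local Notation Wn := (meets W0 W).

Lemma over_meets s g : over (Wn s) g <-> over W0 g /\ forall j, j \in s -> over (W j) g.
Proof.
elim: s => [|i s IH] /=; first by split=> [|[]].
rewrite over_opensI; split=> [[Wi /IH[? H]]|[W0x H]].
  by split=> // j; rewrite inE => /predU1P[->//|/H].
by split; [apply: H; rewrite mem_head|apply/IH; split=> // j js; apply: H; rewrite inE js orbT].
Qed.

Definition frame_face := face k (fun (j : J) (g : 'M[k]_n) => over (W j) g).

Lemma frame_face_restrict s1 j s2 f : is_section lambda (Wn (s1 ++ s2)) f ->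
  frame_face j f = restrict (Wn (s1 ++ j :: s2)) f.
Proof.
move=> [_ _ zf]; apply/funext => g; rewrite /= /fcut /restrict.
have E : over (Wn (s1 ++ j :: s2)) g <-> over (W j) g /\ over (Wn (s1 ++ s2)) g.
  rewrite !over_meets; split=> [[W0x H]|[Wj [W0x H]]].
    split; first by apply: H; rewrite mem_cat mem_head orbT.
    by split=> // i; rewrite mem_cat => ii; apply: H; rewrite mem_cat inE orbCA ii orbT.
  split=> // i; rewrite mem_cat inE orbCA => /predU1P[->//|ii].
  by apply: H; rewrite mem_cat.
case: asboolP => [Wj|nW]; case: asboolP => [Wx|nWx] //.
  by apply: zf => Wx; apply: nWx; apply/E.
by case: nW; have /E[] := Wx.
Qed.

Fact frame_face_section s1 j s2 f : is_section lambda (Wn (s1 ++ s2)) f ->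
  is_section lambda (Wn (s1 ++ j :: s2)) (frame_face j f).
Proof.
move=> sf; rewrite (frame_face_restrict j sf); apply: is_section_restrict sf.
exact: meets_ins.
Qed.

Definition section_complex : double_complex k J :=
  plain_complex (fun s => is_section0 (Wn s)) (fun s => @is_section_lin (Wn s)) frame_face_section.

Definition section_rel (s : seq J) (u : resolution_complex L W0 W 0) (f : section_complex 0) : Prop :=
  exists sg : sections lambda (Wn s),
    f = section_val sg /\ u = fval (germ_aug L (Wn s) (sg : L (Wn s)) : fsections k _ (Wn s)).

(** By exactness at the augmentation the kernel of the first differential is the line bundle itself,
    so cochains in an abstract resolution may be replaced by functions on frames. *)
Lemma section_kernel_iso : kernel_iso section_rel.
Proof.
split.
- move=> s a u u' v v' _ [sg [-> ->]] [tg [-> ->]]; exists (a *: sg + tg); split=> //.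
  by rewrite (linearP (germ_aug L (Wn s))).
- move=> s u _ [/rinE[sg ->]] /=; rewrite rdifE => d0.
  have /cogerm_exact im : germ_diff L 0 (Wn s) sg = 0 by apply: val_inj.
  have [t tE] := mono_in_image (@germ_aug_mono _ _ L) im.
  exists (section_val (t : sections lambda (Wn s))).
    by split=> //; exact: is_section_val.
  by exists t; rewrite -tE.
- move=> s f _ [sf _]; pose sg := Sections (lambda := lambda) (U := Wn s) (section_val := f) (asboolT sf).
  exists (fval (germ_aug L (Wn s) (sg : L (Wn s)) : fsections k _ (Wn s))); last by exists sg.
  split; first exact: rin_fval.
  apply: (etrans (rdifE _)); rewrite (_ : germ_diff L 0 (Wn s) _ = 0) //.
  apply/cogerm_exact => x Wx; exists (Wn s), (@subset_refl _ _); split=> //.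
  by exists sg; rewrite res_id.
- move=> s u f _ [sg [-> ->]]; split=> [E|E].
    suff -> : sg = 0 by [].
    by apply: (@germ_aug_mono _ _ L); rewrite linear0; apply: val_inj.
  have -> : sg = 0 by apply: val_inj.
  by rewrite (linear0 (germ_aug L (Wn s))).
- move=> s1 j s2 u f _ [sg [-> ->]].
  have h := @meets_ins X J W0 W s1 j s2.
  exists (section_res h sg); split.
    by rewrite [LHS](frame_face_restrict j (is_section_val sg)).
  pose rg : fsections k (@stage_pi k X (stages L 0)) (Wn (s1 ++ s2)) := germ_aug L (Wn (s1 ++ s2)) sg.
  apply: (etrans (rface_res j rg)); congr (fval _).
  by rewrite (shom_res (germ_aug L) h).
Qed.

Lemma section_cech_vanish :
  (forall m (c : seq J -> ('M[k]_n -> k^o)),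
     (forall s, size s = m.+2 -> is_section lambda (Wn s) (c s)) ->
     (forall s, size s = m.+3 -> delta frame_face c s = 0) ->
     exists b, (forall u, size u = m.+1 -> is_section lambda (Wn u) (b u)) /\
       forall s, size s = m.+2 -> c s = delta frame_face b s) ->
  cech_vanish L W0 W.
Proof.
move=> H m; have := kernel_iso_sym section_kernel_iso.
move=> /(@cech_transfer _ _ _ _ _ m.+1 0); apply.
by apply: plain_vanish => c; exact: H.
Qed.

End Cover.

End LineBundleComplex.

Section MatrixPolynomials.
Variables (k : closedFieldType) (n : nat).
Local Notation mp := (mpoly.mpoly (n * n) k).

Lemma mx_eval_meval (P : mp) (u : 'I_(n * n) -> k) :
  mx_eval P (vec_mx (\row_i u i)) = mpoly.meval u P.
Proof. by apply: mpoly.meval_eq => i; rewrite vec_mxK mxE. Qed.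

Lemma mx_nullstellensatz N (h : 'I_N -> mp) (q : mp) :
  (forall u, mx_eval q u != 0 -> exists j, mx_eval (h j) u != 0) ->
  exists M a, q ^+ M = \sum_j a j * h j.
Proof.
move=> H; apply: nullstellensatz_finite => u; rewrite -mx_eval_meval => /H[j].
by rewrite mx_eval_meval; exists j.
Qed.

Lemma mx_quasi_compact (F : mp -> Prop) (q : mp) :
  (forall u, mx_eval q u != 0 -> exists2 h, F h & mx_eval h u != 0) ->
  exists N (h : 'I_N -> mp), (forall j, F (h j)) /\
    forall u, mx_eval q u != 0 -> exists j, mx_eval (h j) u != 0.
Proof.
move=> H; have [u|N [h [Fh hu]]] := @quasi_compact k (n * n) F q.
  by rewrite -mx_eval_meval => /H[h Fh]; rewrite mx_eval_meval; exists h.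
by exists N, h; split=> // u; apply: hu.
Qed.

Lemma mx_global_fraction (f : 'M[k]_n -> k) (q : mp) :
  (forall u, mx_eval q u != 0 -> rational_at (fun u' => mx_eval q u' != 0) u f) ->
  exists P M, forall u, mx_eval q u != 0 -> f u = mx_eval P u / mx_eval q u ^+ M.
Proof.
move=> H; have [u|P [M PE]] := @global_fraction k (n * n) (fun u => f (vec_mx (\row_i u i))) q.
  rewrite -mx_eval_meval => /H[P [Q [Qu E]]]; exists P, Q; rewrite -mx_eval_meval; split=> // u'.
  by rewrite -!mx_eval_meval => q' Q'; exact: E.
exists P, M => u qu; have := PE (fun i => mxvec u 0 i) qu.
by rewrite (_ : \row_i _ = mxvec u) ?mxvecK // ; apply/rowP => i; rewrite mxE.
Qed.

Lemma mx_evalX (P : mp) m u : mx_eval (P ^+ m) u = mx_eval P u ^+ m.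
Proof. exact: mevalXn. Qed.

Lemma mx_eval_sum (I : Type) (s : seq I) (F : I -> mp) u :
  mx_eval (\sum_(i <- s) F i) u = \sum_(i <- s) mx_eval (F i) u.
Proof. exact: raddf_sum. Qed.

Lemma mx_eval_prod (I : Type) (s : seq I) (F : I -> mp) u :
  mx_eval (\prod_(i <- s) F i) u = \prod_(i <- s) mx_eval (F i) u.
Proof. exact: rmorph_prod. Qed.

(* Rows are indexed by nat in Yof, hence this padding by zeros. *)
Definition rowf (A : 'M[k]_n) : nat -> 'I_n -> k :=
  fun r j => if insub r is Some i then A i j else 0.

Lemma rowfE A (i j : 'I_n) : rowf A i j = A i j.
Proof. by rewrite /rowf valK. Qed.

End MatrixPolynomials.

Section PivotedFrames.
Variables (k : closedFieldType) (n : nat) (piv : seq 'I_n).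
Hypothesis size_piv : size piv = n.

Definition pivot_col (q : 'I_n) : 'I_n := nth q piv q.
Local Notation pv := pivot_col.

Lemma pvE (q : 'I_n) j : nth j piv q = pv q.
Proof. by apply: set_nth_default; rewrite size_piv. Qed.

Lemma pivoted_frame (A : 'M[k]_n) : (forall q, A q (pv q) != 0) ->
  (forall q a : 'I_n, (q < a)%N -> A a (pv q) = 0) ->
  frame_of (rowf A) \in unitmx /\ Yof (frame_of (rowf A)) = rowf A.
Proof.
move=> A0 A1; pose M : 'M[k]_n := \matrix_(j, c) rowf A (rev_ord c) j.
have uM : M \in unitmx.
  rewrite -unitmx_tr; apply: unitmx_kernel => w w0.
  suff H q : forall a : 'I_n, (a < q)%N -> w 0 (rev_ord a) = 0.
    by apply/rowP => i; rewrite [RHS]mxE -(rev_ordK i); exact: H (ltnSn _).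
  elim: q => // q IH a; rewrite ltnS leq_eqVlt => /predU1P[aq|]; last exact: IH.
  have := congr1 (fun B : 'rV_n => B 0 (pv a)) w0; rewrite !mxE.
  rewrite (reindex_inj rev_ord_inj) (bigD1 a) //= big1 ?addr0; last first.
    move=> b ba; rewrite !mxE rev_ordK rowfE.
    have [ab|ba'] := ltnP a b; first by rewrite A1 ?mulr0.
    rewrite IH ?mul0r // -aq ltn_neqAle ba'.
    by rewrite -val_eqE in ba; rewrite ba.
  by rewrite !mxE rev_ordK rowfE => /eqP; rewrite mulf_eq0 (negPf (A0 a)) orbF => /eqP.
have fE : frame_of (rowf A) = invmx M by [].
split; first by rewrite fE unitmx_inv.
apply/funext => r; apply/funext => j; rewrite /Yof fE invmxK /rowf.
by case: insubP => // i _ _; rewrite mxE rev_ordK rowfE.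
Qed.

End PivotedFrames.

(** * Affine charts of the flag variety and their principal open sets *)

Section Chart.
Variables (k : closedFieldType) (n : nat) (piv : seq 'I_n).
Hypotheses (size_piv : size piv = n) (uniq_piv : uniq piv).
Variable lambda : seq int.
Local Notation mp := (mpoly.mpoly (n * n) k).
Local Notation pv := (pivot_col piv).
Implicit Types (u g : 'M[k]_n) (q : mp).

Definition full : seq ('I_n * seq 'I_n) := [seq (i, [::]) | i <- piv].

Lemma pivots_full : pivots full = piv.
Proof. by rewrite /pivots -map_comp map_id. Qed.

Lemma size_full : size full = n. Proof. by rewrite size_map. Qed.

(** A retraction of all matrices onto the normal forms of the chart. The chart is parametrised by
    arbitrary matrices whose prescribed entries are overwritten, so that polynomials in [n * n]
    variables and the Nullstellensatz apply as they are. *)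
Definition mask u : 'M[k]_n := \matrix_(i, j)
  if j \in take i piv then 0 else if j == pv i then 1 else u i j.

Lemma pv_notin (i : 'I_n) (q : 'I_n) : (q < i)%N = (pv q \in take i piv).
Proof.
rewrite in_take ?mem_nth ?size_piv //.
by rewrite /pivot_col index_uniq ?size_piv.
Qed.

Lemma mask_pv u i : mask u i (pv i) = 1.
Proof. by rewrite mxE -pv_notin ltnn eqxx. Qed.

Lemma mask_zero u (q a : 'I_n) : (q < a)%N -> mask u a (pv q) = 0.
Proof. by move=> qa; rewrite mxE -pv_notin qa. Qed.

Definition chart_frame u : 'M[k]_n := frame_of (rowf (mask u)).

Lemma chart_frame_unit u : chart_frame u \in unitmx.
Proof.
by have [] // := pivoted_frame (piv := piv) (A := mask u);
  [move=> q; rewrite mask_pv oner_neq0|exact: mask_zero].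
Qed.

Lemma Yof_chart u : Yof (chart_frame u) = rowf (mask u).
Proof.
by have [] // := pivoted_frame (piv := piv) (A := mask u);
  [move=> q; rewrite mask_pv oner_neq0|exact: mask_zero].
Qed.

Local Notation Z g := (reduced full g).

Lemma reduced_pivot g (i : 'I_n) : cond 0 full (Yof g) -> Z g i (pv i) != 0.
Proof.
move=> /condP /(_ i); rewrite size_full => /(_ (ltn_ord i) (pv i)); apply.
have -> : levels full = [seq [:: i] | i <- piv] by rewrite /levels -map_comp.
by rewrite (nth_map i) ?size_piv // mem_seq1.
Qed.

Lemma reduced_zero g (q a : 'I_n) : cond 0 full (Yof g) -> (q < a)%N -> Z g a (pv q) = 0.
Proof.
move=> C qa; apply: (elim_pivot C (q := q)); rewrite ?size_full //.
by rewrite pivots_full pvE.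
Qed.

(** Dividing by the pivots removes the last dependence on the frame: these are affine coordinates of
    the flag. *)
Definition coords g : 'M[k]_n := \matrix_(i, j) (Z g i j / Z g i (pv i)).

Lemma coords_zero g (i j : 'I_n) : cond 0 full (Yof g) -> j \in take i piv -> coords g i j = 0.
Proof.
move=> C jp; rewrite mxE; have jj : (index j piv < n)%N by rewrite -{2}size_piv index_mem (mem_take jp).
have -> : j = pv (Ordinal jj) by rewrite /pivot_col nth_index ?(mem_take jp).
rewrite reduced_zero ?mul0r //=.
by rewrite -(in_take _ (mem_take jp)).
Qed.

Lemma mask_coords g : cond 0 full (Yof g) -> mask (coords g) = coords g.
Proof.
move=> C; apply/matrixP => i j; rewrite mxE; case: ifP => [jp|_].
  by rewrite coords_zero.
case: eqP => [->|//]; by rewrite mxE divff // reduced_pivot.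
Qed.

Lemma mask_mask u : mask (mask u) = mask u.
Proof. by apply/matrixP => i j; rewrite mxE; case: ifP => H; rewrite mxE H //; case: eqP. Qed.

Lemma elim_chart u : elim 0 (pivots full) (Yof (chart_frame u)) = rowf (mask u).
Proof.
rewrite Yof_chart elim_id // => q a; rewrite pivots_full size_piv add0n => qn qa i iq.
rewrite /rowf; case: insubP => // b _ ba.
rewrite -iq -[q]/(val (Ordinal qn)) pvE // mask_zero //=.
by rewrite ba.
Qed.

Lemma cond_chart u : cond 0 full (Yof (chart_frame u)).
Proof.
apply/condP => q; rewrite size_full => qn j; rewrite elim_chart add0n.
have -> : levels full = [seq [:: i] | i <- piv] by rewrite /levels -map_comp.
rewrite (nth_map j) ?size_piv // mem_seq1 => /eqP ->.
by rewrite -[q]/(val (Ordinal qn)) pvE // rowfE mask_pv oner_neq0.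
Qed.

Lemma coords_chart u : coords (chart_frame u) = mask u.
Proof.
apply/matrixP => i j; rewrite mxE /reduced elim_chart !rowfE mask_pv divr1.
by [].
Qed.

Definition pivot_val g (a : nat) : k := if (insub a : option 'I_n) is Some i then Z g i (pv i) else 0.

Lemma pivot_valE g (i : 'I_n) : pivot_val g i = Z g i (pv i).
Proof. by rewrite /pivot_val valK. Qed.

Lemma chart_tri g : cond 0 full (Yof g) ->
  tri (pivot_val g) (Yof (chart_frame (coords g))) (Yof g).
Proof.
move=> C; rewrite Yof_chart mask_coords // => a an.
have zE (i : 'I_n) j : Z g i j = pivot_val g i * rowf (coords g) i j.
  by rewrite rowfE mxE pivot_valE mulrC divfK // reduced_pivot.
have [c cE] := @elim_tri k n 0 (pivots full) (Yof g) a an.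
exists (fun l => c l * pivot_val g l) => j; rewrite cE mul1r.
rewrite -[a]/(val (Ordinal an)) -/(reduced full g) zE; congr (_ + _).
apply: eq_big_nat => l /andP[_ la]; rewrite -[l]/(val (Ordinal (ltn_trans la an))).
by rewrite zE mulrA.
Qed.

Lemma coords_tri g g' d : (forall a, (a < n)%N -> d a != 0) -> cond 0 full (Yof g) ->
  tri d (Yof g) (Yof g') -> cond 0 full (Yof g') /\ coords g' = coords g.
Proof.
move=> d0 C T; have sf : (0 + size full <= n)%N by rewrite size_full.
have [C' T'] := cond_tri sf d0 T C; split=> //; apply/matrixP => i j; rewrite !mxE.
have E (j' : 'I_n) : Z g' i j' = d i * Z g i j'.
  by apply: tri_row T' _ _ => //; rewrite add0n size_full ltnW.
by rewrite !E -mulf_div divff ?mul1r ?d0.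
Qed.

Lemma rational_chart_frame (O : 'M[k]_n -> Prop) u i j : O u ->
  rational_at O u (fun x => chart_frame x i j).
Proof.
move=> Ou; apply: rational_inv => // [x _|a b].
  by have := chart_frame_unit x; rewrite /chart_frame /frame_of unitmx_inv.
apply: (@rational_ext _ _ _ _ (fun x => mask x (rev_ord b) a)) => [x _|].
  by rewrite [RHS]mxE rowfE.
apply: (@rational_ext _ _ _ _ (fun x => if a \in take (rev_ord b) piv then 0
   else if a == pv (rev_ord b) then 1 else x (rev_ord b) a)) => [x _|]; first by rewrite [RHS]mxE.
case: (a \in _); first exact: rational_cst.
by case: (a == _); [exact: rational_cst|exact: rational_entry].
Qed.

Lemma mask_poly q : exists qm : mp, forall u, mx_eval qm u = mx_eval q (mask u).
Proof.
elim/mpoly_closed: q => [c|l|p q [pm pE] [qm qE]|p q [pm pE] [qm qE]].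
- by exists (mpoly.mpolyC _ c) => u; rewrite !mx_evalC.
- case/mxvec_indexP: l => i j; rewrite /mask.
  exists (if j \in take i piv then mpoly.mpolyC _ 0 else if j == pv i then mpoly.mpolyC _ 1
    else mpoly.mpolyX k (mpoly.mnm1 (mxvec_index i j))) => u.
  rewrite mx_eval_var mxE; case: ifP => _; first by rewrite mx_evalC.
  by case: ifP => _; rewrite ?mx_evalC ?mx_eval_var.
- by exists (pm + qm) => u; rewrite !mx_evalD pE qE.
- by exists (pm * qm) => u; rewrite !mx_evalM pE qE.
Qed.

Lemma rational_coords g i j : g \in unitmx -> cond 0 full (Yof g) ->
  rational_at (fun x => x \in unitmx) g (fun x => coords x i j).
Proof.
move=> ug C; have [//|_ R] := @rational_elim k n (fun x => x \in unitmx) g (@Yof k n) 0 full ug _ C.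
  by move=> a b; exact: rational_Yof.
apply: (@rational_ext _ _ _ _ (fun x => Z x i j / Z x i (pv i))) => [x _|].
  by rewrite [RHS]mxE.
exact: rational_div ug (reduced_pivot _ C) (R i j) (R i (pv i)).
Qed.

Definition dopen q : opens (flag k n) :=
  opens_of (fun g => cond 0 full (Yof g) && (mx_eval q (coords g) != 0)).

Lemma over_dopen q g : over (dopen q) g <->
  [/\ g \in unitmx, cond 0 full (Yof g) & mx_eval q (coords g) != 0].
Proof.
rewrite over_opens_of; first by split=> [[? /andP[]]|[? ? ?]] //; split=> //; apply/andP.
  move=> g1 g2 d u1 u2 d0 T /andP[C q0].
  by have [C' E] := coords_tri d0 C T; rewrite C' E.
move=> g1 u1 /andP[C q0].
have RY a j : rational_at (fun x => x \in unitmx) g1 (fun x => Yof x a j) by exact: rational_Yof.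
have [[Q [Qg QC]] _] := rational_elim u1 RY C.
have Rq : rational_at (fun x => x \in unitmx) g1 (fun x => mx_eval q (coords x)).
  by apply: rational_comp => i j; exact: rational_coords.
have [Q' [Qg' QC']] := rational_neq0 (O := fun x => x \in unitmx) u1 q0 Rq.
exists (Q * Q'); split=> [|x ux]; rewrite mx_evalM; first by rewrite mulf_neq0.
by rewrite mulf_eq0 negb_or => /andP[? ?]; rewrite QC //= QC'.
Qed.

Lemma over_chart q u : over (dopen q) (chart_frame u) <-> mx_eval q (mask u) != 0.
Proof.
rewrite over_dopen coords_chart; split=> [[]//|q0]; split=> //.
  exact: chart_frame_unit.
exact: cond_chart.
Qed.

(** The equivariance factor between [g] and the normalised frame of the same flag; it trivialises
    the line bundle over the chart. *)
Definition chart_weight g : k := \prod_(i < n) Z g i (pv i) ^ lambda`_i.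

Lemma section_coords q f g : is_section lambda (dopen q) f -> over (dopen q) g ->
  f g = chart_weight g * f (chart_frame (coords g)).
Proof.
move=> sf og; have [ug C q0] := (over_dopen q g).1 og.
rewrite (section_tri sf (chart_frame_unit _) og (chart_tri C)); congr (_ * _).
by apply: eq_bigr => i _; rewrite pivot_valE.
Qed.

Lemma section_fraction q f : is_section lambda (dopen q) f ->
  exists P M, forall g, over (dopen q) g ->
    f g = chart_weight g * (mx_eval P (coords g) / mx_eval q (coords g) ^+ M).
Proof.
move=> sf; have [qm qmE] := mask_poly q.
have [|P [M PE]] := @mx_global_fraction k n (fun u => f (chart_frame u)) qm.
  move=> u qu; have ou : over (dopen q) (chart_frame u) by apply/over_chart; rewrite -qmE.
  have [rf _ _] := sf; have [P [Q [Qu PQ]]] := rf _ ou.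
  have R0 (H : mp) : rational_at (fun u' => mx_eval qm u' != 0) u (fun x => mx_eval H (chart_frame x)).
    by apply: rational_comp => i j; exact: rational_chart_frame.
  have [Q1 [Q1u Q1E]] := rational_neq0 (O := fun u' => mx_eval qm u' != 0) qu Qu (R0 Q).
  apply: (rational_local Q1u).
  apply: (@rational_ext _ _ _ _ (fun x => mx_eval P (chart_frame x) / mx_eval Q (chart_frame x))).
    move=> x [qx Q1x]; rewrite PQ //; first by apply/over_chart; rewrite -qmE.
    exact: Q1E.
  apply: (rational_sub (O := fun u' => mx_eval qm u' != 0)); first by move=> x [].
  exact: rational_div (R0 P) (R0 Q).
exists P, M => g og; have [ug C q0] := (over_dopen q g).1 og.
rewrite (section_coords sf og) PE; last by rewrite qmE mask_coords.
by rewrite qmE mask_coords.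
Qed.

End Chart.

Section ChartAcyclic.
Variables (k : closedFieldType) (n : nat) (piv : seq 'I_n).
Hypotheses (size_piv : size piv = n) (uniq_piv : uniq piv).
Variable lambda : seq int.
Local Notation X := (flag k n).
Local Notation L := (line_bundle k n lambda).
Local Notation mp := (mpoly.mpoly (n * n) k).
Local Notation pv := (pivot_col piv).
Local Notation dopen := (@dopen k n piv).
Implicit Types (u g : 'M[k]_n) (q : mp).

Lemma over_triR (U : opens X) g g' d : g' \in unitmx -> tri d (Yof g) (Yof g') ->
  over U g -> over U g'.
Proof.
move=> ug' T [V UV Vg]; exists V => //.
have [b [ub tb gE] _] := tri_frame (proj1 Vg) ug' T.
have [V' V'g'] := flag_of_frame ug'.
have : over (whole X) (b *m g') by exists V => //; rewrite -gE.
suff V'g : adapted V' g by rewrite (adapted_inj Vg V'g).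
rewrite gE; split; first by rewrite unitmx_mul ub ug'.
have [_ H] := V'g'; move=> i j ji; rewrite row_mul mulmx_sum_row; apply: memv_suml => l _.
rewrite mxE; have [jl|lj] := ltnP j l; first by rewrite (is_trig_mxP tb) // scale0r mem0v.
by rewrite memvZ // H // (leq_ltn_trans lj).
Qed.

Lemma rational_reduced ss g a b : g \in unitmx -> cond 0 ss (Yof g) ->
  rational_at (fun x => x \in unitmx) g (fun x => reduced ss x a b).
Proof.
move=> ug C; have [//|_ R] := @rational_elim k n (fun x => x \in unitmx) g (@Yof k n) 0 ss ug _ C.
  by move=> a' b'; exact: rational_Yof.
exact: R.
Qed.

Lemma rational_weight g : g \in unitmx -> cond 0 (full piv) (Yof g) ->
  rational_at (fun x => x \in unitmx) g (fun x => chart_weight piv lambda x).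
Proof.
move=> ug C; apply: rational_prod => i _; apply: rational_exprz => //.
  by rewrite reduced_pivot ?orbT.
exact: rational_reduced.
Qed.

Section Cover.
Variables (N : nat) (q : mp) (h : 'I_N -> mp).
Local Notation W0 := (dopen q).
Local Notation W := (fun j => dopen (h j)).
Local Notation Wn := (meets W0 W).
Hypothesis cover : forall u, mx_eval q (mask piv u) != 0 -> exists j, mx_eval (h j) (mask piv u) != 0.

Definition denom (s : seq 'I_N) : mp := q * \prod_(j <- s) h j.

Lemma meets_dopen s : Wn s = dopen (denom s).
Proof.
apply: opens_over_eq => g; rewrite over_meets !over_dopen //.
have dE : (mx_eval (denom s) (coords piv g) != 0) =
    (mx_eval q (coords piv g) != 0) && all (fun j => mx_eval (h j) (coords piv g) != 0) s.
  rewrite mx_evalM mulf_eq0 negb_or; congr (_ && _).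
  elim: s => [|j s IH]; first by rewrite big_nil mx_eval1 oner_neq0.
  by rewrite big_cons mx_evalM mulf_eq0 negb_or IH.
rewrite dE; split=> [[[ug C q0] H]|[ug C /andP[q0 /allP H]]].
  by split=> //; rewrite q0; apply/allP => j /H; rewrite over_dopen // => -[].
by split=> // j js; rewrite over_dopen //; split=> //; exact: H.
Qed.

(** The classical vanishing on affine open sets: powers of the [h j] generate a power of [q], which
    gives a partition of unity whose weights absorb the denominators of the cochain. *)
Lemma dopen_cech_vanish : cech_vanish L W0 W.
Proof.
apply: section_cech_vanish => m c cP c0.
have /boolp.choice[M /boolp.choice[P PE]] : forall s, exists M P, size s = m.+2 ->
    forall g, over (Wn s) g -> c s g = chart_weight piv lambda g *
      (mx_eval P (coords piv g) / mx_eval (denom s) (coords piv g) ^+ M).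
  move=> s; have [ss|ns] := pselect (size s = m.+2); last by exists 0%N, 0.
  have := cP s ss; rewrite meets_dopen => /(section_fraction size_piv uniq_piv)[P [M PE]].
  by exists M, P.
(* There are finitely many tuples of this length, so the pole orders have a common bound. *)
pose B := \max_(t : m.+2.-tuple 'I_N) M t.
have MB s : size s = m.+2 -> (M s <= B)%N.
  move=> ss; have := @leq_bigmax _ (fun t : m.+2.-tuple 'I_N => M t) (tcast ss (in_tuple s)).
  by rewrite val_tcast.
have [qm qmE] := mask_poly piv q.
have /boolp.choice[hm hmE] : forall j, exists hm : mp, forall u, mx_eval hm u = mx_eval (h j) (mask piv u).
  by move=> j; exact: mask_poly.
(* The exponent exceeds every pole order, so after the denominators are cleared a factor [h j]
   remains. It makes the product vanish at the zeros of [h j], where the cochain is extended by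
   zero. *)
have [|M' [a aE]] := @mx_nullstellensatz k n N (fun j => hm j ^+ B.+1) qm.
  by move=> u; rewrite qmE => /cover[j hj]; exists j; rewrite mx_evalX expf_neq0 // hmE.
pose w j g : k := if `[< over W0 g >] then
  mx_eval (a j) (coords piv g) * mx_eval (h j) (coords piv g) ^+ B.+1 / mx_eval q (coords piv g) ^+ M'
  else 0.
have w0 j g : ~ over (W j) g -> w j g = 0.
  rewrite /w; case: asboolP => // /over_dopen[] // ug C q0 nW.
  have [->|hj] := eqVneq (mx_eval (h j) (coords piv g)) 0; first by rewrite expr0n mulr0 mul0r.
  by case: nW; apply/over_dopen.
have w1 g : over W0 g -> \sum_j w j g = 1.
  move=> og; have [ug C q0] := (over_dopen size_piv _ _).1 og.
  have := congr1 (fun p => mx_eval p (coords piv g)) aE.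
  rewrite mx_evalX mx_eval_sum qmE mask_coords // => E.
  rewrite -(divff (expf_neq0 M' q0)) {1}E mulr_suml; apply: eq_bigr => j _.
  by rewrite /w asboolT // mx_evalM mx_evalX hmE mask_coords.
exists (contract w c); split; last first.
  move=> s ss; apply/funext => g; rewrite delta_contract //; last first.
    by move=> j; apply: c0; rewrite /= ss.
  have [og|nog] := pselect (over W0 g); first by rewrite w1 // mul1r.
  by have [_ _ ->] := cP s ss; rewrite ?mulr0 // => /over_meets[/nog].
move=> u su.
have szj j : size (j :: u) = m.+2 by rewrite /= su.
have oWn j g : over (Wn u) g -> over (W j) g -> over (Wn (j :: u)) g.
  by move=> ? ?; apply/over_opensI.
apply: section_of.
- move=> g g' d og og' d0 T; rewrite /contract mulr_sumr; apply: eq_bigr => j _.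
  have [W0g Wg] := (over_meets _ _ _ _).1 og; have [W0g' Wg'] := (over_meets _ _ _ _).1 og'.
  have [ug C q0] := (over_dopen size_piv _ _).1 W0g.
  have ug' := over_unit og'.
  have [C' cE] := coords_tri size_piv d0 C T.
  rewrite {1}/w {1}/w !asboolT // cE mulrCA; congr (_ * _).
  have [o'|no'] := pselect (over (Wn (j :: u)) g').
    by rewrite (section_tri (cP _ (szj j)) ug o' T).
  have [_ _ z] := cP _ (szj j); rewrite !z ?mulr0 // => o.
  exact: no' (over_triR ug' T o).
- move=> g og; apply: rational_sum => j _.
  have [W0g Wg] := (over_meets _ _ _ _).1 og.
  have [ug C q0] := (over_dopen size_piv _ _).1 W0g.
  have dE x : over (Wn u) x -> mx_eval (denom u) (coords piv x) != 0.
    by rewrite meets_dopen => /(over_dopen size_piv)[].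
  have dg := dE _ og.
  set Mj := M (j :: u); have MjB : (Mj <= B)%N by exact: MB.
  pose A : mp := a j * h j ^+ (B.+1 - Mj) * P (j :: u).
  pose D : mp := q ^+ M' * denom u ^+ Mj.
  have Rp (p : mp) : rational_at (fun x => x \in unitmx) g (fun x => mx_eval p (coords piv x)).
    by apply: rational_comp => i i'; exact: rational_coords.
  apply: (@rational_ext _ _ _ _ (fun x => chart_weight piv lambda x *
      (mx_eval A (coords piv x) / mx_eval D (coords piv x)))); last first.
    apply: (rational_sub (O := fun x => x \in unitmx)); first by move=> x /over_unit.
    apply: rationalM; first exact: rational_weight.
    by apply: rational_div => //; rewrite mx_evalM !mx_evalX mulf_neq0 ?expf_neq0.
  move=> x ox; have [W0x Wx] := (over_meets _ _ _ _).1 ox.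
  have [ux Cx qx] := (over_dopen size_piv _ _).1 W0x.
  have dx := dE _ ox.
  rewrite /w asboolT // /A /D !mx_evalM !mx_evalX.
  have [h0|hj] := eqVneq (mx_eval (h j) (coords piv x)) 0.
    rewrite h0 !expr0n /= subSn //= !mulr0 !mul0r mulr0.
    by [].
  have oj : over (Wn (j :: u)) x.
    by apply: oWn => //; apply/(over_dopen size_piv).
  rewrite (PE _ (szj j) _ oj) -/Mj.
  have -> : mx_eval (denom (j :: u)) (coords piv x) =
      mx_eval (h j) (coords piv x) * mx_eval (denom u) (coords piv x).
    by rewrite /denom big_cons !mx_evalM mulrCA.
  have -> : mx_eval (h j) (coords piv x) ^+ B.+1 =
      mx_eval (h j) (coords piv x) ^+ (B.+1 - Mj) * mx_eval (h j) (coords piv x) ^+ Mj.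
    by rewrite -exprD subnK // leqW.
  rewrite exprMn.
  have := expf_neq0 Mj hj; have := expf_neq0 Mj dx; have := expf_neq0 M' qx.
  move: (_ ^+ Mj) (_ ^+ Mj) (_ ^+ M') => x1 x2 x3 n3 n2 n1.
  by field; rewrite n1 n2 n3.
- move=> g nog; rewrite /contract big1 // => j _.
  have [_ _ ->] := cP _ (szj j); rewrite ?mulr0 // => /over_opensI[_].
  exact: nog.
Qed.

End Cover.

Lemma over_open_chart (U : opens X) u : over U (chart_frame piv u) ->
  exists2 p : mp, mx_eval p u != 0 &
    forall u', mx_eval p u' != 0 -> over U (chart_frame piv u').
Proof.
move=> oU; have [Q [Qg QU]] := over_open oU.
have RQ : rational_at (fun=> True) u (fun x => mx_eval Q (chart_frame piv x)).
  by apply: rational_comp => i j; exact: rational_chart_frame.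
have [p [pu pE]] := @rational_neq0 _ _ _ u (fun x => mx_eval Q (chart_frame piv x)) I Qg RQ.
by exists p => // u' pu'; apply: QU; [exact: chart_frame_unit|exact: pE].
Qed.

(** Cartan's criterion for principal open sets: they form a basis, finitely many of them suffice for
    a cover by quasi-compactness, and their intersections are principal. *)
Lemma dopen_acyclic q : acyclic L (dopen q).
Proof.
apply: (cartan_acyclic (B := fun U => exists q, U = dopen q)); last by exists q.
move=> W0 Q [{}q ->] loc here.
have [qm qmE] := mask_poly piv q.
pose F (p : mp) := exists2 h : mp, Q (dopen (h * q)) & forall u, mx_eval p u = mx_eval h (mask piv u).
have [|N [p [Fp pq]]] := @mx_quasi_compact k n F qm.
  move=> u; rewrite qmE => qu.
  have [V Vq Vg] : over (dopen q) (chart_frame piv u) by apply/over_chart.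
  have [U [UV Uq QU]] := loc V Vq.
  have oU : over U (chart_frame piv (mask piv u)).
    by rewrite /chart_frame mask_mask; exists V.
  have [h hu hU] := over_open_chart oU; have [hm hmE] := mask_poly piv h.
  exists hm; last by rewrite hmE.
  exists h => //; apply: here QU => V' /oset_over[g V'g /(over_dopen size_piv)[ug C]].
  rewrite mx_evalM mulf_eq0 negb_or => /andP[hg qg].
  have := over_triR ug (chart_tri size_piv uniq_piv C) (hU _ hg).
  by move=> oUg; apply/oset_over; exists g.
have /boolp.choice[h hP] : forall j, exists h : mp, Q (dopen (h * q)) /\
    forall u, mx_eval (p j) u = mx_eval h (mask piv u).
  by move=> j; have [h ? ?] := Fp j; exists h.
have cov u : mx_eval q (mask piv u) != 0 -> exists j, mx_eval (h j * q) (mask piv u) != 0.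
  move=> qu; have [|j] := pq u; first by rewrite qmE.
  have [_ ->] := hP j => hj.
  by exists j; rewrite mx_evalM mulf_neq0.
exists N, (fun j => dopen (h j * q)); split.
- by move=> j; have [] := hP j.
- move=> V /oset_over[g Vg /(over_dopen size_piv)[ug C qg]].
  have [|j hj] := cov (coords piv g); first by rewrite mask_coords.
  exists j; apply/oset_over; exists g => //; apply/(over_dopen size_piv); split=> //.
  by rewrite mask_coords in hj.
- by move=> s; exists (denom q (fun j => h j * q) s); exact: meets_dopen.
- exact: dopen_cech_vanish.
Qed.

End ChartAcyclic.

(** * Laurent polynomial sections *)

Section LaurentSums.
Variables (k : closedFieldType) (I : finType).
Local Notation expo := {ffun I -> int}.
Implicit Types (l : seq (k * expo)) (z : I -> k) (e : expo).

Definition lsum l z : k := \sum_(x <- l) x.1 * monomial x.2 z.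

Definition lcoef l e : k := \sum_(x <- l | x.2 == e) x.1.

Lemma lsum_lcoef l (es : seq expo) z : uniq es -> (forall x, x \in l -> x.2 \in es) ->
  lsum l z = \sum_(e <- es) lcoef l e * monomial e z.
Proof.
move=> ues sub; under eq_bigr => e _ do rewrite mulr_suml big_mkcond.
rewrite exchange_big /= /lsum !big_seq; apply: eq_bigr => x xl.
rewrite (bigD1_seq x.2) ?sub //= eqxx big1 ?addr0 // => e; rewrite eq_sym => /negPf ->.
by [].
Qed.

Definition lexpos l := undup [seq x.2 | x <- l].

Lemma lcoef_out l e : e \notin lexpos l -> lcoef l e = 0.
Proof.
rewrite mem_undup => nl; rewrite /lcoef big_seq_cond big1 // => x /andP[xl /eqP xe].
by case/negP: nl; apply/mapP; exists x.
Qed.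

Lemma lsum_eq l l' z : lcoef l =1 lcoef l' -> lsum l z = lsum l' z.
Proof.
move=> E; pose es := undup [seq x.2 | x <- l ++ l'].
rewrite !(@lsum_lcoef _ es) ?undup_uniq //.
- by apply: eq_bigr => e _; rewrite E.
- by move=> x xl; rewrite mem_undup map_f // mem_cat xl orbT.
- by move=> x xl; rewrite mem_undup map_f // mem_cat xl.
Qed.

Lemma lcoef_torus l l' :
  (forall z, (forall i, z i != 0) -> lsum l z = lsum l' z) -> lcoef l =1 lcoef l'.
Proof.
move=> H e; pose es := undup [seq x.2 | x <- l ++ l'].
have [ees|ne] := boolP (e \in es); last first.
  rewrite !lcoef_out //; apply: contra ne; rewrite !mem_undup map_cat mem_cat => ->//.
  by rewrite orbT.
apply/eqP; rewrite -subr_eq0; apply/eqP.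
apply: (@monomial_independent _ _ _ es id (fun e => lcoef l e - lcoef l' e)) ees => //.
  exact: undup_uniq.
move=> z z0; under eq_bigr do rewrite mulrBl.
rewrite sumrB -!lsum_lcoef ?undup_uniq ?H ?subrr //.
- by move=> x xl; rewrite mem_undup map_f // mem_cat xl orbT.
- by move=> x xl; rewrite mem_undup map_f // mem_cat xl.
Qed.

Lemma lsum_cat l l' z : lsum (l ++ l') z = lsum l z + lsum l' z.
Proof. exact: big_cat. Qed.

Definition lscale (a : k) l := [seq (a * x.1, x.2) | x <- l].

Lemma lsum_scale a l z : lsum (lscale a l) z = a * lsum l z.
Proof. by rewrite /lsum big_map mulr_sumr; apply: eq_bigr => x _; rewrite mulrA. Qed.

Lemma lcoef_cat l l' e : lcoef (l ++ l') e = lcoef l e + lcoef l' e.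
Proof. exact: big_cat. Qed.

Lemma lcoef_scale a l e : lcoef (lscale a l) e = a * lcoef l e.
Proof. by rewrite /lcoef big_map mulr_sumr. Qed.

Lemma lcoef_filter (p : pred expo) l e : lcoef [seq x <- l | p x.2] e = if p e then lcoef l e else 0.
Proof.
rewrite /lcoef big_filter_cond; case: ifP => pe.
  by apply: eq_bigl => x; case: eqP => [->|]; rewrite ?pe ?andbF.
by rewrite big1 // => x /andP[px /eqP xe]; rewrite xe pe in px.
Qed.

End LaurentSums.

(** * Cech complexes of Laurent polynomials *)

Section MonomialCech.
Variables (k : closedFieldType) (I : finType) (D : Type) (zeta : D -> I -> k).
Variables (J : finType) (D0 : D -> Prop) (sub : J -> D -> Prop).
Local Notation expo := {ffun I -> int}.
Variables (E : seq J -> expo -> Prop) (good : J -> expo -> Prop).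

Definition inside (s : seq J) (g : D) : Prop := D0 g /\ forall j, j \in s -> sub j g.

Hypothesis E_ins : forall s1 j s2 e, E (s1 ++ s2) e -> E (s1 ++ j :: s2) e.
Hypothesis E_good : forall s e, E s e -> exists j, good j e.
Hypothesis E_del : forall j s e, good j e -> E (j :: s) e -> E s e.
Hypothesis torus : forall s, s <> [::] -> forall z : I -> k, (forall i, z i != 0) ->
  exists2 g, inside s g & forall e, E s e -> monomial e (zeta g) = monomial e z.

Definition laurent (s : seq J) (f : D -> k^o) : Prop :=
  (exists2 l : seq (k * expo), (forall x, x \in l -> E s x.2) &
     forall g, inside s g -> f g = lsum l (zeta g)) /\
  forall g, ~ inside s g -> f g = 0.

Let Cface : J -> {linear (expo -> k^o) -> (expo -> k^o)} := face k (fun (_ : J) (_ : expo) => True).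

(** Relates a function to the coefficients of one of its Laurent expansions. It carries the cocycle
    condition over to coefficients, where all faces are the identity. *)
Let R (s : seq J) (f : D -> k^o) (C : expo -> k^o) : Prop :=
  (exists l : seq (k * expo), [/\ forall x, x \in l -> E s x.2, lcoef l =1 C &
     forall g, inside s g -> f g = lsum l (zeta g)]) /\
  forall g, ~ inside s g -> f g = 0.

Lemma inside_ins s1 j s2 g : inside (s1 ++ j :: s2) g <-> sub j g /\ inside (s1 ++ s2) g.
Proof.
split=> [[W0x H]|[Wj [W0x H]]].
  split; first by apply: H; rewrite mem_cat mem_head orbT.
  by split=> // i; rewrite mem_cat => ii; apply: H; rewrite mem_cat inE orbCA ii orbT.
split=> // i; rewrite mem_cat inE orbCA => /predU1P[->//|ii].
by apply: H; rewrite mem_cat.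
Qed.

Let R_lin s (a : k) u u' v v' : R s u u' -> R s v v' -> R s (a *: u + v) (a *: u' + v').
Proof.
move=> [[l [El lu uE]] u0] [[l' [El' lv vE]] v0]; split.
  exists (lscale a l ++ l'); split.
  - by move=> x; rewrite mem_cat => /orP[/mapP[y yl ->]|/El'//]; exact: (El y yl).
  - by move=> e; rewrite lcoef_cat lcoef_scale lu lv.
  - move=> g ig; change (a * u g + v g = lsum (lscale a l ++ l') (zeta g)).
    by rewrite lsum_cat lsum_scale uE // vE.
move=> g ng; change (a * u g + v g = 0).
by rewrite u0 // v0 // mulr0 addr0.
Qed.

Let R_ins s1 j s2 u u' : R (s1 ++ s2) u u' -> R (s1 ++ j :: s2) (face k sub j u) (Cface j u').
Proof.
move=> [[l [El lu uE]] u0]; split.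
  exists l; split.
  - by move=> x /El; exact: E_ins.
  - move=> e; rewrite lu; change (u' e = if `[< True >] then u' e else 0).
    by rewrite (asboolT Logic.I).
  - by move=> g /inside_ins[sj ig]; rewrite /= /fcut asboolT // uE.
move=> g ng; rewrite /= /fcut; case: asboolP => // sj; apply: u0 => ig.
by apply: ng; apply/inside_ins.
Qed.

Let R_eq0 s u u' : s <> [::] -> R s u u' -> u = 0 -> u' = 0.
Proof.
move=> s0 [[l [El lu uE]] _] u0; apply/funext => e; rewrite -lu.
rewrite (@lcoef_torus _ _ l [::]) ?/lcoef ?big_nil // => z z0.
have [g ig gE] := torus s0 z0; have := uE g ig; rewrite u0 /lsum big_nil => H.
by rewrite [RHS]H /lsum !big_seq; apply: eq_bigr => x /El xE; rewrite gE.
Qed.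

Let R_fun s u v C : R s u C -> R s v C -> u = v.
Proof.
move=> [[l [El lu uE]] u0] [[l' [El' lv vE]] v0]; apply/funext => g.
have [ig|ng] := pselect (inside s g); last by rewrite u0 // v0.
by rewrite uE // vE //; apply: lsum_eq => e; exact: etrans (lu e) (esym (lv e)).
Qed.

Let laurentR s f : laurent s f -> exists C, R s f C.
Proof. by move=> [[l El fE] f0]; exists (lcoef l); split=> //; exists l. Qed.

Let R_laurent s f C : R s f C -> laurent s f.
Proof. by move=> [[l [El _ fE]] f0]; split=> //; exists l. Qed.

(** The complex splits over exponents. For an exponent [e], putting in front of the tuples a fixed
    [j] with [good j e] is a contraction, and by [E_del] the monomial remains admissible after [j]
    is omitted. The points supplied by [torus] make coefficients unique. *)
Lemma laurent_exact m (c : seq J -> (D -> k^o)) :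
  (forall s, size s = m -> laurent s (c s)) ->
  (forall s, size s = m.+1 -> delta (face k sub) c s = 0) ->
  exists b, (forall u, (size u).+1 = m -> laurent u (b u)) /\
    forall s, size s = m -> c s = delta (face k sub) b s.
Proof.
move=> cL c0.
have /boolp.choice[C CP] : forall s, exists C, size s = m -> R s (c s) C.
  move=> s; have [/cL/laurentR[C H]|ns] := pselect (size s = m); first by exists C.
  by exists 0.
have C0 s : size s = m.+1 -> delta Cface C s = 0.
  move=> ss; have s0 : s <> [::] by move=> s0; rewrite s0 in ss.
  have := @delta_rel k J _ _ (face k sub) Cface R m c C.
  move=> /(_ _ _ CP s ss) H; apply: (R_eq0 s0 (H _ _)); last exact: c0.
    by move=> s' a u u' v v' _; exact: R_lin.
  by move=> s1 j s2 u u' _; exact: R_ins.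
(* The choice depends on the exponent alone and not on the tuple, so the weights are the same on all
   faces. *)
pose jsel e : option J := if pselect (exists j, good j e) is left h then Some (sval (cid h)) else None.
have jselP e j : jsel e = Some j -> good j e.
  by rewrite /jsel; case: pselect => // h [<-]; case: cid.
pose w (j : J) (e : expo) : k := (jsel e == Some j)%:R.
have w1 s e : E s e -> \sum_j w j e = 1.
  move=> /E_good h; rewrite /w /jsel; case: pselect => // h'.
  rewrite (bigD1 (sval (cid h'))) //= eqxx big1 ?addr0 // => j jn.
  by rewrite (_ : _ == _ = false) //; apply/eqP => -[e1]; rewrite e1 eqxx in jn.
pose B := contract w C.
have BC s : size s = m -> delta Cface B s = C s.
  move=> ss; apply/funext => e; rewrite delta_contract //; last first.
    by move=> j; apply: C0; rewrite /= ss.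
  have [[l [El lC _]] _] := CP s ss.
  have [ein|eout] := boolP (e \in lexpos l); last by rewrite -lC lcoef_out ?mulr0.
  rewrite (w1 s) ?mul1r //; move: ein; rewrite mem_undup => /mapP[x xl ->]; exact: El.
have /boolp.choice[b bP] : forall u, exists f, (size u).+1 = m -> R u f (B u).
  move=> u; have [su|nu] := pselect ((size u).+1 = m); last by exists 0.
  have /boolp.choice[l lP] : forall j, exists l : seq (k * expo),
      (forall x, x \in l -> E (j :: u) x.2) /\ lcoef l =1 C (j :: u).
    by move=> j; have [[l [El lC _]] _] := CP (j :: u) su; exists l.
  (* From the expansion of the cochain on [j :: u] only the monomials that chose [j] are kept; these
     are admissible on [u]. *)
  pose lB := flatten [seq [seq x <- l j | jsel x.2 == Some j] | j <- index_enum J].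
  have lBE : lcoef lB =1 B u.
    move=> e; rewrite /lB /lcoef big_flatten big_map /B /contract; apply: eq_bigr => j _.
    have := lcoef_filter (fun e => jsel e == Some j) (l j) e; rewrite /lcoef /= => ->.
    have [_ lC] := lP j; rewrite /w -lC.
    by case: eqP => _; rewrite ?mul1r ?mul0r.
  pose f g : k^o := if pselect (inside u g) is left _ then lsum lB (zeta g) else 0.
  exists f => _; split; last by move=> g ng; rewrite /f; case: pselect.
  exists lB; split=> //; last by move=> g ig; rewrite /f; case: pselect.
  move=> x /flattenP[_ /mapP[j _ ->]]; rewrite mem_filter => /andP[/eqP/jselP gj xl].
  by have [El _] := lP j; exact: E_del gj (El _ xl).
exists b; split=> [u su|s ss]; first exact: R_laurent (bP u su).
case: m => [|m'] in cL c0 CP C0 BC bP ss *.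
  case: s ss => // _; have := BC [::] erefl => /= C00.
  by apply: R_fun (CP [::] erefl) _; rewrite -C00; split=> //; exists [::]; split=> //;
    move=> *; rewrite /lcoef /lsum big_nil.
apply: R_fun (CP s ss) _; rewrite -BC //.
apply: (delta_rel (m := m')) => //.
- by move=> s' a u u' v v' _; exact: R_lin.
- by move=> s1 j s2 u u' _; exact: R_ins.
- by move=> u su; apply: bP; rewrite su.
Qed.

End MonomialCech.

Section LaurentSpan.
Variables (k : closedFieldType) (I : finType) (D : Type) (zeta : D -> I -> k) (O : D -> Prop).
Local Notation expo := {ffun I -> int}.
Implicit Types (E : expo -> Prop) (f : D -> k).

Definition lspan E f : Prop := exists2 l : seq (k * expo),
  (forall x, x \in l -> E x.2) & forall g, O g -> f g = lsum l (zeta g).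

Lemma lspan_ext E f f' : (forall g, O g -> f g = f' g) -> lspan E f -> lspan E f'.
Proof. by move=> H [l El fE]; exists l => // g og; rewrite -H // fE. Qed.

Lemma lspan_sub E E' f : (forall e, E e -> E' e) -> lspan E f -> lspan E' f.
Proof. by move=> H [l El fE]; exists l => // x /El /H. Qed.

Lemma lspan0 E : lspan E (fun=> 0).
Proof. by exists [::] => // g _; rewrite /lsum big_nil. Qed.

Lemma lspanD E f f' : lspan E f -> lspan E f' -> lspan E (fun g => f g + f' g).
Proof.
move=> [l El fE] [l' El' fE']; exists (l ++ l').
  by move=> x; rewrite mem_cat => /orP[/El|/El'].
by move=> g og; rewrite lsum_cat fE // fE'.
Qed.

Lemma lspan_monomial E e c : E e -> lspan E (fun g => c * monomial e (zeta g)).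
Proof.
move=> Ee; exists [:: (c, e)] => [x|g _]; first by rewrite inE => /eqP ->.
by rewrite /lsum big_seq1.
Qed.

Lemma monomial0 (z : I -> k) : monomial 0 z = 1.
Proof. by rewrite /monomial big1 // => i _; rewrite ffunE expr0z. Qed.

(** Since the inverse of 0 is 0, the law of exponents fails at [z i = 0] in general; nonnegative
    exponents are safe. *)
Lemma monomialD (z : I -> k) (e e' : expo) : (forall i, z i != 0 \/ (0 <= e i /\ 0 <= e' i)) ->
  monomial (e + e') z = monomial e z * monomial e' z.
Proof.
move=> H; rewrite /monomial -big_split; apply: eq_bigr => i _ /=; rewrite ffunE.
case: (H i) => [z0|[e0 e0']]; first by rewrite expfzDr.
by rewrite exprzD_ss ?e0 ?e0'.
Qed.

Lemma lspanM E E' E'' f f' : (forall e e', E e -> E' e' -> E'' (e + e')) ->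
  (forall e e' g, E e -> E' e' -> O g -> forall i, zeta g i != 0 \/ (0 <= e i /\ 0 <= e' i)) ->
  lspan E f -> lspan E' f' -> lspan E'' (fun g => f g * f' g).
Proof.
move=> EE Z [l El fE] [l' El' fE'].
exists [seq (x.1 * y.1, x.2 + y.2) | x <- l, y <- l'].
  by move=> x /allpairsP[[a b] /= [al bl ->]] /=; exact: EE (El _ al) (El' _ bl).
move=> g og; rewrite fE // fE' // /lsum big_allpairs_dep mulr_suml !big_seq.
apply: eq_bigr => x xl; rewrite mulr_sumr !big_seq; apply: eq_bigr => y yl /=.
rewrite monomialD; first by rewrite mulrACA.
exact: Z (El _ xl) (El' _ yl) og.
Qed.

End LaurentSpan.

Section Tower.
Variables (k : closedFieldType) (n : nat) (lambda : seq int).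
Local Notation X := (flag k n).
Local Notation L := (line_bundle k n lambda).
Local Notation mp := (mpoly.mpoly (n * n) k).
Local Notation I := ('I_n * 'I_n)%type.
Local Notation expo := {ffun I -> int}.
Implicit Types (g : 'M[k]_n) (e : expo) (ss : seq ('I_n * seq 'I_n)) (s piv : seq 'I_n)
  (LL : seq (seq 'I_n)) (lam : nat -> int).

Definition entries ss g : I -> k := fun x => reduced ss g x.1 x.2.

(* Exponents of the Laurent monomials in the entries of the first size LL
   reduced rows, with poles allowed only along the columns listed in LL and
   degrees lam in the rows. *)
Definition Eok piv LL lam e : Prop :=
  [/\ forall r j : 'I_n, (size LL <= r)%N || (j \in take r piv) -> e (r, j) = 0,
      forall r j : 'I_n, j \notin nth [::] LL r -> 0 <= e (r, j) &
      forall r : 'I_n, \sum_j e (r, j) = lam r].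

(** A reduced row vanishes in the earlier pivot columns, so a condition there could not be met. *)
Definition valid ss : Prop := forall r, (r < size ss)%N ->
  forall j, j \in nth [::] (levels ss) r -> j \notin take r (pivots ss).

Lemma EokD piv LL lam lam' e e' : Eok piv LL lam e -> Eok piv LL lam' e' ->
  Eok piv LL (fun r => lam r + lam' r) (e + e').
Proof.
move=> [e0 e1 e2] [e0' e1' e2']; split=> r.
- by move=> j rj; rewrite ffunE e0 // e0' // addr0.
- by move=> j rj; rewrite ffunE addr_ge0 // (e1, e1').
- by rewrite -e2 -e2' -big_split; apply: eq_bigr => j _; rewrite ffunE.
Qed.

Lemma size_levels ss : size (levels ss) = size ss. Proof. exact: size_map. Qed.
Lemma size_pivots ss : size (pivots ss) = size ss. Proof. exact: size_map. Qed.

Lemma pivot_in_level ss r j : (r < size ss)%N -> nth j (pivots ss) r \in nth [::] (levels ss) r.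
Proof.
by move=> rs; rewrite /pivots /levels !(nth_map (j, [::])) // mem_head.
Qed.

Lemma valid_uniq ss : valid ss -> uniq (pivots ss).
Proof.
move=> V; case: ss V => // s0 ss V; apply/(uniqP s0.1) => q q'.
rewrite !inE size_pivots => qs qs'.
wlog qq : q q' qs qs' / (q < q')%N => [H E|E].
  by have [lt|gt|//] := ltngtP q q'; [exact: H|apply/esym; apply: H].
have := V q' qs' _ (pivot_in_level s0.1 qs'); rewrite -E.
rewrite -(nth_take s0.1 qq) mem_nth // size_take size_pivots.
by case: ifP => // _; exact: ltn_trans qq qs'.
Qed.

Section TorusPoint.
Variables (ss : seq ('I_n * seq 'I_n)) (s : seq 'I_n).
Hypotheses (ss_lt : (size ss < n)%N) (ss_valid : valid ss)
  (s_new : forall j, j \in s -> j \notin pivots ss).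

(** A reduced row vanishing in all the other columns would be zero, and the matrix of the frame
    would be singular. This shows that the cells of the next level form a cover. *)
Lemma entries_row_neq0 g : cond 0 ss (Yof g) -> g \in unitmx ->
  exists2 j, j \notin pivots ss & reduced ss g (size ss) j != 0.
Proof.
move=> C ug; apply: contrapT => nex.
have Z0 j : reduced ss g (size ss) j = 0.
  have [jp|jp] := boolP (j \in pivots ss).
    apply: (elim_pivot C (q := index j (pivots ss))); rewrite ?nth_index //.
      by rewrite -size_pivots index_mem.
    by rewrite add0n -size_pivots index_mem.
  by apply/eqP/negPn/negP => H; apply: nex; exists j.
pose Ym : 'M[k]_n := \matrix_(a, j) Yof g a j.
pose Zm : 'M[k]_n := \matrix_(a, j) reduced ss g a j.
have uY : Ym \in unitmx.
  have -> : Ym = row_perm (perm (@rev_ord_inj n)) (invmx g)^T.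
    by apply/matrixP => a j; rewrite !mxE YofE permE.
  by rewrite row_permE unitmx_mul unitmx_perm unitmx_tr unitmx_inv.
have /boolp.choice[c cE] : forall a : 'I_n, exists c : nat -> k, forall j,
    Yof g a j = 1 * reduced ss g a j + \sum_(0 <= l < a) c l * reduced ss g l j.
  by move=> a; exact: elim_tri (ltn_ord a).
have YC : Ym = (\matrix_(a, l) if (l < a)%N then c a l else (l == a)%:R) *m Zm.
  apply/matrixP => a j; rewrite !mxE cE mul1r.
  under [RHS]eq_bigr => l _ do rewrite !mxE.
  rewrite (bigID (fun l : 'I_n => (l < a)%N)) /= addrC; congr (_ + _).
    rewrite (bigD1 a) ?ltnn //= eqxx mul1r big1 ?addr0 // => l /andP[/negPf -> /negPf ->].
    by rewrite mul0r.
  rewrite big_mkord (big_ord_widen n (fun l => c a l * reduced ss g l j)) 1?ltnW //.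
  by apply: eq_bigr => l ->.
have : Zm \in unitmx by move: uY; rewrite YC unitmx_mul => /andP[].
move=> /mulmxV/matrixP/(_ (Ordinal ss_lt) (Ordinal ss_lt))/eqP.
rewrite !mxE big1 ?eqxx; first by rewrite eq_sym oner_eq0.
by move=> j _; rewrite !mxE Z0 mul0r.
Qed.

(** With the pivots completed to all columns, the matrix with the prescribed entries is already
    reduced, so elimination does nothing to it and its entries can be read off. *)
Lemma entries_onto (z : I -> k) : (forall i, z i != 0) ->
  exists2 g, [/\ g \in unitmx, cond 0 ss (Yof g) & all (fun j => reduced ss g (size ss) j != 0) s] &
    forall r j : 'I_n, (r <= size ss)%N -> j \notin take r (pivots ss) -> entries ss g (r, j) = z (r, j).
Proof.
move=> z0; pose rest := [seq j <- enum 'I_n | j \notin pivots ss].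
pose piv := pivots ss ++ rest.
have upiv : uniq piv.
  rewrite cat_uniq valid_uniq //= filter_uniq ?enum_uniq // andbT.
  by apply/hasPn => j; rewrite mem_filter => /andP[].
have spiv : size piv = n.
  have /perm_size : perm_eq piv (enum 'I_n).
    apply: uniq_perm => // [|j]; first exact: enum_uniq.
    by rewrite mem_cat mem_filter mem_enum andbT orbN.
  by rewrite size_enum_ord.
have tk r : (r <= size ss)%N -> take r piv = take r (pivots ss).
  by move=> rs; rewrite takel_cat // size_pivots.
pose A : 'M[k]_n := \matrix_(i, j) if j \in take i piv then 0 else z (i, j).
have pvn := pv_notin spiv upiv.
have [] := pivoted_frame (piv := piv) (A := A).
- by move=> q; rewrite mxE -pvn ltnn z0.
- by move=> q a qa; rewrite mxE -pvn qa.
set g := frame_of _ => ug Yg.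
have E : elim 0 (pivots ss) (Yof g) = rowf A.
    rewrite Yg elim_id // => q a; rewrite size_pivots add0n => qs qa i iq.
    rewrite /rowf; case: insubP => // b _ ba; rewrite mxE ba ifT //.
    rewrite -iq -[nth i _ q]/(nth i (pivots ss) q).
    have qa' : (q < size (take a piv))%N.
      by rewrite size_take spiv -ba ltn_ord ba.
    have -> : nth i (pivots ss) q = nth i (take a piv) q.
      by rewrite nth_take // nth_cat size_pivots qs.
    exact: mem_nth.
have rE (r j : 'I_n) : (r <= size ss)%N -> j \notin take r (pivots ss) -> entries ss g (r, j) = z (r, j).
    by move=> rs jr; rewrite /entries /reduced E rowfE mxE tk // (negPf jr).
have C : cond 0 ss (Yof g).
    apply/condP => q qs j jq; have qn := ltn_trans qs ss_lt.
    have := rE (Ordinal qn) j (ltnW qs) (ss_valid qs jq).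
    by rewrite /entries /reduced add0n => ->.
exists g; last exact: rE.
split=> //; apply/allP => j js.
have := rE (Ordinal ss_lt) j (leqnn _); rewrite take_oversize ?size_pivots // => /(_ (s_new js)).
by rewrite /entries /= => ->.
Qed.

End TorusPoint.
End Tower.

Section Singles.
Variables (k : closedFieldType) (n : nat).
Local Notation I := ('I_n * 'I_n)%type.
Local Notation expo := {ffun I -> int}.
Implicit Types (e : expo) (piv : seq 'I_n) (LL : seq (seq 'I_n)) (lam : nat -> int).

Definition single (i j : 'I_n) (c : int) : expo := [ffun x => if x == (i, j) then c else 0].

Lemma monomial_single i j c (z : I -> k) : monomial (single i j c) z = z (i, j) ^ c.
Proof.
rewrite /monomial (bigD1 (i, j)) //= ffunE eqxx big1 ?mulr1 // => x /negPf xn.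
by rewrite ffunE xn expr0z.
Qed.

Lemma Eok_ext piv LL lam lam' e : (forall r : 'I_n, lam r = lam' r) ->
  Eok piv LL lam e -> Eok piv LL lam' e.
Proof. by move=> E [e0 e1 e2]; split=> // r; rewrite -E. Qed.

Lemma Eok_single piv LL (i j : 'I_n) c : (i < size LL)%N -> j \notin take i piv ->
  j \in nth [::] LL i \/ 0 <= c -> Eok piv LL (fun r => if r == i then c else 0) (single i j c).
Proof.
move=> il jp jc; split=> r.
- move=> j'; rewrite ffunE xpair_eqE; case: eqP => // ->; case: eqP => //= ->.
  by rewrite leqNgt il (negPf jp).
- move=> j' jn; rewrite ffunE xpair_eqE; case: eqP => //= ri; case: eqP => //= jj.
  by case: jc => // jl; rewrite ri jj jl in jn.
- case: eqP => [ri|ne].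
    rewrite (bigD1 j) //= ffunE (val_inj ri) eqxx big1 ?addr0 // => j' /negPf jj.
    by rewrite ffunE xpair_eqE jj andbF.
  rewrite big1 // => j' _; rewrite ffunE xpair_eqE; case: eqP => // ri.
  by rewrite ri in ne.
Qed.

Lemma Eok0 piv LL : Eok piv LL (fun=> 0) 0.
Proof.
by split=> r *; rewrite ?ffunE // big1 // => j _; rewrite ffunE.
Qed.

Lemma monomial_scale piv LL lam e (d : nat -> k) (z z' : I -> k) : Eok piv LL lam e ->
  (forall r : 'I_n, d r != 0) ->
  (forall r j : 'I_n, (r < size LL)%N -> z' (r, j) = d r * z (r, j)) ->
  monomial e z' = \prod_(r < n) d r ^ lam r * monomial e z.
Proof.
move=> [e0 e1 e2] d0 zE; rewrite /monomial.
have E (w : I -> k) : \prod_i w i ^ e i = \prod_(r < n) \prod_(j < n) w (r, j) ^ e (r, j).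
  by rewrite pair_bigA; apply: eq_bigr => -[].
rewrite !E -big_split; apply: eq_bigr => r _ /=.
have -> : d r ^ lam r = \prod_(j < n) d r ^ e (r, j).
  rewrite -e2; elim: (index_enum _) => [|j s IH]; first by rewrite !big_nil expr0z.
  by rewrite !big_cons expfzDr // IH.
rewrite -big_split; apply: eq_bigr => j _ /=.
have [rl|lr] := ltnP r (size LL); last by rewrite e0 ?lr // !expr0z mulr1.
by rewrite zE // expfzMl.
Qed.

End Singles.

Section ChartSpan.
Variables (k : closedFieldType) (n : nat) (lambda : seq int).
Local Notation mp := (mpoly.mpoly (n * n) k).
Variable ss : seq ('I_n * seq 'I_n).
Hypotheses (size_ss : size ss = n) (ss_valid : valid ss).
Local Notation piv := (pivots ss).
Local Notation pv := (pivot_col piv).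
Local Notation O := (over (cell k ss [::])).
Local Notation LL := (rcons (levels ss) [::]).
Local Notation E := (Eok piv LL).

Lemma size_piv : size piv = n. Proof. by rewrite size_pivots. Qed.
Lemma uniq_piv : uniq piv. Proof. exact: valid_uniq. Qed.

Lemma nth_rcons_nil (T : Type) (l : seq (seq T)) r : nth [::] (rcons l [::]) r = nth [::] l r.
Proof.
rewrite nth_rcons; case: ltngtP => // h; first by rewrite nth_default // ltnW.
by rewrite h nth_default.
Qed.

Lemma over_cell_full g : O g <-> g \in unitmx /\ cond 0 ss (Yof g).
Proof.
by rewrite over_cell; [split=> [[]|[]]|right; rewrite size_ss].
Qed.

Lemma entries_level g (i j : 'I_n) : O g -> j \in nth [::] (levels ss) i -> entries ss g (i, j) != 0.
Proof.
move=> /over_cell_full[ug /condP H] jl.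
by have := H i; rewrite size_ss => /(_ (ltn_ord i) j jl).
Qed.

Lemma E_defined lam g e x : O g -> E lam e -> entries ss g x != 0 \/ 0 <= e x.
Proof.
case: x => i j Og [_ e1 _]; have := e1 i j; rewrite nth_rcons_nil.
have [jl _|_ /(_ isT)] := boolP (j \in _); last by right.
by left; exact: entries_level.
Qed.

Local Notation span lam := (lspan (entries ss) O (E lam)).

Lemma spanM (lam lam' lam'' : nat -> int) f f' : (forall r : 'I_n, lam r + lam' r = lam'' r) ->
  span lam f -> span lam' f' -> span lam'' (fun g => f g * f' g).
Proof.
move=> lE; apply: lspanM => [e e' Ee Ee'|e e' g Ee Ee' Og x].
  exact: Eok_ext lE (EokD Ee Ee').
have [|e0] := E_defined x Og Ee; first by left.
by have [|e0'] := E_defined x Og Ee'; [left|right].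
Qed.

Lemma span1 : span (fun=> 0) (fun=> 1).
Proof.
apply: lspan_ext (lspan_monomial (entries ss) O 1 (Eok0 piv LL)) => g _.
by rewrite monomial0 mulr1.
Qed.

Lemma span_entry (i j : 'I_n) c : j \notin take i piv ->
  j \in nth [::] (levels ss) i \/ 0 <= c ->
  span (fun r => if r == i then c else 0) (fun g => entries ss g (i, j) ^ c).
Proof.
move=> jp jc; have Ee : E (fun r => if r == i then c else 0) (single i j c).
  apply: Eok_single => //; last by rewrite nth_rcons_nil.
  by rewrite size_rcons size_levels size_ss leqW.
apply: lspan_ext (lspan_monomial (entries ss) O 1 Ee) => g _.
by rewrite monomial_single mul1r.
Qed.

Lemma pv_level (i : 'I_n) : pv i \in nth [::] (levels ss) i.
Proof. by apply: pivot_in_level; rewrite size_ss. Qed.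

Lemma span_coord (i j : 'I_n) (b : bool) : j \notin take i piv ->
  b ==> (j \in nth [::] (levels ss) i) ->
  span (fun=> 0) (fun g => coords piv g i j ^ (if b then -1 else 1)).
Proof.
move=> jp jb; pose c : int := if b then -1 else 1.
have c0 : j \in nth [::] (levels ss) i \/ 0 <= c by rewrite /c; case: (b) jb => /=; [left|right].
have pi0 : pv i \notin take i piv by rewrite -(pv_notin size_piv uniq_piv) ltnn.
apply: (@lspan_ext _ _ _ _ _ _ (fun g => entries ss g (i, j) ^ c * entries ss g (i, pv i) ^ (- c))) => [g Og|]; last first.
  apply: spanM (span_entry jp c0) (span_entry pi0 (or_introl (pv_level i))) => r /=.
  by case: (_ == _); rewrite ?subrr ?addr0.
have p0 := entries_level Og (pv_level i).
rewrite mxE /c /reduced (pivots_full piv) /= -/(reduced ss g).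
move: p0; rewrite /entries /=; case: (b) => p0; first by rewrite ?exprN1 ?opprK ?expr1z ?exprN1 invf_div mulrC.
by rewrite !expr1z exprN1.
Qed.

Lemma span_prod (T : eqType) (s : seq T) (F : T -> 'M[k]_n -> k) :
  (forall i, i \in s -> span (fun=> 0) (F i)) -> span (fun=> 0) (fun g => \prod_(i <- s) F i g).
Proof.
elim: s => [|i s IH] H.
  by apply: lspan_ext span1 => g _; rewrite big_nil.
apply: (@lspan_ext _ _ _ _ _ _ (fun g => F i g * \prod_(i <- s) F i g)) => [g _|].
  by rewrite big_cons.
apply: (spanM (lam := fun=> 0) (lam' := fun=> 0)); first by move=> r; exact: addr0.
  by apply: H; rewrite mem_head.
by apply: IH => i' i's; apply: H; rewrite inE i's orbT.
Qed.

Lemma span_weight : span (nth 0 lambda) (fun g => chart_weight piv lambda g).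
Proof.
suff H (s : seq 'I_n) : span (fun r => \sum_(i <- s) if r == i then lambda`_i else 0)
    (fun g => \prod_(i <- s) entries ss g (i, pv i) ^ lambda`_i).
  have := H (index_enum _); case=> l El fE; exists l => [x /El|g Og].
    apply: Eok_ext => r; rewrite (bigD1 r) //= eqxx big1 ?addr0 // => i /negPf.
    by rewrite eq_sym -val_eqE => ->.
  rewrite -fE //; apply: eq_bigr => i _.
  by rewrite /reduced (pivots_full piv).
elim: s => [|i s IH].
  apply: (@lspan_ext _ _ _ _ _ _ (fun=> 1)) => [g _|]; first by rewrite big_nil.
  by apply: lspan_sub span1 => e; apply: Eok_ext => r; rewrite big_nil.
apply: (@lspan_ext _ _ _ _ _ _ (fun g => entries ss g (i, pv i) ^ lambda`_i *
    \prod_(i <- s) entries ss g (i, pv i) ^ lambda`_i)) => [g _|]; first by rewrite big_cons.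
apply: spanM (span_entry _ _) IH; first by move=> r; rewrite big_cons.
  by rewrite -(pv_notin size_piv uniq_piv) ltnn.
by left; exact: pv_level.
Qed.

Definition chart_denom : mp := \prod_(i <- index_enum 'I_n) \prod_(j <- nth [::] (levels ss) i)
  mpoly.mpolyX k (mpoly.mnm1 (mxvec_index i j)).

Lemma chart_denomE u : mx_eval chart_denom u =
  \prod_(i <- index_enum 'I_n) \prod_(j <- nth [::] (levels ss) i) u i j.
Proof.
rewrite mx_eval_prod; apply: eq_bigr => i _; rewrite mx_eval_prod.
by apply: eq_bigr => j _; rewrite mx_eval_var.
Qed.

Lemma cell_dopen : cell k ss [::] = dopen piv chart_denom.
Proof.
apply: opens_over_eq => g; rewrite over_cell_full over_dopen ?size_piv //.
have cE : cond 0 (full piv) (Yof g) -> coords piv g = \matrix_(i, j) (entries ss g (i, j) / entries ss g (i, pv i)).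
  by move=> _; apply/matrixP => i j; rewrite !mxE /entries /reduced (pivots_full piv).
split=> [[ug C]|[ug C]].
  have Og : O g by apply/over_cell_full.
  have C' : cond 0 (full piv) (Yof g).
    apply/condP => q; rewrite (size_full size_piv) => qn j.
    have -> : levels (full piv) = [seq [:: i] | i <- piv] by rewrite /levels -map_comp.
    rewrite (nth_map j) ?size_piv // mem_seq1 (pivots_full piv) add0n => /eqP ->.
    by have := entries_level Og (pv_level (Ordinal qn)); rewrite /entries /= -(pvE size_piv _ j).
  split=> //; rewrite chart_denomE cE // prodf_seq_neq0; apply/allP => i _ /=.
  rewrite prodf_seq_neq0; apply/allP => j jl; rewrite /= mxE mulf_neq0 ?invr_eq0 //.
    exact: entries_level.
  exact: entries_level Og (pv_level i).
rewrite chart_denomE cE // prodf_seq_neq0 => /allP H; split=> //.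
apply/condP => q; rewrite size_ss => qn j jl.
have /= := H (Ordinal qn) (mem_index_enum _); rewrite prodf_seq_neq0 => /allP/(_ j jl) /=.
by rewrite mxE mulf_eq0 negb_or => /andP[].
Qed.

(** A section is the weight times a polynomial in the coordinates over a power of [chart_denom]. A
    coordinate is a quotient of two entries in one row, of degree 0, and inverses are taken only of
    entries listed in the levels; the weight carries the degrees. *)
Lemma chart_span f : is_section lambda (cell k ss [::]) f -> span (nth 0 lambda) f.
Proof.
rewrite {1}cell_dopen => /(section_fraction size_piv uniq_piv)[P [M PE]].
have fE g : O g -> f g = chart_weight piv lambda g *
    (mx_eval P (coords piv g) * (mx_eval chart_denom (coords piv g))^-1 ^+ M).
  by rewrite {1}cell_dopen => /PE ->; rewrite exprVn.
apply: (@lspan_ext _ _ _ _ _ _ _ f) => [g Og|]; first by rewrite (fE g Og).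
apply: (spanM (lam' := fun=> 0) _ span_weight); first by move=> r; exact: addr0.
apply: (spanM (lam := fun=> 0) (lam' := fun=> 0)); first by move=> r; exact: addr0.
  elim/mpoly_closed: P {PE fE} => [c|l|p q IHp IHq|p q IHp IHq].
  - apply: (@lspan_ext _ _ _ _ _ _ (fun g => c * monomial 0 (entries ss g))) => [g _|].
      by rewrite monomial0 mulr1 mx_evalC.
    by apply: lspan_monomial; exact: Eok0.
  - case/mxvec_indexP: l => i j; have [jp|jp] := boolP (j \in take i piv).
      apply: (@lspan_ext _ _ _ _ _ _ (fun=> 0)) => [g|]; last exact: lspan0.
      rewrite {1}cell_dopen => /(over_dopen size_piv)[ug C _].
      by rewrite mx_eval_var (coords_zero size_piv).
    apply: (@lspan_ext _ _ _ _ _ _ (fun g => coords piv g i j ^ 1)) => [g _|].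
      by rewrite mx_eval_var expr1z.
    exact: (span_coord (b := false) jp isT).
  - by apply: lspan_ext (lspanD IHp IHq) => g _; rewrite mx_evalD.
  - apply: (@lspan_ext _ _ _ _ _ _ (fun g => mx_eval p (coords piv g) * mx_eval q (coords piv g))) => [g _|].
      by rewrite mx_evalM.
    by apply: spanM IHp IHq => r; exact: addr0.
apply: (@lspan_ext _ _ _ _ _ _ (fun g => \prod_(m <- iota 0 M) (mx_eval chart_denom (coords piv g))^-1)) => [g _|].
  by rewrite big_const_seq count_predT size_iota iter_mulr_1.
apply: span_prod => _ _.
apply: (@lspan_ext _ _ _ _ _ _ (fun g => \prod_(i <- index_enum 'I_n)
    \prod_(j <- nth [::] (levels ss) i) coords piv g i j ^ (-1))) => [g _|].
  rewrite chart_denomE -prodfV; apply: eq_bigr => i _; rewrite -prodfV.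
  by apply: eq_bigr => j _; rewrite exprN1.
apply: span_prod => i _; apply: span_prod => j jl.
apply: (span_coord (b := true)) => //.
by apply: ss_valid => //; rewrite size_ss.
Qed.

End ChartSpan.

(** * Descent from the big cells *)

Section Tower.
Variables (k : closedFieldType) (n : nat) (lambda : seq int).
Hypotheses (lambda_ge0 : forall r, (0 < r)%N -> 0 <= lambda`_r)
  (lambda_eq0 : forall r, (1 < r)%N -> lambda`_r = 0).
Local Notation X := (flag k n).
Local Notation L := (line_bundle k n lambda).
Local Notation lam := (nth 0 lambda).
Implicit Types (ss : seq ('I_n * seq 'I_n)).

(** The two statements descend together, since the Cech complex that gives acyclicity consists of
    sections over smaller cells. The extra level [[::]] lets the next row enter polynomially: its
    entries are homogeneous coordinates on a projective space, where a bundle of nonnegative degree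
    has polynomial sections. *)
Definition tower_ok ss : Prop := acyclic L (cell k ss [::]) /\
  forall f, is_section lambda (cell k ss [::]) f ->
    lspan (entries ss) (over (cell k ss [::])) (Eok (pivots ss) (rcons (levels ss) [::]) lam) f.

Lemma tower_base ss : size ss = n -> valid ss -> tower_ok ss.
Proof.
move=> sn V; split; last by move=> f; exact: chart_span.
rewrite (cell_dopen k sn); apply: dopen_acyclic; first exact: size_piv.
exact: uniq_piv.
Qed.

Section Step.
Variable ss : seq ('I_n * seq 'I_n).
Hypotheses (ss_gt0 : (0 < size ss)%N) (ss_lt : (size ss < n)%N) (ss_valid : valid ss)
  (IH : forall ss', size ss' = (size ss).+1 -> valid ss' -> tower_ok ss').
Local Notation piv := (pivots ss).
Local Notation last_row := (Ordinal ss_lt).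

Definition new_col : finType := {j : 'I_n | j \notin piv}.
Local Notation J := new_col.
Local Notation W0 := (cell k ss [::]).
Definition new_cell (j : J) : opens X := cell k ss [:: val j].
Local Notation W := new_cell.
Local Notation vals := (map (val : J -> 'I_n)).
Local Notation sub := (fun (j : J) g => over (W j) g).
Local Notation E := (fun s : seq J => Eok piv (rcons (levels ss) (vals s)) lam).
Local Notation good := (fun (j : J) (e : {ffun 'I_n * 'I_n -> int}) => 0 <= e (last_row, val j)).
Local Notation laurent := (laurent (entries ss) (over W0) sub E).

Lemma new_insideP s g : inside (over W0) sub s g <->
  [/\ g \in unitmx, cond 0 ss (Yof g) & all (fun j => reduced ss g (size ss) j != 0) (vals s)].
Proof.
rewrite /inside over_cell; last by left.
split=> [[[ug C _] H]|[ug C /allP H]].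
  split=> //; apply/allP => _ /mapP[j /H + ->]; rewrite over_cell; last by left.
  by case=> _ _ /=; rewrite andbT.
split=> // j js; rewrite over_cell; last by left.
by split=> //=; rewrite H ?map_f.
Qed.

Lemma over_new s g : over (meets W0 W s) g <-> inside (over W0) sub s g.
Proof. exact: over_meets. Qed.

Definition next_ss (j : J) (s : seq J) := rcons ss (val j, vals s).

Lemma next_valid j s : valid (next_ss j s).
Proof.
move=> r; rewrite size_rcons ltnS /next_ss /levels /pivots !map_rcons nth_rcons !size_map.
rewrite leq_eqVlt => /predU1P[->|rs] i.
  rewrite ltnn eqxx -cats1 take_size_cat ?size_map // -/piv.
  by rewrite inE => /predU1P[->|/mapP[j' _ ->]]; [exact: (valP j)|exact: (valP j')].
by rewrite rs -cats1 takel_cat ?size_map 1?ltnW //; exact: (ss_valid rs).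
Qed.

Lemma meets_next j s : meets W0 W (j :: s) = cell k (next_ss j s) [::].
Proof.
apply: opens_over_eq => g; rewrite over_new new_insideP over_cell; last first.
  by right; rewrite size_rcons.
rewrite /next_ss -cats1 cond_cat /= andbT add0n.
split=> [[ug C H]|[ug /andP[C H] _]]; split=> //.
by rewrite C.
Qed.

Lemma entries_next j s (g : 'M[k]_n) (r c : 'I_n) : (r <= size ss)%N ->
  entries (next_ss j s) g (r, c) = entries ss g (r, c).
Proof.
move=> rs; rewrite /entries /reduced /next_ss -cats1 /pivots map_cat elim_cat.
by rewrite elim_row // add0n size_map.
Qed.

Lemma Eok_next j s e : Eok (pivots (next_ss j s)) (rcons (levels (next_ss j s)) [::]) lam e ->
  E (j :: s) e.
Proof.
rewrite /next_ss /pivots /levels !map_rcons -/piv -/(levels ss) /=.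
set l := _ :: _; move=> [e0 e1 e2]; split=> // r c; last by have := e1 r c; rewrite nth_rcons_nil.
rewrite size_rcons size_levels; case: ltnP => [rs _|rs /= cr]; last first.
  by apply: e0; rewrite -(cats1 piv) takel_cat ?size_map ?cr ?orbT.
(* In row [size ss + 1] there are no poles. As [ss] is nonempty this row has index at least 2, hence
   degree 0, and its exponents vanish. *)
have [r1|r1] := eqVneq (r : nat) (size ss).+1; last first.
  by apply: e0; rewrite !size_rcons size_levels ltn_neqAle eq_sym r1 rs.
have ge c' : 0 <= e (r, c').
  by apply: e1; rewrite nth_rcons_nil nth_default // size_rcons size_levels r1.
apply/eqP; have := e2 r; rewrite lambda_eq0; last by rewrite r1 ltnS.
by move=> /eqP; rewrite psumr_eq0 // => /allP/(_ c (mem_index_enum _)).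
Qed.

Lemma E_ins s1 j s2 e : E (s1 ++ s2) e -> E (s1 ++ j :: s2) e.
Proof.
move=> [e0 e1 e2]; split=> // r c; first by have := e0 r c; rewrite !size_rcons.
move=> H; apply: e1; apply: contra H; rewrite !nth_rcons; case: ifP => // _.
case: ifP => // _; rewrite !map_cat /= !mem_cat inE => /orP[->//|->].
by rewrite !orbT.
Qed.

(** If the exponents in all new columns were negative, so would be the degree of the row. This is
    where the sign of [lambda] enters. *)
Lemma E_good s e : E s e -> exists j, good j e.
Proof.
move=> [e0 e1 e2]; apply: contrapT => nex.
have lt j : j \notin piv -> e (last_row, j) < 0.
  move=> jn; rewrite ltNge; apply/negP => ge; apply: nex.
  by exists (Sub j jn).
have : 0 <= \sum_j e (last_row, j) by rewrite e2 lambda_ge0.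
have [j0 j0n] : exists j, j \notin piv.
  apply: contrapT => H; have : (n <= size piv)%N.
    rewrite -[X in (X <= _)%N](size_enum_ord n) uniq_leq_size ?enum_uniq // => j _.
    by apply/negPn/negP => jn; apply: H; exists j.
  by rewrite size_pivots leqNgt ss_lt.
apply/negP; rewrite -ltNge (bigD1 j0) //= ltr_wnDr ?lt // sumr_le0 // => j _.
have [jp|/lt/ltW//] := boolP (j \in piv); rewrite e0 //= take_oversize ?jp ?orbT //.
by rewrite size_pivots.
Qed.

Lemma E_del j s e : good j e -> E (j :: s) e -> E s e.
Proof.
move=> gj [e0 e1 e2]; split=> // r c; first by have := e0 r c; rewrite !size_rcons.
have [->|cj] := eqVneq c (val j); last first.
  move=> H; apply: e1; apply: contra H; rewrite !nth_rcons; case: ifP => // _.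
  by case: ifP => // _; rewrite inE (negPf cj).
have [rl _|rl] := eqVneq r last_row; first by rewrite rl.
have rl' : (r == size ss :> nat) = false by apply/eqP => E; case/eqP: rl; apply: val_inj.
by have := e1 r (val j); rewrite !nth_rcons !size_levels rl'.
Qed.

Lemma E_torus s : s <> [::] -> forall z : 'I_n * 'I_n -> k, (forall i, z i != 0) ->
  exists2 g, inside (over W0) sub s g & forall e, E s e -> monomial e (entries ss g) = monomial e z.
Proof.
move=> _ z z0; have [|g G gE] := @entries_onto k n ss (vals s) ss_lt ss_valid _ z z0.
  by move=> _ /mapP[j _ ->]; exact: (valP j).
exists g; first exact/new_insideP.
move=> e [e0 _ _]; apply: eq_bigr => -[r j] _.
have [H|] := boolP ((size (rcons (levels ss) (vals s)) <= r)%N || (j \in take r piv)).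
  by rewrite e0 // !expr0z.
by rewrite size_rcons size_levels negb_or -ltnNge ltnS => /andP[rs jr]; rewrite gE.
Qed.

Let exact := laurent_exact E_ins E_good E_del E_torus.

Lemma section_laurent s f : s <> [::] -> is_section lambda (meets W0 W s) f -> laurent s f.
Proof.
case: s => // j s _; rewrite meets_next => sf.
have [_ /(_ f sf)[l El fE]] := IH (size_rcons _ _) (@next_valid j s).
have [_ _ zf] := sf; split; last first.
  by move=> g ng; apply: zf; rewrite -meets_next over_new.
exists l => [x /El|g /over_new]; first exact: Eok_next.
rewrite meets_next => /fE ->; rewrite /lsum !big_seq; apply: eq_bigr => x /El /Eok_next[e0 _ _].
congr (_ * _); apply: eq_bigr => -[r c] _.
have [rs|rs] := leqP r (size ss); first by rewrite entries_next.
by rewrite e0 ?expr0z // size_rcons size_levels rs.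
Qed.

Lemma laurent_section s f : laurent s f -> is_section lambda (meets W0 W s) f.
Proof.
move=> [[l El fE] f0]; apply: section_of => [g g' d|g|g]; last by rewrite over_new; exact: f0.
  move=> og og' d0 T; have /new_insideP[ug C _] := (over_new s g).1 og.
  rewrite !fE -?over_new // /lsum mulr_sumr [LHS]big_seq [RHS]big_seq; apply: eq_bigr => x xl.
  rewrite mulrCA; congr (_ * _).
  apply: (monomial_scale (d := d) (z := entries ss g) (El x xl)) => [r|r j]; first exact: d0.
  rewrite size_rcons size_levels ltnS => rs.
  have [_ T'] := cond_tri (r := 0) (ltnW ss_lt) d0 T C.
  exact: tri_row T' _ _.
move=> og; have /new_insideP[ug C /allP Hs] := (over_new s g).1 og.
apply: (@rational_ext _ _ _ _ (fun x => lsum l (entries ss x))).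
  by move=> x /over_new ix; rewrite fE.
apply: (rational_sub (O := fun x => x \in unitmx)); first by move=> x /over_unit.
rewrite /lsum; under [X in rational_at _ _ X]eq_fun do rewrite big_seq.
apply: rational_sum => x /El[e0 e1 _].
apply: rationalM; first exact: rational_cst.
apply: rational_prod => -[r j] _; apply: rational_exprz => //; last exact: rational_reduced.
have [//|] := boolP (0 <= _) => lt /=; rewrite /entries /=.
have jl : j \in nth [::] (rcons (levels ss) (vals s)) r.
  by apply: contraNT lt; exact: e1.
move: jl; rewrite nth_rcons size_levels; case: ltnP => [rs jl|_].
  by have /condP/(_ r rs j jl) := C; rewrite add0n.
by case: eqP => // -> /Hs.
Qed.

Lemma tower_cover x : oset W0 x -> exists j, oset (W j) x.
Proof.
move=> /oset_over[g Vg og]; have /new_insideP[ug C _] : inside (over W0) sub [::] g by split.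
have [j jn j0] := entries_row_neq0 ss_lt C ug.
exists (Sub j jn); apply/oset_over; exists g => //; rewrite over_cell; last by left.
by rewrite /= j0.
Qed.

Lemma tower_step : tower_ok ss.
Proof.
split.
  apply: (leray_acyclic tower_cover).
    move=> [//|j s] _; rewrite meets_next.
    by have [] := IH (size_rcons _ _) (@next_valid j s).
  apply: section_cech_vanish => m c cP c0.
  have [s ss'|//|b [bP cE]] := @exact m.+2 c.
    by apply: section_laurent (cP s ss') => s0; rewrite s0 in ss'.
  exists b; split=> // u su; apply: laurent_section; apply: bP; by rewrite su.
(* The restrictions of [f] form a cocycle of Laurent polynomials; exactness for [m = 1] glues them
   to a single one over the whole cell. *)
move=> f sf; pose c (s : seq J) : 'M[k]_n -> k^o := if s is [:: j] then frame_face W j f else 0.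
have [s s1|s s2|b [bP cE]] := @exact 1 c.
- apply: section_laurent; first by move=> s0; rewrite s0 in s1.
  case: s s1 => // j [|//] _.
  exact: (@frame_face_section k n lambda J W0 W [::] j [::] f sf).
- case: s s2 => [//|i [//|j [|//]]] _ /=.
  by rewrite subr0 [X in X - _]fcutC subrr.
have [[l El bE] b0] := bP [::] erefl.
exists l => // g og; have [V Vx Vg] := og.
have [j /oset_over[g' Vg' og']] := tower_cover Vx.
have oj : over (W j) g by have [V' V'x V'g'] := og'; exists V' => //; rewrite (adapted_inj Vg' V'g') in Vg *.
have := congr1 (fun h : 'M[k]_n -> k^o => h g) (cE [:: j] erefl).
rewrite /c /= subr0 /= /fcut asboolT // => ->.
by rewrite bE //; split.
Qed.

End Step.

(** The descent stops with one row remaining: below it the freed row would be the first one, whose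
    degree is not assumed nonnegative. *)
Lemma tower ss : (0 < size ss <= n)%N -> valid ss -> tower_ok ss.
Proof.
have [m] := ubnP (n - size ss)%N; elim: m ss => // m IH ss mn /andP[s0 sn] V.
have [E|ne] := eqVneq (size ss) n; first exact: tower_base.
have lt : (size ss < n)%N by rewrite ltn_neqAle ne.
apply: (tower_step s0 lt V) => ss' s' V'; apply: IH => //; rewrite s'; lia.
Qed.

End Tower.

(** * Hasse derivatives in characteristic p *)

Section Lucas.
Variables (R : comNzRingType) (p : nat).
Hypothesis hp : p \in [pchar R].

Let p_prime : prime p. Proof. exact: pcharf_prime hp. Qed.

Lemma binomial_expand m : (('X : {poly R}) + 1) ^+ m = \poly_(i < m.+1) ('C(m, i))%:R.
Proof.
rewrite addrC exprDn poly_def; apply: eq_bigr => i _.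
by rewrite expr1n mul1r scaler_nat.
Qed.

Lemma coef_binomial m i : ((('X : {poly R}) + 1) ^+ m)`_i = ('C(m, i))%:R.
Proof.
rewrite binomial_expand coef_poly; case: ltnP => // mi.
by rewrite bin_small.
Qed.

(** Lucas's congruence, read off the coefficients of [('X^q + 1)^v ('X + 1)^u] with [q = p ^ l]. *)
Lemma lucas l u v a i : (u < p ^ l)%N -> (i < p ^ l)%N ->
  ('C(p ^ l * v + u, p ^ l * a + i))%:R = ('C(v, a))%:R * ('C(u, i))%:R :> R.
Proof.
set q := (p ^ l)%N => uq iq; have q0 : (0 < q)%N by rewrite expn_gt0 prime_gt0.
have chP : p \in [pchar {poly R}] by apply: (rmorph_pchar (@polyC R)).
rewrite -coef_binomial exprD exprM exprDn_pchar; last first.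
  by rewrite (eq_pnat _ (pcharf_eq chP)) pnatX pnat_id.
rewrite expr1n (addrC ('X^q : {poly R})) exprDn.
under eq_bigr => j _ do rewrite expr1n mul1r.
rewrite mulr_suml coef_sum.
have cE (j : 'I_v.+1) : ('X^q ^+ j *+ 'C(v, j) * ('X + 1) ^+ u : {poly R})`_(q * a + i) =
   if j == a :> nat then ('C(v, a))%:R * ('C(u, i))%:R else 0.
  rewrite mulrnAl coefMn -exprM coefXnM.
  case: (ltngtP j a) => [ja|aj|->].
  - rewrite ltnNge (leq_trans (leq_mul (leqnn q) (ltnW ja))) ?leq_addr //=.
    rewrite coef_binomial bin_small ?mul0rn //.
    rewrite (leq_trans uq) // -(leq_add2l (q * j)) subnKC; last first.
      by rewrite (leq_trans (leq_mul (leqnn q) (ltnW ja))) ?leq_addr.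
    by rewrite (leq_trans _ (leq_addr _ _)) // -mulnSr leq_mul.
  - rewrite (leq_trans _ (leq_mul (leqnn q) aj)) ?mul0rn //.
    by rewrite mulnSr ltn_add2l.
  - by rewrite ltnNge leq_addr /= addKn coef_binomial mulr_natl.
under eq_bigr => j _ do rewrite cE.
have [av|va] := ltnP a v.+1.
  by rewrite (bigD1 (Ordinal av)) //= eqxx big1 ?addr0 // => j; rewrite -val_eqE => /negPf /= ->.
rewrite bin_small // mul0r big1 // => j _; case: eqP => // ja.
Qed.

End Lucas.

Section Digits.
Variable p : nat.
Hypothesis p_gt1 : (1 < p)%N.

Definition digit l m := ((m %/ p ^ l) %% p)%N.

Let q_gt0 l : (0 < p ^ l)%N. Proof. by rewrite expn_gt0 ltnW. Qed.

Lemma digit_lt l m : (digit l m < p)%N. Proof. by rewrite ltn_mod ltnW. Qed.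

Lemma digit_add l l' e m : (digit l m + e < p)%N ->
  digit l' (m + e * p ^ l) = (digit l' m + e * (l' == l))%N.
Proof.
rewrite /digit => H.
have [lt|gt|->] := ltngtP l' l; rewrite ?muln0 ?muln1 ?addn0.
- rewrite -[in RHS](modnMDl (e * p ^ (l - l'.+1))) -divnMDl //; congr (_ %/ _ %% _)%N.
  by rewrite addnC -mulnA -expnS -mulnA -expnD subnK.
- have E x : (x %/ p ^ l' = x %/ p ^ l %/ p %/ p ^ (l' - l.+1))%N.
    by rewrite -!divnMA -expnS -expnD addnS -addSn subnKC.
  have E2 x : (x %% p + e < p -> (x + e) %/ p = x %/ p)%N.
    move=> xe; rewrite {1}(divn_eq x p) -addnA.
    rewrite divnMDl; last exact: ltnW p_gt1.
    by rewrite (divn_small xe) addn0.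
  by rewrite !E addnC divnMDl // addnC E2.
- by rewrite addnC divnMDl // -modnDmr modn_small addnC.
Qed.

Lemma digit_le l m e : (e <= digit l m)%N -> (e * p ^ l <= m)%N.
Proof.
move=> H; apply: leq_trans (leq_trunc_div m (p ^ l)); rewrite leq_mul //.
exact: leq_trans H (leq_mod _ _).
Qed.

Lemma digit_sub l l' e m : (e <= digit l m)%N ->
  digit l' (m - e * p ^ l) = (digit l' m - e * (l' == l))%N.
Proof.
move=> H; have em := digit_le H.
have D : digit l (m - e * p ^ l) = (digit l m - e)%N.
  rewrite /digit divnBMl {1}(divn_eq (m %/ p ^ l) p) -addnBA // modnMDl modn_small //.
  by rewrite (leq_ltn_trans (leq_subr _ _)) // digit_lt.
rewrite -{2}(subnK em) digit_add ?addnK // D subnK //; exact: digit_lt.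
Qed.

Lemma digit_exists M m : (0 < m < p ^ M)%N -> exists2 l, (l < M)%N & (0 < digit l m)%N.
Proof.
move=> /andP[m0 mM]; have /andP[lm ml] := trunc_log_bounds p_gt1 m0.
exists (trunc_log p m); first by rewrite -(ltn_exp2l _ _ p_gt1) (leq_ltn_trans lm).
by rewrite /digit modn_small ?divn_gt0 // ltn_divLR // -expnS.
Qed.

End Digits.

Section DividedPowers.
Variables (k : closedFieldType) (p : nat).
Hypothesis hp : p \in [pchar k].
Implicit Types (P Q : {poly k}) (l e m : nat).

Let p_prime : prime p. Proof. exact: pcharf_prime hp. Qed.
Let p_gt1 : (1 < p)%N. Proof. exact: prime_gt1. Qed.
Local Notation digit := (digit p).

Lemma binomial_digit l e m : (e < p)%N -> ('C(m, e * p ^ l))%:R = ('C(digit l m, e))%:R :> k.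
Proof.
move=> ep; have q0 : (0 < p ^ l)%N by rewrite expn_gt0 ltnW.
rewrite {1}(divn_eq m (p ^ l)) mulnC -[(e * _)%N]addn0 (mulnC e) (lucas hp) ?ltn_mod // bin0 mulr1.
have := @lucas k p hp 1 (digit l m) (m %/ p ^ l %/ p) 0 e.
rewrite expn1 muln0 add0n bin0 mul1r (mulnC p) /digit -divn_eq; apply=> //.
by rewrite ltn_mod ltnW.
Qed.

Lemma binomial_neq0 g e : (e <= g < p)%N -> ('C(g, e))%:R != 0 :> k.
Proof.
move=> /andP[eg gp]; rewrite -(dvdn_pcharf hp); apply/negP => pd.
have : (p %| g`!)%N by rewrite -(bin_fact eg) dvdn_mulr.
apply/negP; elim: g {eg pd} gp => [|g IH] gp; first by rewrite dvdn1 neq_ltn p_gt1 orbT.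
by rewrite factS Euclid_dvdM // negb_or gtnNdvd //= IH // ltnW.
Qed.

Definition lower l e P : {poly k} := P^`N(e * p ^ l).

(** A partial inverse of [lower], which subtracts [e] from the [l]-th digit of an exponent up to a
    binomial factor. [raise] adds [e] to that digit when there is room for it and kills the monomial
    otherwise. *)
Definition raise l e P : {poly k} := \poly_(m < size P + e * p ^ l)
  if (e <= digit l m)%N then P`_(m - e * p ^ l) / ('C(digit l m, e))%:R else 0.

Lemma coef_lower l e P m : (e < p)%N -> (lower l e P)`_m =
  if (digit l m + e < p)%N then P`_(m + e * p ^ l) * ('C(digit l m + e, e))%:R else 0.
Proof.
move=> ep; rewrite coef_nderivn addnC -[LHS]mulr_natr binomial_digit //.
case: ltnP => H; first by rewrite digit_add // eqxx muln1.
rewrite bin_small ?mulr0 //.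
have gp := digit_lt p_gt1 l m.
have E : digit l (m + e * p ^ l) = (digit l m + e - p)%N.
  rewrite /digit addnC divnMDl ?expn_gt0 ?(ltnW p_gt1) // addnC -modnDml -/(digit l m).
  by rewrite -{1}(subnK H) modnDr modn_small //; move: gp H ep; lia.
by rewrite E; move: gp H ep; lia.
Qed.

Lemma coef_raise l e P m : (raise l e P)`_m =
  if (e <= digit l m)%N then P`_(m - e * p ^ l) / ('C(digit l m, e))%:R else 0.
Proof.
rewrite coef_poly; case: ltnP => // H; case: ifP => // _.
by rewrite nth_default ?mul0r // leq_subRL ?(leq_trans _ H) ?leq_addl // addnC.
Qed.

Lemma raise0 l e : raise l e 0 = 0.
Proof. by apply/polyP => m; rewrite coef_raise !coef0 mul0r; case: ifP. Qed.

Lemma lower_lin l e (a : k) P Q : lower l e (a *: P + Q) = a *: lower l e P + lower l e Q.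
Proof.
apply/polyP => m; rewrite /lower coefD coefZ !coef_nderivn coefD coefZ.
by rewrite mulrnDl mulrnAr.
Qed.

Lemma lower0 l e : lower l e 0 = 0.
Proof. by apply/polyP => m; rewrite coef_nderivn !coef0 mul0rn. Qed.

Lemma lowerZ l e (a : k) P : lower l e (a *: P) = a *: lower l e P.
Proof. by rewrite -[a *: P]addr0 lower_lin lower0 addr0. Qed.

Lemma raise_lin l e (a : k) (P Q : {poly k}) : raise l e (a *: P + Q) = a *: raise l e P + raise l e Q.
Proof.
apply/polyP => m; rewrite coefD coefZ !coef_raise; case: ifP => _; last by rewrite mulr0 addr0.
by rewrite !coefE mulrDl mulrA.
Qed.

Lemma raiseZ l e (a : k) (P : {poly k}) : raise l e (a *: P) = a *: raise l e P.
Proof. by rewrite -[a *: P]addr0 raise_lin raise0 addr0. Qed.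

Lemma lower_raise l e P m : (e < p)%N ->
  (lower l e (raise l e P))`_m = if (digit l m + e < p)%N then P`_m else 0.
Proof.
move=> ep; rewrite coef_lower // coef_raise; case: ltnP => // H.
rewrite digit_add // eqxx muln1 leq_addl addnK divfK // binomial_neq0 // leq_addl.
by [].
Qed.

Lemma raise_lower l e P m : (e < p)%N ->
  (raise l e (lower l e P))`_m = if (e <= digit l m)%N then P`_m else 0.
Proof.
move=> ep; rewrite coef_raise; case: leqP => // H; rewrite coef_lower //.
rewrite digit_sub // eqxx muln1 subnK // digit_lt //= subnK; last exact: digit_le.
by rewrite mulfK // binomial_neq0 // H digit_lt.
Qed.

(** The two shifts together would subtract [p] from a single digit. *)
Lemma lower_lower l e P : (0 < e < p)%N -> lower l e (lower l (p - e) P) = 0.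
Proof.
move=> /andP[e0 ep]; have pe : (p - e < p)%N by rewrite ltn_subrL e0 (ltnW p_gt1).
apply/polyP => m; rewrite coef0 !coef_lower //.
case: ltnP => // H; rewrite digit_add // eqxx muln1 -addnA subnKC ?(ltnW ep) //.
by rewrite ltnNge leq_addl mul0r.
Qed.

Lemma lower_lowerC l l' e e' P : l != l' -> (e < p)%N -> (e' < p)%N ->
  lower l e (lower l' e' P) = lower l' e' (lower l e P).
Proof.
move=> ll ep ep'; apply/polyP => m; rewrite !coef_lower //.
have [H|H] := ltnP (digit l m + e) p; have [H'|H'] := ltnP (digit l' m + e') p => //.
- rewrite !digit_add // (eq_sym l') (negPf ll) !muln0 !addn0 H H'.
  by rewrite -!addnA (addnC (e * _)%N) mulrAC.
- by rewrite digit_add // (eq_sym l') (negPf ll) !muln0 !addn0 ltnNge H' mul0r.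
- by rewrite digit_add // (negPf ll) !muln0 !addn0 ltnNge H mul0r.
Qed.

Lemma lower_raiseC l l' e e' P : l != l' -> (e < p)%N ->
  lower l e (raise l' e' P) = raise l' e' (lower l e P).
Proof.
move=> ll ep; apply/polyP => m; rewrite coef_lower // !coef_raise coef_lower //.
have [H|H] := ltnP (digit l m + e) p; have [H'|H'] := leqP e' (digit l' m).
- rewrite digit_add // digit_sub // (eq_sym l') (negPf ll) !muln0 addn0 subn0 H' H.
  rewrite addnBAC ?digit_le // mulrAC.
  by [].
- by rewrite digit_add // (eq_sym l') (negPf ll) !muln0 addn0 leqNgt H' mul0r.
- by rewrite digit_sub // (negPf ll) muln0 subn0 ltnNge H mul0r.
- by [].
Qed.

(** Every exponent between 0 and [p ^ M], exclusive, has a nonzero digit in some place [l < M], and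
    [lower l 1] does not lose that monomial. *)
Lemma lower_kernel M P : (size P <= p ^ M)%N -> (forall l, (l < M)%N -> lower l 1 P = 0) ->
  P = (P`_0)%:P.
Proof.
move=> sP H; apply/polyP => m; rewrite coefC; case: eqP => [->//|/eqP m0].
have [mM|Mm] := ltnP m (p ^ M); last by rewrite nth_default // (leq_trans sP).
have [|l lM lm] := digit_exists p_gt1 (M := M) (m := m); first by rewrite lt0n m0.
have := congr1 (fun Q : {poly k} => Q`_(m - 1 * p ^ l)) (H l lM).
rewrite coef0 coef_lower // digit_sub // eqxx muln1 subnK // digit_lt // subnK; last exact: digit_le.
by move=> /eqP; rewrite mulf_eq0 (negPf (binomial_neq0 _)) ?orbF => [/eqP//|]; rewrite lm digit_lt.
Qed.

Lemma horner_inj P Q : (forall c, P.[c] = Q.[c]) -> P = Q.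
Proof.
move=> H; apply/eqP; rewrite -subr_eq0; apply/negPn/negP => n0.
(* At a root of this polynomial [P - Q] cannot vanish. *)
have /closed_rootP[c] : size ((P - Q) * 'X + 1%:P) != 1%N.
  by rewrite size_MXaddC (negPf n0) /= eqSS size_poly_eq0.
by rewrite /root !hornerE H subrr mul0r add0r oner_eq0.
Qed.

End DividedPowers.

(** * Taylor expansion along the shifts of y by multiples of x *)

Section Shift.
Variables (k : closedFieldType) (n : nat).
Local Notation D := (('I_n -> k) * ('I_n -> k))%type.
Implicit Types (F G : D -> k) (t : D) (P : {poly k}).

Definition shift (c : k) t : D := (t.1, fun j => t.2 j + c * t.1 j).

Lemma shift_shift c c' t : shift c (shift c' t) = shift (c + c') t.
Proof. by congr pair; apply/funext => j /=; rewrite mulrDl (addrC (c * _)) addrA. Qed.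

Lemma shift0 t : shift 0 t = t.
Proof.
case: t => x y; congr pair; apply/funext => j /=.
by rewrite mul0r addr0.
Qed.

Definition expands F t P : Prop := forall c, F (shift c t) = P.[c].

Definition taylor F t : {poly k} :=
  if pselect (exists P, expands F t P) is left h then sval (cid h) else 0.

Definition polynomial F : Prop := forall t, exists P, expands F t P.

Definition hasse r F t : k := (taylor F t)`_r.

Lemma taylorP F t : polynomial F -> expands F t (taylor F t).
Proof. by move=> /(_ t) pF; rewrite /taylor; case: pselect => // h; case: cid. Qed.

Lemma taylorE F t P : expands F t P -> taylor F t = P.
Proof.
move=> E; rewrite /taylor; case: pselect => [h|[]]; last by exists P.
by case: cid => Q QE /=; apply: horner_inj => c; rewrite -QE -E.
Qed.

Lemma taylor_shift F t c r : polynomial F ->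
  (taylor F (shift c t))`_r = ((taylor F t)^`N(r)).[c].
Proof.
move=> pF; set P := taylor F t.
rewrite (@taylorE F (shift c t) (\poly_(i < size P) (P^`N(i)).[c])); last first.
  move=> x; rewrite shift_shift (taylorP t pF) -/P addrC nderiv_taylor; last exact: mulrC.
  by rewrite horner_poly; apply: eq_bigr => i _; rewrite mulrC.
rewrite coef_poly; case: ltnP => // sP; rewrite (_ : P^`N(r) = 0) ?horner0 //.
by apply/polyP => i; rewrite coef_nderivn nth_default ?mul0rn ?coef0 // (leq_trans sP) ?leq_addr.
Qed.

Lemma expands_hasse F t r : polynomial F -> expands (hasse r F) t ((taylor F t)^`N(r)).
Proof. by move=> pF c; exact: taylor_shift. Qed.

Lemma hasse_polynomial F r : polynomial F -> polynomial (hasse r F).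
Proof. by move=> pF t; eexists; exact: expands_hasse. Qed.

Lemma taylor_hasse F t r : polynomial F -> taylor (hasse r F) t = (taylor F t)^`N(r).
Proof. by move=> pF; apply: taylorE; exact: expands_hasse. Qed.

Lemma taylor_lin (a : k) F G t : polynomial F -> polynomial G ->
  taylor (fun u => a * F u + G u) t = a *: taylor F t + taylor G t.
Proof.
by move=> pF pG; apply: taylorE => c; rewrite !hornerE (taylorP t pF) (taylorP t pG).
Qed.

Lemma polynomial_lin (a : k) F G : polynomial F -> polynomial G ->
  polynomial (fun u => a * F u + G u).
Proof.
move=> pF pG t; exists (a *: taylor F t + taylor G t) => c.
by rewrite !hornerE (taylorP t pF) (taylorP t pG).
Qed.

Lemma polynomial0 : polynomial (fun=> 0).
Proof. by move=> t; exists 0 => c; rewrite horner0. Qed.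

Lemma taylor0 t : taylor (fun=> 0) t = 0.
Proof. by apply: taylorE => c; rewrite horner0. Qed.

(** Where [x_i] is nonzero, [tau i] is a coordinate on the orbits of [shift], and [bar i t] is the
    point of the orbit with [y_i = 0]. A function is thus a polynomial in [tau i] with invariant
    coefficients. *)
Definition tau (i : 'I_n) t : k := t.2 i / t.1 i.
Definition bar (i : 'I_n) t : D := shift (- tau i t) t.

Lemma tau_shift i c t : t.1 i != 0 -> tau i (shift c t) = tau i t + c.
Proof. by move=> ti; rewrite /tau /= mulrDl mulfK. Qed.

Lemma bar_shift i c t : t.1 i != 0 -> bar i (shift c t) = bar i t.
Proof. by move=> ti; rewrite /bar tau_shift // shift_shift; congr shift; ring. Qed.

Lemma tau_bar i t : t.1 i != 0 -> tau i (bar i t) = 0.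
Proof. by move=> ti; rewrite /bar tau_shift // subrr. Qed.

Lemma bar_bar i t : t.1 i != 0 -> bar i (bar i t) = bar i t.
Proof. by move=> ti; rewrite {2}/bar bar_shift. Qed.

Lemma shift_bar i t : shift (tau i t) (bar i t) = t.
Proof. by rewrite /bar shift_shift subrr shift0. Qed.

Lemma taylor_bar F i t : polynomial F -> F t = (taylor F (bar i t)).[tau i t].
Proof. by move=> pF; rewrite -(taylorP (bar i t) pF) shift_bar. Qed.

End Shift.

Section LaurentClosure.
Variables (k : closedFieldType) (n : nat).
Local Notation D := (('I_n -> k) * ('I_n -> k))%type.
Local Notation I := ('I_n + 'I_n)%type.
Local Notation expo := {ffun I -> int}.
Implicit Types (F G : D -> k) (t : D) (P : D -> {poly k}) (s : seq 'I_n) (a b c : int) (e : expo).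

Definition xy t : I -> k := fun v => match v with inl j => t.1 j | inr j => t.2 j end.

Definition nonzero (j : 'I_n) t : Prop := t.1 j != 0.
Local Notation inside := (inside (fun=> True) nonzero).

Definition bideg s a b e : Prop :=
  [/\ forall j, j \notin s -> 0 <= e (inl j), forall j, 0 <= e (inr j),
      \sum_j e (inl j) = a & \sum_j e (inr j) = b].

Definition lau s a b F : Prop := lspan xy (inside s) (bideg s a b) F.

Lemma bidegD s a b a' b' e e' : bideg s a b e -> bideg s a' b' e' ->
  bideg s (a + a') (b + b') (e + e').
Proof.
move=> [e0 e1 e2 e3] [e0' e1' e2' e3']; split.
- by move=> j js; rewrite ffunE addr_ge0 ?(e0, e0').
- by move=> j; rewrite ffunE addr_ge0.
- by rewrite -e2 -e2' -big_split; apply: eq_bigr => j _; rewrite ffunE.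
- by rewrite -e3 -e3' -big_split; apply: eq_bigr => j _; rewrite ffunE.
Qed.

Lemma lauM s a b a' b' F G : lau s a b F -> lau s a' b' G ->
  lau s (a + a') (b + b') (fun t => F t * G t).
Proof.
apply: lspanM => [e e'|e e' t [e0 e1 _ _] [e0' e1' _ _] it [j|j]]; first exact: bidegD.
  have [js|js] := boolP (j \in s); first by left; have [_ H] := it; exact: H.
  by right; rewrite e0 // e0'.
by right.
Qed.

Lemma bideg0 s : bideg s 0 0 0.
Proof. by split=> [j _|j||]; rewrite ?big1 // => *; rewrite ffunE. Qed.

Lemma lau_cst s (c : k) : lau s 0 0 (fun=> c).
Proof.
apply: lspan_ext (lspan_monomial xy (inside s) c (bideg0 s)) => t _.
by rewrite monomial0 mulr1.
Qed.

Lemma lauZ s a b (c : k) F : lau s a b F -> lau s a b (fun t => c * F t).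
Proof. by move=> lF; have := lauM (lau_cst s c) lF; rewrite !add0r. Qed.

Lemma lauD s a b F G : lau s a b F -> lau s a b G -> lau s a b (fun t => F t + G t).
Proof. exact: lspanD. Qed.

Lemma lau0 s a b : lau s a b (fun=> 0).
Proof. exact: lspan0. Qed.

Lemma lau_sum (T : Type) (r : seq T) (Q : pred T) s a b (F : T -> D -> k) :
  (forall i, Q i -> lau s a b (F i)) -> lau s a b (fun t => \sum_(i <- r | Q i) F i t).
Proof.
move=> H; elim: r => [|i r IH].
  by apply: lspan_ext (lau0 s a b) => t _; rewrite big_nil.
case Qi : (Q i).
  by apply: lspan_ext (lauD (H i Qi) IH) => t _; rewrite big_cons Qi.
by apply: lspan_ext IH => t _; rewrite big_cons Qi.
Qed.

Lemma lau_ext s a b F G : (forall t, inside s t -> F t = G t) -> lau s a b F -> lau s a b G.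
Proof. exact: lspan_ext. Qed.

Lemma lau_x s j c : j \in s \/ 0 <= c -> lau s c 0 (fun t => t.1 j ^ c).
Proof.
move=> jc; pose e : expo := [ffun v => if v == inl j then c else 0].
have be : bideg s c 0 e.
  split.
  - move=> j' js; rewrite ffunE (inj_eq (@inl_inj _ _)); case: eqP => // E.
    by case: jc => //; rewrite -E (negPf js).
  - by move=> j'; rewrite ffunE.
  - rewrite (bigD1 j) //= ffunE eqxx big1 ?addr0 // => j' /negPf jj.
    by rewrite ffunE (inj_eq (@inl_inj _ _)) jj.
  - by rewrite big1 // => j' _; rewrite ffunE.
apply: lau_ext (lspan_monomial xy (inside s) 1 be) => t _.
rewrite mul1r /monomial (bigD1 (inl j)) //= ffunE eqxx big1 ?mulr1 // => v /negPf vn.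
by rewrite ffunE vn expr0z.
Qed.

Lemma lau_y s j : lau s 0 1 (fun t => t.2 j).
Proof.
pose e : expo := [ffun v => if v == inr j then 1 else 0].
have be : bideg s 0 1 e.
  split.
  - by move=> j' js; rewrite ffunE.
  - by move=> j'; rewrite ffunE; case: eqP.
  - by rewrite big1 // => j' _; rewrite ffunE.
  - rewrite (bigD1 j) //= ffunE eqxx big1 ?addr0 // => j' /negPf jj.
    by rewrite ffunE (inj_eq (@inr_inj _ _)) jj.
apply: lau_ext (lspan_monomial xy (inside s) 1 be) => t _.
rewrite mul1r /monomial (bigD1 (inr j)) //= ffunE eqxx big1 ?mulr1 ?expr1z // => v /negPf vn.
by rewrite ffunE vn expr0z.
Qed.

Lemma lau_neg s a b F t : b < 0 -> lau s a b F -> inside s t -> F t = 0.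
Proof.
move=> b0 [l El FE] it; rewrite FE // /lsum big_seq big1 // => x /El[_ e1 _ eb].
by move: b0; rewrite -eb ltNge sumr_ge0.
Qed.

(** The parameter [c] of the shift has bidegree (-1, 1), which makes [y + c x] homogeneous. *)
Definition plau s a b P : Prop := forall m : nat, lau s (a + m%:Z) (b - m%:Z) (fun t => (P t)`_m).

Lemma plauM s a b a' b' P Q : plau s a b P -> plau s a' b' Q ->
  plau s (a + a') (b + b') (fun t => P t * Q t).
Proof.
move=> lP lQ m; apply: lau_ext => [t _|]; first by rewrite coefM.
apply: lau_sum => i _; have := lauM (lP i) (lQ (m - i)%N).
have im : (i <= m)%N by rewrite -ltnS.
have -> : a + i%:Z + (a' + (m - i)%N%:Z) = a + a' + m%:Z by rewrite -subzn //; ring.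
by have -> : b - i%:Z + (b' - (m - i)%N%:Z) = b + b' - m%:Z by rewrite -subzn //; ring.
Qed.

Lemma plau_cst s a F : lau s a 0 F -> plau s a 0 (fun t => (F t)%:P).
Proof.
move=> lF [|m]; first by rewrite addr0 subr0; apply: lau_ext lF => t _; rewrite coefC.
by apply: lau_ext (lau0 _ _ _) => t _; rewrite coefC.
Qed.

Lemma plau_prod (T : Type) (r : seq T) s (a b : T -> int) (P : T -> D -> {poly k}) :
  (forall i, plau s (a i) (b i) (P i)) ->
  plau s (\sum_(i <- r) a i) (\sum_(i <- r) b i) (fun t => \prod_(i <- r) P i t).
Proof.
move=> H; elim: r => [|i r IH] m.
  rewrite !big_nil; apply: lau_ext (plau_cst (lau_cst s 1) m) => t _.
  by rewrite big_nil.
rewrite !big_cons; apply: lau_ext (plauM (H i) IH m) => t _.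
by rewrite big_cons.
Qed.

Lemma plau_shift s j : plau s 0 1 (fun t => (t.2 j)%:P + t.1 j *: 'X).
Proof.
case=> [|[|m]].
- by apply: lau_ext (lau_y s j) => t _; rewrite !coefE mulr0 addr0.
- have := @lau_x s j 1 (or_intror isT); rewrite add0r subrr.
  by apply: lau_ext => t _; rewrite !coefE expr1z mulr1 add0r.
- by apply: lau_ext (lau0 _ _ _) => t _; rewrite !coefE mulr0 addr0.
Qed.

Lemma plauX s a b P m : plau s a b P -> plau s (a *+ m) (b *+ m) (fun t => P t ^+ m).
Proof.
move=> lP; have := @plau_prod _ (iota 0 m) s (fun=> a) (fun=> b) (fun=> P) (fun=> lP).
rewrite !big_const_seq !count_predT !size_iota !iter_addr_0 => H i.
apply: lau_ext (H i) => t _.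
by rewrite big_const_seq count_predT size_iota iter_mulr_1.
Qed.

(** The shift changes only [y], whose exponents are nonnegative, so substituting [y + c x] in a
    Laurent monomial gives a polynomial in [c]. *)
Lemma lau_expands s a b F : lau s a b F ->
  exists P, plau s a b P /\ forall t, inside s t -> expands F t (P t).
Proof.
move=> [l El FE].
pose Pe (e : expo) t : {poly k} := (\prod_j t.1 j ^ e (inl j))%:P *
  \prod_j ((t.2 j)%:P + t.1 j *: 'X) ^+ `|e (inr j)|%N.
have lPe e : bideg s a b e -> plau s a b (Pe e).
  move=> [e0 e1 ea eb]; rewrite -[a]addr0 -[b]add0r; apply: plauM.
    apply: plau_cst; rewrite -ea.
    have H (r : seq 'I_n) : lau s (\sum_(j <- r) e (inl j)) 0 (fun t => \prod_(j <- r) t.1 j ^ e (inl j)).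
      elim: r => [|j r IH].
        by rewrite big_nil; apply: lau_ext (lau_cst s 1) => t _; rewrite big_nil.
      rewrite big_cons -[0]addr0; apply: lau_ext (lauM (lau_x _) IH) => [t _|].
        by rewrite big_cons.
      by have [js|js] := boolP (j \in s); [left|right; exact: e0].
    exact: H.
  have := @plau_prod _ (index_enum 'I_n) s _ _ _ (fun j => plauX `|e (inr j)|%N (plau_shift s j)).
  rewrite (_ : \sum_(i <- _) 0 *+ _ = 0); last by rewrite big1 // => j _; rewrite mul0rn.
  rewrite (_ : \sum_(i <- _) 1 *+ _ = b) // -eb; apply: eq_bigr => j _.
  by rewrite -[RHS]gez0_abs // natz.
exists (fun t => \sum_(x <- l) x.1 *: Pe x.2 t); split.
  move=> m; apply: (@lau_ext _ _ _ (fun t => \sum_(x <- l) if x \in l then x.1 * (Pe x.2 t)`_m else 0)).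
    move=> t _; rewrite coef_sum [LHS]big_seq [RHS]big_seq; apply: eq_bigr => x xl.
    by rewrite xl coefZ.
  apply: lau_sum => x _; have [xl|_] := boolP (x \in l); last exact: lau0.
  by apply: lauZ; exact: lPe (El x xl) m.
move=> t it c; rewrite FE // /lsum horner_sum !big_seq; apply: eq_bigr => x /El[e0 e1 _ _].
rewrite hornerZ hornerM hornerC horner_prod; congr (_ * _).
rewrite /monomial big_sumType /=; congr (_ * _).
apply: eq_bigr => j _; rewrite horner_exp hornerD hornerC hornerZ hornerX -(mulrC c).
by rewrite -{1}[x.2 (inr j)]gez0_abs.
Qed.

End LaurentClosure.

Section Vanishing.
Variables (k : closedFieldType) (n : nat).
Local Notation D := (('I_n -> k) * ('I_n -> k))%type.
Implicit Types (F G : D -> k) (t : D) (s : seq 'I_n) (a b : int).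
Local Notation inside := (inside (fun=> True) (@nonzero k n)).

Definition laz s a b F : Prop := lau s a b F /\ forall t, ~ inside s t -> F t = 0.

Lemma laz_polynomial s a b F : laz s a b F -> polynomial F.
Proof.
move=> [lF F0] t; have [it|nt] := pselect (inside s t).
  by have [P [_ PE]] := lau_expands lF; exists (P t); exact: PE.
by exists 0 => c; rewrite horner0 F0.
Qed.

Lemma taylor_out s a b F t : laz s a b F -> ~ inside s t -> taylor F t = 0.
Proof. by move=> [_ F0] nt; apply: taylorE => c; rewrite horner0 F0. Qed.

Lemma laz_hasse s a b F (r : nat) : laz s a b F -> laz s (a + r%:Z) (b - r%:Z) (hasse r F).
Proof.
move=> lF; have [P [lP PE]] := lau_expands (proj1 lF); split.
  by apply: lau_ext (lP r) => t it; rewrite /hasse (taylorE (PE t it)).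
by move=> t nt; rewrite /hasse (taylor_out lF nt) coef0.
Qed.

Lemma laz_neg s a b F t : b < 0 -> laz s a b F -> F t = 0.
Proof.
move=> b0 [lF F0]; have [it|nt] := pselect (inside s t); last exact: F0.
exact: lau_neg lF it.
Qed.

(** The Taylor coefficient of index [m] has degree [b - m] in [y], which cannot be negative. *)
Lemma laz_size s a b F B t : b < B%:Z -> laz s a b F -> (size (taylor F t) <= B)%N.
Proof.
move=> bB lF; apply/leq_sizeP => m Bm.
have := laz_neg t _ (laz_hasse m lF); apply.
by rewrite subr_lt0 (lt_le_trans bB) // lez_nat.
Qed.

Lemma laz_lin s a b (c : k) F G : laz s a b F -> laz s a b G -> laz s a b (fun t => c * F t + G t).
Proof.
move=> [lF F0] [lG G0]; split; first exact: lauD (lauZ c lF) lG.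
by move=> t nt; rewrite F0 // G0 // mulr0 addr0.
Qed.

Lemma laz0 s a b : laz s a b (fun=> 0).
Proof. by split=> //; exact: lau0. Qed.

Lemma lazZ s a b (c : k) F : laz s a b F -> laz s a b (fun t => c * F t).
Proof.
move=> lF; have := laz_lin c lF (laz0 s a b); congr laz.
by apply/funext => t; rewrite addr0.
Qed.

Lemma laz_sum (T : Type) (r : seq T) s a b (F : T -> D -> k) :
  (forall i, laz s a b (F i)) -> laz s a b (fun t => \sum_(i <- r) F i t).
Proof.
move=> H; split; first by apply: lau_sum => i _; case: (H i).
by move=> t nt; rewrite big1 // => i _; have [_ ->] := H i.
Qed.

Lemma laz_ins s1 j s2 a b F : laz (s1 ++ s2) a b F ->
  laz (s1 ++ j :: s2) a b (fcut (@nonzero k n j) F).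
Proof.
move=> [[l El FE] F0]; split.
  exists l => [x /El[e0 e1 ea eb]|t it].
    by split=> // i; rewrite mem_cat inE orbCA negb_or => /andP[_ ii]; apply: e0; rewrite mem_cat.
  by have [tj it'] := (inside_ins _ _ _ _ _ _).1 it; rewrite /fcut asboolT // FE.
move=> t nt; rewrite /fcut; case: asboolP => // tj; apply: F0 => it.
by apply: nt; apply/inside_ins.
Qed.

Section Chart.
Variables (s : seq 'I_n) (i : 'I_n).
Hypothesis si : i \in s.

Lemma inside_neq0 t : inside s t -> t.1 i != 0.
Proof. by move=> [_ /(_ i si)]. Qed.

Lemma lau_tau m : lau s (- m%:Z) m%:Z (fun t => tau i t ^+ m).
Proof.
have l1 : lau s (-1) 1 (fun t => tau i t).
  have := lauM (lau_y k s i) (lau_x k (c := -1) (or_introl si)); rewrite add0r addr0.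
  by apply: lau_ext => t _; rewrite exprN1.
elim: m => [|m IH]; first by rewrite oppr0; apply: lau_ext (lau_cst s 1) => t _.
have := lauM l1 IH; rewrite -opprD -intS.
by apply: lau_ext => t _; rewrite exprS.
Qed.

Lemma lau_horner a b B (G : nat -> D -> k) :
  (forall m : nat, lau s (a + m%:Z) (b - m%:Z) (G m)) ->
  lau s a b (fun t => \sum_(m < B) G m t * tau i t ^+ m).
Proof.
move=> H; apply: lau_sum => m _; have := lauM (H m) (lau_tau m).
by rewrite addrK subrK.
Qed.

(** The value at [bar i t] is the Taylor polynomial at [- tau i t], and [tau i] has its only pole
    along [x_i], allowed because [i] is in [s]. *)
Lemma laz_bar a b F : laz s a b F -> laz s a b (fun t => F (bar i t)).
Proof.
move=> lF; split; last by move=> t nt; have [_ ->] := lF.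
have [B bB] : exists B : nat, b < B%:Z by exists `|b|.+1; lia.
apply: (@lau_ext _ _ _ _ _ (fun t => \sum_(m < B) ((-1) ^+ m * hasse m F t) * tau i t ^+ m)).
  move=> t it; rewrite (taylorP t (laz_polynomial lF)).
  rewrite (horner_coef_wide _ (laz_size t bB lF)); apply: eq_bigr => m _.
  by rewrite /hasse (exprNn (tau i t)) mulrCA mulrA.
apply: (@lau_horner _ _ B (fun m t => (-1) ^+ m * hasse m F t)) => m.
by apply: lauZ; have [] := laz_hasse m lF.
Qed.

Variable p : nat.

(** [raise] applied to [F] as a polynomial in [tau i]; the base point [bar i t] makes the result
    independent of the position on the orbit. *)
Definition homot l e F t : k := (raise p l e (taylor F (bar i t))).[tau i t].

Lemma taylor_homot l e F t : inside s t -> taylor (homot l e F) (bar i t) = raise p l e (taylor F (bar i t)).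
Proof.
move=> it; have ti := inside_neq0 it; apply: taylorE => c.
have tbi : (bar i t).1 i != 0 by [].
by rewrite /homot bar_shift // bar_bar // tau_shift // tau_bar // add0r.
Qed.

Lemma laz_homot l e a b F : laz s a b F ->
  laz s (a - (e * p ^ l)%N%:Z) (b + (e * p ^ l)%N%:Z) (homot l e F).
Proof.
move=> lF; split; last first.
  by move=> t nt; rewrite /homot (taylor_out lF) // raise0 horner0.
have [B bB] : exists B : nat, b < B%:Z by exists `|b|.+1; lia.
set q := (e * p ^ l)%N.
pose G m t : k := if (e <= digit p l m)%N
  then (('C(digit p l m, e))%:R)^-1 * hasse (m - q) F (bar i t) else 0.
apply: (@lau_ext _ _ _ _ _ (fun t => \sum_(m < B + q) G m t * tau i t ^+ m)).
  move=> t it; rewrite /homot (@horner_coef_wide _ (B + q)); last first.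
    by apply: leq_trans (size_poly _ _) _; rewrite leq_add2r (laz_size _ bB lF).
  apply: eq_bigr => m _; rewrite /raise coef_poly /G /hasse.
  case: ltnP => H.
    case: ifP => // _; by congr (_ * _); rewrite mulrC.
  case: ifP => // _; rewrite nth_default ?mulr0 ?mul0r //.
  by rewrite -(leq_add2r q) subnK //; exact: leq_trans (leq_addl _ _) H.
apply: lau_horner => m; rewrite /G; have [H|H] := leqP e (digit p l m); last exact: lau0.
apply: lauZ; have := proj1 (laz_bar (laz_hasse (m - q) lF)).
have qm : (q <= m)%N by exact: digit_le H.
by rewrite -subzn //; congr lau; ring.
Qed.

End Chart.
End Vanishing.

(** * The tensor product of the digit complexes and its homotopies *)

Section PolynomialFamilies.
Variables (k : closedFieldType) (p M : nat).
Hypothesis hp : p \in [pchar k].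
Local Notation B := {ffun 'I_M -> nat}.
Implicit Types (b : B) (l m : 'I_M) (Q : B -> {poly k}).
Local Notation lower := (@lower k p).
Local Notation raise := (@raise k p).

Let p_prime : prime p. Proof. exact: pcharf_prime hp. Qed.
Let p_gt1 : (1 < p)%N. Proof. exact: prime_gt1. Qed.

(* Along each coordinate of b the differential alternates between the Hasse
   derivatives of orders p^l and (p-1)p^l. *)
Definition stride (c : nat) : nat := if odd c then 1 else p.-1.

Lemma stride_bounds c : (0 < stride c < p)%N.
Proof. by rewrite /stride; case: (odd c); move: p_gt1; lia. Qed.

Lemma stride_lt c : (stride c < p)%N. Proof. by case/andP: (stride_bounds c). Qed.

Lemma strideS c : stride c.+1 = (p - stride c)%N.
Proof. by rewrite /stride /=; case: (odd c); move: p_gt1 => /=; lia. Qed.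

Definition up m b : B := [ffun i => (b i + (i == m))%N].
Definition dn m b : B := [ffun i => (b i - (i == m))%N].
(** The Koszul sign of the tensor product, by which differentials in different directions
    anticommute. *)
Definition sg m b : k := (-1) ^+ (\sum_(i < M | (i < m)%N) b i)%N.

Lemma sg_up l m b : sg l (up m b) = (-1) ^+ (m < l)%N * sg l b.
Proof.
rewrite /sg -exprD; congr (_ ^+ _).
under eq_bigr => i _ do rewrite ffunE.
rewrite big_split addnC /=; congr (_ + _)%N.
have [ml|lm] := ltnP m l; last first.
  by rewrite big1 // => i il; case: eqP => // im; rewrite im ltnNge lm in il.
rewrite (bigD1 m) //= eqxx big1 ?addn0 // => i /andP[_ /negPf ->].
by [].
Qed.

Lemma up_dn m b : (0 < b m)%N -> up m (dn m b) = b.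
Proof. by move=> bm; apply/ffunP => i; rewrite !ffunE subnK //; case: eqP => // ->. Qed.

Lemma dn_up m b : dn m (up m b) = b.
Proof. by apply/ffunP => i; rewrite !ffunE addnK. Qed.

Lemma dn_upC l m b : l != m -> dn l (up m b) = up m (dn l b).
Proof.
move=> lm; apply/ffunP => i; rewrite !ffunE; case: (eqVneq i l) => [->|il].
  by rewrite (negPf lm) !addn0.
by rewrite !subn0.
Qed.

Lemma dnC l m b : dn l (dn m b) = dn m (dn l b).
Proof. by apply/ffunP => i; rewrite !ffunE subnAC. Qed.

Lemma sg_dn l m b : (0 < b m)%N -> sg l (dn m b) = (-1) ^+ (m < l)%N * sg l b.
Proof. by move=> bm; rewrite -{2}(up_dn bm) sg_up mulrA -expr2 sqrr_sign mul1r. Qed.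

Lemma sg_sqr m b : sg m b * sg m b = 1.
Proof. by rewrite /sg -signr_odd -expr2 sqrr_sign. Qed.

Lemma up_neq l m b : l != m -> up m b l = b l.
Proof. by move=> /negPf lm; rewrite ffunE lm addn0. Qed.

Lemma dn_neq l m b : l != m -> dn m b l = b l.
Proof. by move=> /negPf lm; rewrite ffunE lm subn0. Qed.

Definition dpoly_term (l : 'I_M) b Q : {poly k} :=
  if (0 < b l)%N then sg l b *: lower l (stride (b l)) (Q (dn l b)) else 0.

Definition dpoly Q b : {poly k} := \sum_l dpoly_term l b Q.

Definition hpoly m Q b : {poly k} := sg m b *: raise m (stride (b m).+1) (Q (up m b)).

Lemma antisym_sum (V : zmodType) (T : 'I_M -> 'I_M -> V) : (forall l, T l l = 0) ->
  (forall l l' : 'I_M, (l < l')%N -> T l l' + T l' l = 0) -> \sum_l \sum_l' T l l' = 0.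
Proof.
move=> T0 TT.
have E l : \sum_l' T l l' = \sum_(l' : 'I_M | (l < l')%N) T l l' + \sum_(l' : 'I_M | (l' < l)%N) T l l'.
  rewrite (bigID (fun l' : 'I_M => (l < l')%N)) /=; congr (_ + _).
  rewrite (bigD1 l) ?ltnn //= T0 add0r; apply: eq_bigl => l'.
  by rewrite -leqNgt ltn_neqAle andbC.
under eq_bigr => l _ do rewrite E.
rewrite big_split /= [X in _ + X](exchange_big_dep xpredT) //= -big_split big1 // => l _ /=.
by rewrite -big_split big1 // => l' /TT.
Qed.

Lemma dpoly_dpoly Q b : dpoly (dpoly Q) b = 0.
Proof.
have E l : dpoly_term l b (dpoly Q) = \sum_l' (if (0 < b l)%N && (0 < dn l b l')%N then
    (sg l b * sg l' (dn l b)) *: lower l (stride (b l)) (lower l' (stride (dn l b l')) (Q (dn l' (dn l b))))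
    else 0).
  rewrite /dpoly_term; case: ifP => bl; last by rewrite big1.
  rewrite /dpoly (big_morph _ (id1 := 0) (op1 := +%R)) ?lower0 //; last first.
    by move=> P P'; rewrite -[P]scale1r lower_lin !scale1r.
  rewrite scaler_sumr; apply: eq_bigr => l' _; rewrite /dpoly_term /=; case: ifP => _.
    by rewrite lowerZ scalerA.
  by rewrite lower0 scaler0.
rewrite /dpoly (eq_bigr _ (fun l _ => E l)); apply: antisym_sum => [l|l l' ll].
  rewrite !ffunE eqxx; case: ifP => // /andP[bl bl1].
  have -> : stride (b l) = (p - stride (b l - 1))%N.
    by rewrite -strideS -subSn // subn1.
  have ss := stride_bounds (b l - 1).
  rewrite -{2}(subKn (ltnW (stride_lt (b l - 1)))).
  rewrite lower_lower ?scaler0 //.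
  by move: ss; lia.
have nl : l' != l by rewrite -val_eqE /= neq_ltn ll orbT.
have nl' : l != l' by rewrite eq_sym.
rewrite (dn_neq _ nl) (dn_neq _ nl') andbC; case: ifP => [/andP[bl' bl]|_]; last by rewrite addr0.
rewrite (sg_dn _ bl') (sg_dn _ bl) ll ltnNge (ltnW ll) /= expr1 expr0 mul1r mulN1r.
rewrite (dnC l) (lower_lowerC hp _ nl) ?stride_lt // -scalerDl mulrN (mulrC (sg l' b)) addNr scale0r.
by [].
Qed.

(** In directions other than [m] the two terms cancel by the Koszul signs. In direction [m], with
    stride [e], the two compositions project onto digits below [p - e] and digits at least [p - e],
    so they add up to the identity; when [b m = 0] only the second is present, and digit 0 is
    lost. *)
Lemma homotopy m Q b j : (dpoly (hpoly m Q) b + hpoly m (dpoly Q) b)`_j =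
  if (b m == 0)%N && (digit p m j == 0)%N then 0 else (Q b)`_j.
Proof.
have E : hpoly m (dpoly Q) b = \sum_l (if (0 < up m b l)%N then
    (sg m b * sg l (up m b)) *: raise m (stride (b m).+1) (lower l (stride (up m b l)) (Q (dn l (up m b))))
    else 0).
  rewrite /hpoly /dpoly (big_morph _ (id1 := 0) (op1 := +%R)) ?raise0 //; last first.
    by move=> P P'; rewrite -[P]scale1r raise_lin !scale1r.
  rewrite scaler_sumr; apply: eq_bigr => l _; rewrite /dpoly_term /=; case: ifP => _.
    by rewrite raiseZ scalerA.
  by rewrite raise0 scaler0.
rewrite E /dpoly -big_split (bigD1 m) //= [X in _ + X]big1 ?addr0; last first.
  move=> l lm; have ml : m != l by rewrite eq_sym.
  rewrite /dpoly_term /hpoly up_neq //; case: ifP => bl; last by rewrite addr0.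
  rewrite (dn_neq _ ml) lowerZ scalerA (dn_upC _ lm) (lower_raiseC hp _ _ lm) ?stride_lt //.
  rewrite -scalerDl (sg_dn _ bl) sg_up.
  have : (m < l)%N = ~~ (l < m)%N by rewrite -leqNgt ltn_neqAle -val_eqE /= in ml *; rewrite ml.
  move=> ->; case: (l < m)%N => /=; rewrite expr0 expr1 ?mul1r ?mulN1r ?mulrN ?mulNr.
    by rewrite (mulrC (sg l b)) addNr scale0r.
  by rewrite (mulrC (sg l b)) subrr scale0r.
have um : up m b m = (b m).+1 by rewrite ffunE eqxx addn1.
have dm : dn m b m = (b m).-1 by rewrite ffunE eqxx subn1.
rewrite /dpoly_term /hpoly um dm /= dn_up sg_up ltnn mul1r sg_sqr scale1r.
have rl := raise_lower hp m (Q b) j (stride_lt (b m).+1).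
rewrite coefD rl; case: ifP => bm.
  rewrite up_dn // lowerZ scalerA sg_dn // ltnn mul1r sg_sqr scale1r prednK //.
  rewrite (lower_raise hp) ?stride_lt // (gtn_eqF bm) /= strideS.
  have := stride_bounds (b m); have := digit_lt p_gt1 m j.
  move: (digit p m j) (stride (b m)) => g e ge eb.
  have [H|H] := ltnP (g + e) p.
    by rewrite leq_subLR leqNgt addnC H addr0.
  by rewrite leq_subLR addnC H add0r.
have b0 : b m = 0%N by move/negbT: bm; rewrite lt0n negbK => /eqP.
rewrite b0 coef0 add0r eqxx /= /stride /=; by case: (digit p m j).
Qed.

End PolynomialFamilies.

(** * The resolution by Laurent functions *)

Section HasseComplex.
Variables (k : closedFieldType) (p M n d : nat).
Hypothesis hp : p \in [pchar k].
Hypothesis d_lt : (d < n)%N.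
Local Notation D := (('I_n -> k) * ('I_n -> k))%type.
Local Notation B := {ffun 'I_M -> nat}.
Local Notation J := 'I_n.
Implicit Types (F G : B * D -> k^o) (b : B) (t : D) (s : seq J) (l m : 'I_M).
Local Notation inside := (inside (fun=> True) (@nonzero k n)).
Local Notation stride := (stride p).

Let p_prime : prime p. Proof. exact: pcharf_prime hp. Qed.
Let p_gt1 : (1 < p)%N. Proof. exact: prime_gt1. Qed.

Definition slice F b : D -> k := fun t => F (b, t).

Definition deg b : nat := \sum_l b l.

(** The sum of the first [c] strides 1, p - 1, 1, p - 1, ...; counting from 0, it is the [c]-th
    natural number congruent to 0 or 1 modulo [p], so [c] is its p-index. *)
Definition tuple_entry (c : nat) : nat := p * c./2 + odd c.

Definition weight b : nat := \sum_(l < M) p ^ l * tuple_entry (b l).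

Lemma tuple_entryS c : tuple_entry c.+1 = (tuple_entry c + stride c.+1)%N.
Proof.
rewrite /tuple_entry /stride /= uphalf_half; case: (odd c) => /=.
  by rewrite add1n mulnS; move: p_gt1; lia.
by rewrite add0n; lia.
Qed.

Lemma deg_up m b : deg (up m b) = (deg b).+1.
Proof.
rewrite /deg; under eq_bigr => i _ do rewrite ffunE.
rewrite big_split /= -addn1; congr (_ + _)%N.
by rewrite (bigD1 m) //= eqxx big1 ?addn0 // => i /negPf ->.
Qed.

Lemma weight_up m b : weight (up m b) = (weight b + stride (b m).+1 * p ^ m)%N.
Proof.
rewrite /weight (bigD1 m) //= [X in _ = (X + _)%N](bigD1 m) //= ffunE eqxx addn1 tuple_entryS.
rewrite (eq_bigr (fun l : 'I_M => p ^ l * tuple_entry (b l)))%N; last by move=> l /negPf lm; rewrite ffunE lm addn0.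
by rewrite mulnDr (mulnC (stride _)) addnAC.
Qed.

Definition hdiff F : B * D -> k^o := fun bt =>
  \sum_(l < M) if (0 < bt.1 l)%N
    then sg k l bt.1 * hasse (stride (bt.1 l) * p ^ l) (slice F (dn l bt.1)) bt.2 else 0.

(** Reaching [b] from the zero tuple takes derivatives of total order [weight b]; each order moves
    one degree from [y] to [x], which accounts for the bidegree. *)
Definition hin q s F : Prop := forall b,
  laz s ((weight b)%:Z - d%:Z) (d%:Z - (weight b)%:Z) (slice F b) /\
  (deg b != q -> forall t, F (b, t) = 0).

Lemma hin_polynomial q s F b : hin q s F -> polynomial (slice F b).
Proof. by move=> /(_ b)[/laz_polynomial]. Qed.

Lemma hin0 q s : hin q s 0.
Proof. by move=> b; split=> //; exact: laz0. Qed.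

Lemma hin_lin q s (a : k) F G : hin q s F -> hin q s G -> hin q s (a *: F + G).
Proof.
move=> hF hG b; have [lF F0] := hF b; have [lG G0] := hG b; split; first exact: (@laz_lin _ _ _ _ _ a _ _ lF lG).
move=> nb t; change (a * F (b, t) + G (b, t) = 0).
by rewrite F0 // G0 // mulr0 addr0.
Qed.

Definition hface := face k (fun (j : J) (bt : B * D) => nonzero j bt.2).

Lemma slice_face j F b : slice (hface j F) b = fcut (@nonzero k n j) (slice F b).
Proof. by []. Qed.

Lemma hin_ins q s1 j s2 F : hin q (s1 ++ s2) F -> hin q (s1 ++ j :: s2) (hface j F).
Proof.
move=> hF b; have [lF F0] := hF b; split; first exact: laz_ins.
by move=> nb t; rewrite /= /fcut F0 //; case: asboolP.
Qed.

Lemma hin_hdiff q s F : hin q s F -> hin q.+1 s (hdiff F).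
Proof.
move=> hF b; split.
  rewrite /slice /hdiff /=; apply: laz_sum => l.
  have [bl|bl] := ltnP 0 (b l); last exact: laz0.
  apply: lazZ; have [lF _] := hF (dn l b).
  have wE : weight b = (weight (dn l b) + stride (b l) * p ^ l)%N.
    by rewrite -{1}(up_dn bl) weight_up ffunE eqxx subn1 prednK.
  by have := laz_hasse (stride (b l) * p ^ l) lF; congr laz; rewrite wE PoszD; ring.
move=> nb t; rewrite /hdiff /= big1 // => l _; case: ifP => // bl.
have [_ F0] := hF (dn l b); rewrite /hasse (_ : slice F _ = fun=> 0) ?taylor0 ?coef0 ?mulr0 //.
apply/funext => u; apply: F0; apply: contra nb => /eqP E.
by rewrite -(up_dn bl) deg_up E.
Qed.

Lemma taylor_sum (r : seq 'I_M) (G : 'I_M -> D -> k) t : (forall l, polynomial (G l)) ->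
  taylor (fun u => \sum_(l <- r) G l u) t = \sum_(l <- r) taylor (G l) t.
Proof.
move=> pG; apply: taylorE => c; rewrite horner_sum.
by apply: eq_bigr => l _; exact: (taylorP t (pG l)).
Qed.

Lemma taylor_hdiff q s F b t : hin q s F ->
  taylor (slice (hdiff F) b) t = dpoly p (fun b => taylor (slice F b) t) b.
Proof.
move=> hF; rewrite /slice /hdiff /= taylor_sum /dpoly; last first.
  move=> l; have [_|_] := ltnP 0 (b l); last exact: polynomial0.
  have := polynomial_lin (sg k l b) (hasse_polynomial (stride (b l) * p ^ l) (hin_polynomial (dn l b) hF)) (@polynomial0 k n).
  by congr polynomial; apply/funext => u; rewrite addr0.
apply: eq_bigr => l _; rewrite /dpoly_term; have [bl|bl] := ltnP 0 (b l); last exact: taylor0.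
have pF := hin_polynomial (dn l b) hF.
have := taylor_lin (sg k l b) t (hasse_polynomial (stride (b l) * p ^ l) pF) (@polynomial0 k n).
rewrite taylor0 addr0 taylor_hasse // => <-.
by congr taylor; apply/funext => u; rewrite addr0.
Qed.

Lemma taylor_eq0 F b t : polynomial (slice F b) -> taylor (slice F b) t = 0 -> F (b, t) = 0.
Proof.
by move=> pF t0; have := taylorP t pF 0; rewrite shift0 t0 horner0.
Qed.

Lemma hdiff_hdiff q s F : hin q s F -> hdiff (hdiff F) = 0.
Proof.
move=> hF; have hF1 := hin_hdiff hF; apply/funext => -[b t].
apply: taylor_eq0; first exact: hin_polynomial (hin_hdiff hF1).
rewrite (taylor_hdiff _ _ hF1) -[RHS](dpoly_dpoly hp (fun b => taylor (slice F b) t) b).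
by congr dpoly; apply/funext => b'; rewrite (taylor_hdiff _ _ hF).
Qed.

Lemma hdiff_lin q s (a : k) F G : hin q s F -> hin q s G ->
  hdiff (a *: F + G) = a *: hdiff F + hdiff G.
Proof.
move=> hF hG; apply/funext => -[b t].
change (hdiff (a *: F + G) (b, t) = a * hdiff F (b, t) + hdiff G (b, t)).
rewrite /hdiff /= mulr_sumr -big_split; apply: eq_bigr => l _ /=.
case: ifP => _; last by rewrite mulr0 addr0.
rewrite mulrCA -mulrDr; congr (_ * _).
rewrite /hasse -coefZ -coefD -taylor_lin //; exact: hin_polynomial.
Qed.

Lemma hdiff_ins j F : hdiff (hface j F) = hface j (hdiff F).
Proof.
apply/funext => -[b t]; rewrite /= /fcut /hdiff /=.
case: asboolP => tj; last first.
  rewrite big1 // => l _; case: ifP => // _.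
  rewrite /hasse (@taylorE _ _ _ t 0) ?coef0 ?mulr0 // => c.
  by rewrite horner0 /slice /= /fcut asboolF.
apply: eq_bigr => l _; case: ifP => // _; congr (_ * _); rewrite /hasse; congr (_`__).
rewrite /taylor; have E P : expands (slice (hface j F) (dn l b)) t P <-> expands (slice F (dn l b)) t P.
  by split=> H c; have := H c; rewrite /slice /= /fcut asboolT.
have EE : expands (slice (hface j F) (dn l b)) t = expands (slice F (dn l b)) t.
  by apply/funext => P; apply/propext.
by rewrite EE.
Qed.

Definition hasse_complex : double_complex k J :=
  @DoubleComplex k J (fun=> (B * D -> k^o : lmodType k)) (fun=> hface) hin (fun _ _ => hdiff)
    (fun _ i j v => fcutC _ _ v) hin0 (fun q s a u v => @hin_lin q s a u v)
    (fun q s1 j s2 v => @hin_ins q s1 j s2 v) (fun q s v => @hin_hdiff q s v)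
    (fun q s a u v => @hdiff_lin q s a u v)
    (fun q s1 j s2 v _ => hdiff_ins j v) (fun q s v => @hdiff_hdiff q s v).

Lemma hin_homot q s i m F : i \in s -> hin q.+1 s F ->
  hin q s (fun bt => sg k m bt.1 * homot i p m (stride (bt.1 m).+1) (slice F (up m bt.1)) bt.2).
Proof.
move=> si hF b; have [lF F0] := hF (up m b); split.
  have := lazZ (sg k m b) (laz_homot si p m (stride (b m).+1) lF); congr laz; rewrite weight_up PoszD; ring.
move=> nb t /=; rewrite /homot (_ : slice F _ = fun=> 0) ?taylor0 ?raise0 ?horner0 ?mulr0 //.
by apply/funext => u; apply: F0; rewrite deg_up eqSS.
Qed.

(** A nonempty tuple supplies an [i] with [x_i] invertible, and with it the homotopies. Each works
    in one direction only and leaves a remainder where that coordinate of [b] is 0, so the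
    directions are treated one after the other; in positive degree some coordinate of [b] is
    nonzero. *)
Lemma hasse_column_exact q : column_exact hasse_complex q.
Proof.
move=> s z s0 hz dz; have [i si] : exists i, i \in s.
  by case: s s0 {hz dz} => // i s _; exists i; rewrite mem_head.
(* After [N] directions the corrected cycle can be nonzero only at those [b] whose first [N]
   coordinates are 0. *)
suff H N : (N <= M)%N -> exists2 y, hin q s y &
    forall b t, (exists2 l : 'I_M, (l < N)%N & b l != 0%N) -> (z - hdiff y : B * D -> k^o) (b, t) = 0.
  have [y hy yz] := H M (leqnn M); exists y => //; apply/esym/eqP; rewrite -subr_eq0; apply/eqP.
  apply/funext => -[b t]; have [db|nb] := eqVneq (deg b) q.+1; last first.
    have [_ z0] := hz b; have [_ y0] := hin_hdiff hy b.
    change (z (b, t) - hdiff y (b, t) = 0).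
    by rewrite z0 // y0 // subr0.
  apply: yz; apply: contrapT => nl; have : deg b = 0%N; last by rewrite db.
  rewrite /deg big1 // => l _; apply/eqP/negPn/negP => bl.
  by apply: nl; exists l.
elim: N => [|N IH] NM.
  exists 0; first exact: hin0.
  by move=> b t [].
have [y hy yz] := IH (ltnW NM); pose m := Ordinal NM.
pose z' : B * D -> k^o := z - hdiff y.
have hdy := hin_hdiff hy.
have hz' : hin q.+1 s z'.
  by rewrite /z' addrC -scaleN1r; exact: hin_lin.
have dz' : hdiff z' = 0.
  rewrite /z' addrC -scaleN1r (hdiff_lin _ hdy hz) (hdiff_hdiff hy) scaler0 add0r.
  exact: dz.
pose h : B * D -> k^o := fun bt => sg k m bt.1 * homot i p m (stride (bt.1 m).+1) (slice z' (up m bt.1)) bt.2.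
have hh : hin q s h := hin_homot m si hz'.
exists (y + h); first by rewrite -[y]scale1r; exact: hin_lin.
have dyh : z - hdiff (y + h) = z' - hdiff h.
  by rewrite -[y]scale1r (hdiff_lin _ hy hh) scale1r opprD addrA.
rewrite dyh => b t [l lN bl].
have hdh := hin_hdiff hh.
have hw : hin q.+1 s (z' - hdiff h) by rewrite addrC -scaleN1r; exact: hin_lin.
have [it|nt] := pselect (inside s t); last by have [[_ w0] _] := hw b; exact: w0.
have pw := hin_polynomial b hw.
(* A function is recovered from its Taylor polynomial at [bar i t], on which [homot] acts as
   [raise]; the claim becomes one about polynomials. *)
apply: (etrans (taylor_bar i t pw)).
suff -> : taylor (slice (z' - hdiff h) b) (bar i t) = 0 by rewrite horner0.
have tsub : taylor (slice (z' - hdiff h) b) (bar i t) =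
    taylor (slice z' b) (bar i t) - taylor (slice (hdiff h) b) (bar i t).
  rewrite [RHS]addrC -[- taylor _ _]scaleN1r -taylor_lin; [|exact: hin_polynomial hdh|exact: hin_polynomial hz'].
  by congr taylor; apply/funext => u; rewrite mulN1r addrC.
rewrite tsub (taylor_hdiff _ _ hh).
pose Q b := taylor (slice z' b) (bar i t).
have -> : (fun b => taylor (slice h b) (bar i t)) = hpoly p m Q.
  apply/funext => b'; rewrite /hpoly.
  have lz := (proj1 (hz' (up m b'))).
  have lh := laz_polynomial (laz_homot si p m (stride (b' m).+1) lz).
  have := taylor_lin (sg k m b') (bar i t) lh (@polynomial0 k n).
  rewrite taylor0 addr0 (taylor_homot si p m _ _ it) => <-.
  by congr taylor; apply/funext => u; rewrite addr0.
have dQ0 : hpoly p m (dpoly p Q) b = 0.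
  rewrite /hpoly (_ : dpoly p Q (up m b) = 0) ?raise0 ?scaler0 //.
  rewrite -(taylor_hdiff _ _ hz') dz'; exact: taylor0.
apply/polyP => j; rewrite coef0 coefB.
have := homotopy hp m Q b j; rewrite dQ0 addr0 => ->.
rewrite -/(Q b); case: ifP => // [/andP[/eqP bm _]|_]; last by rewrite subrr.
rewrite subr0; have ln : (l < N)%N.
  rewrite ltn_neqAle -ltnS lN andbT; apply: contra bl => /eqP lE.
  by rewrite (_ : l = m) ?bm //; exact: val_inj.
rewrite /Q (_ : slice z' b = fun=> 0) ?taylor0 ?coef0 //.
by apply/funext => u; apply: yz; exists l.
Qed.

Lemma laz_cech_exact (a m : nat) (c : seq J -> (D -> k^o)) :
  (forall s, size s = m -> laz s (a%:Z - d%:Z) (d%:Z - a%:Z) (c s)) ->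
  (forall s, size s = m.+1 -> delta (face k (@nonzero k n)) c s = 0) ->
  exists b : seq J -> (D -> k^o), (forall u, (size u).+1 = m -> laz u (a%:Z - d%:Z) (d%:Z - a%:Z) (b u)) /\
    forall s, size s = m -> c s = delta (face k (@nonzero k n)) b s.
Proof.
apply: (@laurent_exact k _ D (@xy k n) J (fun=> True) (@nonzero k n)
  (fun s => bideg s (a%:Z - d%:Z) (d%:Z - a%:Z)) (fun j e => 0 <= e (inl j))).
- move=> s1 j s2 e [e0 e1 ea eb]; split=> // i.
  by rewrite mem_cat inE orbCA negb_or => /andP[_ ii]; apply: e0; rewrite mem_cat.
(* With all [n] exponents of [x] negative the degree would be at most [-n], but it is at least [-d]
   and [d < n]. *)
- move=> s e [_ _ ea _]; apply: contrapT => nex.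
  have lt (j : J) : e (inl j) <= -1.
    have : ~~ (0 <= e (inl j)) by apply/negP => ge; apply: nex; exists j.
    by rewrite -ltNge; lia.
  have : \sum_j e (inl j) <= \sum_(j < n) (-1) by apply: ler_sum => j _; exact: lt.
  rewrite ea sumr_const card_ord; move: d_lt.
  by rewrite -mulr_natl mulrN1 natz; lia.
- move=> j s e gj [e0 e1 ea eb]; split=> // i is_.
  have [->//|ij] := eqVneq i j; apply: e0.
  by rewrite inE negb_or ij.
- move=> s _ z z0; exists (fun j => z (inl j), fun j => z (inr j)).
    by split=> // j _; exact: z0.
  move=> e _; congr monomial; apply/funext; case=> j //.
Qed.

(** The faces do not mix different [b], so each slice is a Cech complex of Laurent polynomials of
    one fixed bidegree. *)
Lemma hasse_row_exact q : row_exact hasse_complex q.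
Proof.
move=> m c cP c0.
have cE b s : size s = m.+1 -> delta (face k (@nonzero k n)) (fun u => slice (c u) b) s = slice (delta hface c s) b.
  move=> ss; pose R (s : seq J) (u : D -> k^o) (v : B * D -> k^o) := u = slice v b.
  apply: (@delta_rel k J (D -> k^o) (B * D -> k^o) (face k (@nonzero k n)) hface R m) => //.
  - by move=> s' a u u' v v' _ -> ->.
  - by move=> s1 j s2 u u' _ ->.
have /boolp.choice[y yP] : forall b, exists y : seq J -> (D -> k^o),
    (forall u, (size u).+1 = m -> laz u ((weight b)%:Z - d%:Z) (d%:Z - (weight b)%:Z) (y u)) /\
    forall s, size s = m -> slice (c s) b = delta (face k (@nonzero k n)) y s.
  move=> b; apply: laz_cech_exact => s ss; first by have [] := cP s ss b.
  by rewrite cE // (c0 s ss).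
pose Y : seq J -> (B * D -> k^o) := fun u bt => if deg bt.1 == q then y bt.1 u bt.2 else 0.
exists Y; split.
  move=> u su b; split; last by move=> /negPf nb t; rewrite /Y /= nb.
  rewrite /slice /Y /=; case: (deg b == q); last exact: laz0.
  by have [H _] := yP b; exact: H.
move=> s ss; apply/funext => -[b t].
case: m => [|m'] in cP c0 cE yP ss *.
  have [_ H] := yP b; have := congr1 (fun f : D -> k^o => f t) (H s ss).
  by case: s ss {H} => //.
have YE : slice (delta hface Y s) b = if deg b == q then slice (c s) b else 0.
  pose R (s : seq J) (u : B * D -> k^o) (v : D -> k^o) := slice u b = if deg b == q then v else 0.
  have := @delta_rel k J (B * D -> k^o) (D -> k^o) hface (face k (@nonzero k n)) R m' Y (y b).
  have [_ ->] := yP b => //; apply=> //.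
  - move=> s' a u u' v v' _; rewrite /R; case: ifP => _ Eu Ev; apply/funext => r.
      have := congr1 (fun f : D -> k^o => f r) Eu; have := congr1 (fun f : D -> k^o => f r) Ev.
      by rewrite /slice => E1 E2; change (a * u (b, r) + v (b, r) = a * u' r + v' r); rewrite E1 E2.
    have := congr1 (fun f : D -> k^o => f r) Eu; have := congr1 (fun f : D -> k^o => f r) Ev.
    by rewrite /slice => E1 E2; change (a * u (b, r) + v (b, r) = 0); rewrite E1 E2 mulr0 addr0.
  - move=> s1 j s2 u u' _; rewrite /R slice_face => ->.
    by case: ifP => // _; apply/funext => r; rewrite /fcut; case: asboolP.
  - by move=> u su; rewrite /R /Y; apply/funext => r; rewrite /slice /=; case: ifP.
have := congr1 (fun f : D -> k^o => f t) YE; rewrite /slice => ->.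
by case: ifP => // nb; have [_ ->] := cP s ss b; rewrite ?nb.
Qed.

End HasseComplex.

(** * Counting tuples *)

Section BoundedTuples.
Variables (p M d : nat).
Hypothesis p_gt1 : (1 < p)%N.
Local Notation B := {ffun 'I_M -> nat}.

(** Entries of a tuple of weight [d] are at most [d], so such tuples can be counted in a finite
    type. *)
Definition nat_tuple (b : {ffun 'I_M -> 'I_d.+1}) : B := [ffun l => val (b l)].

Definition weight_set (q : nat) : {set {ffun 'I_M -> 'I_d.+1}} :=
  [set b | (deg (nat_tuple b) == q) && (weight p (nat_tuple b) == d)].

Lemma nat_tuple_inj : injective nat_tuple.
Proof.
by move=> b b' /ffunP E; apply/ffunP => l; have := E l; rewrite !ffunE => /val_inj.
Qed.

Lemma leq_tuple_entry c : (c <= tuple_entry p c)%N.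
Proof.
rewrite /tuple_entry -{1}(odd_double_half c) addnC leq_add2r -muln2 mulnC leq_mul2r.
by rewrite p_gt1 orbT.
Qed.

Lemma nat_tuple_onto (b : B) : weight p b = d -> exists b', nat_tuple b' = b.
Proof.
move=> wb; have bd l : (b l < d.+1)%N.
  rewrite ltnS -wb (leq_trans (leq_tuple_entry _)) // /weight (bigD1 l) //=.
  by rewrite (leq_trans _ (leq_addr _ _)) // leq_pmull // expn_gt0 ltnW.
by exists [ffun l => inord (b l)]; apply/ffunP => l; rewrite !ffunE /= inordK.
Qed.

End BoundedTuples.

Section GlobalHasse.
Variables (k : closedFieldType) (p M n d : nat).
Hypothesis hp : p \in [pchar k].
Hypothesis d_lt : (d < n)%N.
Local Notation D := (('I_n -> k) * ('I_n -> k))%type.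
Local Notation B := {ffun 'I_M -> nat}.
Implicit Types (F G : B * D -> k^o) (b : B) (t : D).

Let p_prime : prime p. Proof. exact: pcharf_prime hp. Qed.
Let p_gt1 : (1 < p)%N. Proof. exact: prime_gt1. Qed.

(** On the empty tuple no poles are allowed, so the degrees [w - d] in [x] and [d - w] in [y] are
    both nonnegative as soon as a monomial occurs. Then [w = d] and the monomial is constant. *)
Lemma hin_const q F b t t' : hin p d q [::] F ->
  F (b, t) = F (b, t') /\ (weight p b != d -> F (b, t) = 0).
Proof.
move=> /(_ b)[[[l El FE] _] _].
have bal x : x \in l -> (forall v, x.2 v = 0) /\ weight p b = d.
  move=> /El[e0 e1 ea eb].
  have a0 : 0 <= \sum_j x.2 (inl j) by apply: sumr_ge0 => j _; exact: e0.
  have b0 : 0 <= \sum_j x.2 (inr j) by apply: sumr_ge0 => j _; exact: e1.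
  have wd : weight p b = d by move: a0 b0; rewrite ea eb; lia.
  rewrite wd subrr in ea eb; split=> // -[j|j]; apply/eqP.
    move/eqP: ea; rewrite psumr_eq0 => [/allP/(_ j (mem_index_enum _)) //|i _].
    exact: e0.
  move/eqP: eb; rewrite psumr_eq0 => [/allP/(_ j (mem_index_enum _)) //|i _].
  exact: e1.
have FE' u : F (b, u) = \sum_(x <- l) x.1.
  have := FE u; rewrite /slice => -> //; rewrite /lsum !big_seq; apply: eq_bigr => x /bal[e0 _].
  by rewrite /monomial big1 ?mulr1 // => v _; rewrite e0 expr0z.
split; first by rewrite !FE'.
by move=> nw; rewrite FE' big_seq big1 // => x /bal[_ w]; rewrite w eqxx in nw.
Qed.

Lemma hdiff_const q F : hin p d q [::] F -> hdiff p F = 0.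
Proof.
move=> hF; apply/funext => -[b t]; rewrite /hdiff /= big1 // => l _; case: ifP => // _.
rewrite /hasse (@taylorE _ _ _ t (F (dn l b, t))%:P) => [|c].
  have /andP[s0 _] := stride_bounds hp (b l).
  rewrite coefC; case: eqP => [E|_]; last by rewrite mulr0.
  have : (0 < stride p (b l) * p ^ l)%N by rewrite muln_gt0 s0 expn_gt0 (ltnW p_gt1).
  by rewrite E.
by rewrite hornerC; have [] := hin_const (dn l b) (shift c t) t hF.
Qed.

Lemma hasse_dim q : quotient_dim (@dcycle _ _ (hasse_complex M hp d_lt) q [::])
  (@augmentation_boundary _ _ (hasse_complex M hp d_lt) q) #|weight_set p M d q|.
Proof.
pose beta (i : 'I_#|weight_set p M d q|) : B := nat_tuple (enum_val i).
pose t0 : D := (fun=> 0, fun=> 0).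
have aug0 (z : hasse_complex M hp d_lt q) : augmentation_boundary z <-> z = 0.
  case: q z {beta} => [|q] z //=; split=> [[a ha <-]|->]; first exact: hdiff_const ha.
  by exists 0; [exact: hin0|exact: (@ddiff0 _ _ (hasse_complex M hp d_lt) q [::])].
have betaP i : deg (beta i) = q /\ weight p (beta i) = d.
  by have := enum_valP i; rewrite inE => /andP[/eqP ? /eqP ?].
pose e i : B * D -> k^o := fun bt => (bt.1 == beta i)%:R.
have he i : hin p d q [::] (e i).
  move=> b; have [db wb] := betaP i; split; last first.
    by move=> nb t; rewrite /e /=; case: eqP => // bE; rewrite bE db eqxx in nb.
  split; last by move=> t []; split.
  rewrite /slice /e /=; case: eqP => [->|_]; last exact: lau0.
  by rewrite wb subrr; exact: lau_cst.
exists e; split; first by move=> i; split; [exact: he|exact: hdiff_const (he i)].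
move=> z [hz _]; have S (c : 'rV[k]_#|weight_set p M d q|) b t : (\sum_i c 0 i *: e i : B * D -> k^o) (b, t) =
    \sum_i c 0 i * (b == beta i)%:R.
  elim/big_rec2: _ => // i u v _ E; change (c 0 i * e i (b, t) + v (b, t) = c 0 i * (b == beta i)%:R + u).
  by rewrite E.
have beta_inj : injective beta by move=> i j /nat_tuple_inj/enum_val_inj.
have Si (c : 'rV[k]_#|weight_set p M d q|) i t : (\sum_i c 0 i *: e i : B * D -> k^o) (beta i, t) = c 0 i.
  rewrite S (bigD1 i) //= eqxx mulr1 big1 ?addr0 // => j ji.
  by rewrite (inj_eq beta_inj) eq_sym (negPf ji) mulr0.
exists (\row_i z (beta i, t0)); split.
  apply/aug0/eqP; rewrite subr_eq0; apply/eqP/funext => -[b t].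
  have [[i ->]|nb] := pselect (exists i, b = beta i).
    by rewrite Si mxE; have [] := hin_const (beta i) t t0 hz.
  rewrite S big1; last first.
    by move=> i _; case: eqP => [bE|_]; [case: nb; exists i|rewrite mulr0].
  have [wb|/eqP wb] := eqVneq (weight p b) d; last first.
    by have [_ ->] := hin_const b t t hz => //; apply/eqP.
  have [_ z0] := hz b; apply: z0; apply/negP => /eqP db; apply: nb.
  have [b' bE] := nat_tuple_onto p_gt1 wb.
  have bS : b' \in weight_set p M d q by rewrite inE bE db wb !eqxx.
  by exists (enum_rank_in bS b'); rewrite /beta enum_rankK_in.
move=> c /aug0/eqP; rewrite subr_eq0 => /eqP zE; apply/rowP => i.
by rewrite mxE zE Si.
Qed.

End GlobalHasse.

Section TupleCount.
Variables (p d : nat).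
Hypotheses (p_prime : prime p).
Local Notation M := d.
Let p_gt1 : (1 < p)%N. Proof. exact: prime_gt1. Qed.
Local Notation B := {ffun 'I_d -> 'I_d.+1}.

Lemma p_index_entry c : p_index p (tuple_entry p c) = c.
Proof.
have oc : (odd c < p)%N by case: (odd c) => //; exact: ltnW.
rewrite /p_index /tuple_entry (mulnC p) divnMDl ?(ltnW p_gt1) // modnMDl.
by rewrite (divn_small oc) (modn_small oc) addn0 addnC mul2n odd_double_half.
Qed.

Lemma entry_p_index m : (m = 0 %[mod p] \/ m = 1 %[mod p])%N -> tuple_entry p (p_index p m) = m.
Proof.
rewrite mod0n (modn_small p_gt1) => H; rewrite /p_index /tuple_entry mul2n.
have mE := divn_eq m p; case: H => H; rewrite H in mE; rewrite H.
  by rewrite addn0 doubleK odd_double addn0 mulnC [RHS]mE addn0.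
by rewrite addn1 /= uphalf_double odd_double /= mulnC [RHS]mE.
Qed.

(* Sequences without trailing zeros are the coefficient sequences of
   polynomials with natural number coefficients. *)
Definition tuple_poly (b : B) : {poly nat} := \poly_(l < d)
  if insub l is Some i then tuple_entry p (b i) else 0%N.

Lemma coef_tuple_poly b (l : 'I_d) : (tuple_poly b)`_l = tuple_entry p (b l).
Proof. by rewrite coef_poly ltn_ord valK. Qed.

Lemma tuple_poly_inj : injective tuple_poly.
Proof.
move=> b b' E; apply/ffunP => l; apply: val_inj => /=.
by rewrite -(p_index_entry (b l)) -coef_tuple_poly E coef_tuple_poly p_index_entry.
Qed.

Lemma sum_tuple_poly (f : nat -> nat -> nat) b : (forall l, f l 0%N = 0%N) ->
  (\sum_(i < size (tuple_poly b)) f i (nth 0 (tuple_poly b) i) = \sum_(i < d) f i (tuple_entry p (b i)))%N.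
Proof.
move=> f0; have sd : (size (tuple_poly b) <= d)%N by exact: size_poly.
rewrite (big_ord_widen d (fun i => f i (nth 0 (tuple_poly b) i)%N) sd) big_mkcond; apply: eq_bigr => i _.
by rewrite -coef_tuple_poly; case: ltnP => // H; rewrite nth_default ?f0.
Qed.

Lemma tuple_index_poly b : tuple_index p (tuple_poly b) = deg (nat_tuple b).
Proof.
rewrite /tuple_index (big_nth 0%N) big_mkord (@sum_tuple_poly (fun _ => p_index p)); last first.
  by move=> l; rewrite /p_index div0n mod0n.
by apply: eq_bigr => l _; rewrite p_index_entry ffunE.
Qed.

Definition tuples : {set B} := [set b | weight p (nat_tuple b) == d].

Lemma A_setE : A_set p d = [set` [seq polyseq (tuple_poly b) | b in tuples]].
Proof.
apply/seteqP; split=> a /=.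
  move=> [amod asum alast]; pose P := Polynomial alast.
  (* A nonzero last entry at position [i] forces [p ^ i <= d < p ^ d], so [d] positions are
     enough. *)
  have ad : (size a <= d)%N.
    case: (posnP (size a)) => [->//|a0].
    rewrite -(prednK a0) -(ltn_exp2l _ _ p_gt1) (leq_ltn_trans _ (ltn_expl d p_gt1)) //.
    rewrite -[X in (_ <= X)%N]asum; have lt : ((size a).-1 < size a)%N by rewrite prednK.
    rewrite (bigD1 (Ordinal lt)) //= (leq_trans _ (leq_addr _ _)) // leq_pmull // lt0n.
    by rewrite (set_nth_default 1%N) // nth_last.
  have aP (l : nat) : tuple_entry p (p_index p (nth 0%N a l)) = nth 0%N a l.
    have [la|la] := ltnP l (size a); first by apply/entry_p_index/amod; exact: mem_nth.
    by rewrite nth_default // /p_index div0n mod0n /tuple_entry /= muln0.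
  pose b0 : {ffun 'I_d -> nat} := [ffun l : 'I_d => p_index p (nth 0%N a l)].
  have wb : weight p b0 = d.
    rewrite -[RHS]asum (big_ord_widen d (fun i => (nth 0%N a i * p ^ i)%N) ad) [RHS]big_mkcond.
    apply: eq_bigr => l _; rewrite ffunE aP mulnC.
    by case: ltnP => // H; rewrite nth_default.
  have [b bE] := nat_tuple_onto p_gt1 wb.
  apply/mapP; exists b; first by rewrite mem_enum inE bE wb.
  rewrite -[a]/(polyseq P); congr polyseq; apply/polyP => i; rewrite coef_poly.
  case: ltnP => [il|di]; last by rewrite nth_default // (leq_trans ad).
  rewrite insubT /=; have := congr1 (fun b : {ffun _ -> nat} => b (Ordinal il)) bE.
  by rewrite !ffunE => ->; rewrite aP.
move=> /mapP[b]; rewrite mem_enum inE => /eqP wb ->; split.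
- move=> m /(nthP 0%N)[i ip <-]; have id_ : (i < d)%N by exact: leq_trans ip (size_poly _ _).
  have := coef_tuple_poly b (Ordinal id_) => /= ->.
  rewrite /tuple_entry mulnC !modnMDl; case: (odd _); [by right|by left].
- rewrite (@sum_tuple_poly (fun i m => (m * p ^ i)%N)) // -[RHS]wb.
  by apply: eq_bigr => l _; rewrite ffunE mulnC.
- exact: (valP (tuple_poly b)).
Qed.

Lemma tuple_count j : #|weight_set p d d j| =
  (\sum_(a \in A_set p d) ('X^(tuple_index p a) : {poly nat}))`_j.
Proof.
rewrite A_setE -fsbig_seq; last first.
  by rewrite map_inj_uniq ?enum_uniq // => b b' /val_inj/tuple_poly_inj.
rewrite big_map coef_sum big_enum /= -sum1_card big_mkcond [RHS]big_mkcond /=.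
apply: eq_bigr => b _; rewrite !inE tuple_index_poly coefXn eq_sym.
by case: eqP => _; case: eqP.
Qed.

End TupleCount.

(** * Comparison of the two resolutions *)

Section Comparison.
Variables (k : closedFieldType) (p n d : nat).
Hypothesis hp : p \in [pchar k].
Hypotheses (d_gt0 : (0 < d)%N) (d_lt : (d < n)%N) (n_gt1 : (1 < n)%N).
Local Notation D := (('I_n -> k) * ('I_n -> k))%type.
Local Notation B := {ffun 'I_d -> nat}.
Local Notation J := 'I_n.
Local Notation lambda := [:: - d%:Z; d%:Z].
Local Notation lam := (nth 0 lambda).
Local Notation X := (flag k n).
Local Notation L := (line_bundle k n lambda).
Local Notation W0 := (whole X).
Local Notation W := (fun j : J => cell k [::] [:: j]).
Local Notation inside := (inside (fun=> True) (@nonzero k n)).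
Implicit Types (F : B * D -> k^o) (b : B) (t : D) (s : seq J) (g : 'M[k]_n) (f : 'M[k]_n -> k^o).

Let p_prime : prime p. Proof. exact: pcharf_prime hp. Qed.
Let p_gt1 : (1 < p)%N. Proof. exact: prime_gt1. Qed.
Let r0 : 'I_n := Ordinal (ltnW n_gt1).
Let r1 : 'I_n := Ordinal n_gt1.

Definition rows g : D := (Yof g 0, Yof g 1).

Lemma lambda_ge0 r : (0 < r)%N -> 0 <= lam r.
Proof. by case: r => [|[|r]] // _; rewrite /= nth_nil. Qed.

Lemma lambda_eq0 r : (1 < r)%N -> lam r = 0.
Proof. by case: r => [|[|r]] // _; rewrite /= nth_nil. Qed.

Lemma over_locus s g : over (meets W0 W s) g <-> g \in unitmx /\ inside s (rows g).
Proof.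
rewrite over_meets; split=> [[og H]|[ug [_ H]]].
  split; first exact: over_unit og.
  split=> // j /H; rewrite over_cell; last by left; exact: ltnW.
  by case=> _ _ /=; rewrite andbT.
split; first by have [V Vg] := flag_of_frame ug; exists V.
move=> j js; rewrite over_cell; last by left; exact: ltnW.
by split=> //=; rewrite andbT; exact: H.
Qed.

Definition row_ss (i : J) s : seq (J * seq J) := [:: (i, s)].

Lemma meets_row i s : meets W0 W (i :: s) = cell k (row_ss i s) [::].
Proof.
apply: opens_over_eq => g; rewrite over_locus over_cell; last by right; split=> //; exact: ltnW.
split=> [[ug [_ H]]|[ug /= + _]].
  split=> //=; rewrite andbT; apply/andP; split; first by apply: (H i); rewrite mem_head.
  by apply/allP => j js; apply: (H j); rewrite inE js orbT.
rewrite andbT => /andP[i0 /allP H]; split=> //; split=> // j.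
by rewrite inE => /predU1P[->//|/H].
Qed.

Lemma valid_row i s : valid (row_ss i s).
Proof. by case. Qed.

Lemma tower_row i s : tower_ok k lambda (row_ss i s).
Proof.
apply: tower; [exact: lambda_ge0|exact: lambda_eq0|by rewrite /= ltnW|exact: valid_row].
Qed.

Lemma locus_cover (V : X) : oset W0 V -> exists j, oset (W j) V.
Proof.
move=> _; have [g Vg] := frame_of_flag V; have ug : g \in unitmx by case: Vg.
have [//|//|j _ j0] := @entries_row_neq0 k n [::] (ltnW n_gt1) g.
exists j; apply/oset_over; exists g => //; rewrite over_cell; last by left; exact: ltnW.
by split=> //=; rewrite andbT.
Qed.

Lemma locus_acyclic s : s <> [::] -> acyclic L (meets W0 W s).
Proof. by case: s => // i s _; rewrite meets_row; have [] := tower_row i s. Qed.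

Definition zero_tuple : B := [ffun=> 0%N].
Local Notation b0 := zero_tuple.

Lemma deg_eq0 b : deg b = 0%N -> b = b0.
Proof.
move=> /eqP; rewrite sum_nat_eq0 => /forallP H; apply/ffunP => l.
by rewrite ffunE; apply/eqP; have /implyP := H l; exact.
Qed.

Lemma deg_zero : deg b0 = 0%N.
Proof. by rewrite /deg big1 // => l _; rewrite ffunE. Qed.

Lemma weight_zero : weight p b0 = 0%N.
Proof. by rewrite /weight big1 // => l _; rewrite ffunE /tuple_entry /= muln0 addn0 muln0. Qed.

Definition hcycle s F : Prop := hin p d 0 s F /\ hdiff p F = 0.

Lemma hcycle_laz s F : hcycle s F -> laz s (- d%:Z) d%:Z (slice F b0).
Proof. by move=> [hF _]; have [] := hF b0; rewrite weight_zero add0r subr0. Qed.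

Lemma hcycle_off s F b t : hcycle s F -> b <> b0 -> F (b, t) = 0.
Proof.
move=> [hF _] nb; have [_ H] := hF b; apply: H; apply/eqP => E; exact/nb/deg_eq0.
Qed.

(** The component of the differential of [F] at the [l]-th unit tuple is the Hasse derivative of
    order [p ^ l]; when all of them vanish the Taylor polynomial is constant. *)
Lemma hcycle_invariant s F t c : hcycle s F -> F (b0, shift c t) = F (b0, t).
Proof.
move=> cF; have lF := hcycle_laz cF; have pF := laz_polynomial lF.
have [hF dF] := cF.
suff [a E] : exists a, taylor (slice F b0) t = a%:P.
  have H u : F (b0, shift u t) = a by have := taylorP t pF u; rewrite E hornerC.
  by rewrite H -(H 0) shift0.
exists ((taylor (slice F b0) t)`_0).
(* The degree in [c] is at most [d < p ^ d], so the [d] orders [p ^ l] with [l < d] detect every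
   nonconstant term. *)
apply: (lower_kernel hp (M := d)).
  by apply: laz_size lF; rewrite ltz_nat ltn_expl.
move=> l ld; pose i := Ordinal ld.
have H0 : slice (hdiff p F) (up i b0) = fun=> 0 by rewrite dF.
have H u : hasse (1 * p ^ l) (slice F b0) u = 0.
  have := congr1 (fun h : D -> k => h u) H0; rewrite /slice /hdiff /=.
  rewrite (bigD1 i) //= big1 ?addr0; last first.
    by move=> l' li; rewrite up_neq // ffunE.
  rewrite {1}/up ffunE eqxx addn1 dn_up /= => /eqP; rewrite mulf_eq0 => /orP[|/eqP].
    by rewrite /sg expf_eq0 oppr_eq0 oner_eq0 andbF.
  by rewrite [b0 i]ffunE /stride /=.
have := taylor_hasse t (1 * p ^ l) pF; rewrite /lower => <-.
by rewrite (_ : hasse _ _ = fun=> 0) ?taylor0 //; apply/funext.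
Qed.

Definition compare s f F : Prop := hcycle s F /\
  forall g, f g = if g \in unitmx then F (b0, rows g) else 0.

Lemma rows_tri a g g' : tri a (Yof g) (Yof g') -> exists c,
  rows g' = ((fun j => a 0%N * Yof g 0 j), (fun j => a 1%N * Yof g 1 j + c * Yof g 0 j)).
Proof.
move=> T; have [c cE] := T 1%N n_gt1; exists (c 0%N); congr pair; apply/funext => j.
  by have [c' ->] := T 0%N (ltnW n_gt1); rewrite big_geq ?addr0.
by rewrite cE big_nat1.
Qed.

Lemma lspan_scale s (a a' : k) F t : hcycle s F -> inside s t -> a != 0 -> a' != 0 ->
  F (b0, ((fun j => a * t.1 j), (fun j => a' * t.2 j))) = a ^ (- d%:Z) * a' ^ d%:Z * F (b0, t).
Proof.
move=> cF it a0 a'0; have [[l El FE] _] := hcycle_laz cF.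
pose t' : D := ((fun j => a * t.1 j), (fun j => a' * t.2 j)); rewrite -/t'.
have it' : inside s t'.
  by split=> // j js; have [_ H] := it; rewrite /nonzero /= mulf_neq0 //; exact: H.
have FE1 := FE t it; have FE2 := FE t' it'; rewrite /slice in FE1 FE2; rewrite FE1 FE2.
rewrite /lsum mulr_sumr [LHS]big_seq [RHS]big_seq; apply: eq_bigr => x /El[e0 e1 ea eb].
rewrite mulrCA; congr (_ * _).
rewrite /monomial !big_sumType /= mulrACA -ea -eb.
have powsum (c : k) (h : 'I_n -> int) : c != 0 -> c ^ (\sum_j h j) = \prod_j c ^ h j.
  move=> c0; elim: (index_enum _) => [|j r IH]; first by rewrite !big_nil expr0z.
  by rewrite !big_cons expfzDr // IH.
rewrite !powsum //; congr (_ * _); rewrite -big_split; apply: eq_bigr => j _; exact: expfzMl.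
Qed.

Lemma compare_section s f F : s <> [::] -> hcycle s F ->
  (forall g, f g = if g \in unitmx then F (b0, rows g) else 0) ->
  is_section lambda (meets W0 W s) f.
Proof.
move=> s0 cF fE; have [[l El FE] F0] := hcycle_laz cF.
apply: section_of => [g g' a og og' a0 T|g og|g].
- have [ug ig] := (over_locus s g).1 og; have [ug' ig'] := (over_locus s g').1 og'.
  rewrite !fE ug ug'; have [c rE] := rows_tri T.
  have a00 := a0 0%N (ltnW n_gt1); have a10 := a0 1%N n_gt1.
  pose t1 : D := ((fun j => a 0%N * (rows g).1 j), (fun j => a 1%N * (rows g).2 j)).
  have -> : rows g' = shift (c / a 0%N) t1.
    by rewrite rE; congr pair; apply/funext => j /=; rewrite mulrA divfK.
  rewrite (hcycle_invariant _ _ cF) (lspan_scale cF ig) //; congr (_ * _).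
  rewrite (bigD1 r0) //= (bigD1 r1) //= big1 ?mulr1 // => i /andP[i0 i1].
  rewrite lambda_eq0 ?expr0z //.
  by case: i i0 i1 => [[|[|i]]].
- have [ug [_ ig]] := (over_locus s g).1 og.
  apply: (@rational_ext _ _ _ _ (fun x => lsum l (xy (rows x)))).
    move=> x /over_locus[ux ix]; rewrite fE ux; exact/esym/FE.
  apply: (rational_sub (O := fun x => x \in unitmx)); first by move=> x /over_unit.
  rewrite /lsum; under [X in rational_at _ _ X]eq_fun do rewrite big_seq.
  apply: rational_sum => x /El[e0 e1 _ _].
  apply: rationalM; first exact: rational_cst.
  apply: rational_prod => -[j|j] _; apply: rational_exprz => //; try exact: rational_Yof.
    by have [js|js] := boolP (j \in s); [rewrite (ig j js) orbT|rewrite e0].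
  by rewrite e1.
- rewrite over_locus fE => ng; case: ifP => // ug; apply: F0 => ig; exact: ng.
Qed.

(** [F] is controlled only at pairs of rows of frames, that is at independent [x] and [y]. By
    invariance [y] may be moved to [y_i = 0]: either it is then independent of [x], or it is 0,
    where [F] vanishes because its degree [d] in [y] is positive. *)
Lemma compare_faithful s f F : s <> [::] -> compare s f F -> f = 0 -> F = 0.
Proof.
case: s => // i s _ [cF fE] f0; apply/funext => -[b t].
have [->|/eqP nb] := eqVneq b b0; last exact: (hcycle_off t cF nb).
have [[l El FE] F0] := hcycle_laz cF.
have [it|nt] := pselect (inside (i :: s) t); last exact: F0.
have ti : t.1 i != 0 by have [_ H] := it; apply: H; rewrite mem_head.
rewrite -(hcycle_invariant t (- tau i t) cF) -/(bar i t).
have zi : (bar i t).2 i = 0.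
  by have := tau_bar ti; rewrite /tau => /eqP; rewrite mulf_eq0 invr_eq0 (negPf ti) orbF => /eqP.
have [[j zj]|nz] := pselect (exists j, (bar i t).2 j != 0); last first.
  have z0 j : (bar i t).2 j = 0 by apply/eqP/negPn/negP => zj; apply: nz; exists j.
  have := FE (bar i t) it; rewrite /slice => ->.
  rewrite /lsum big_seq big1 // => x /El[_ e1 _ eb].
  have [j ej] : exists j, x.2 (inr j) != 0.
    apply: contrapT => nj; have : \sum_j x.2 (inr j) = 0.
      by rewrite big1 // => j _; apply/eqP/negPn/negP => ej; apply: nj; exists j.
    by rewrite eb => /eqP; rewrite eqz_nat; case: (d) d_gt0.
  rewrite /monomial (bigD1 (inr j)) // [xy _ (inr j)](z0 j : xy (bar i t) (inr j) = 0).
  by rewrite exp0rz (negPf ej) /= mul0r mulr0.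
have ij : i != j by apply: contraNneq zj => <-; rewrite zi.
(* With [x_i] and [y_j] as first pivots, [x] and [y] are completed by unit vectors to the rows of a
   frame. *)
pose piv := [:: i, j & [seq c <- enum 'I_n | c \notin [:: i; j]]].
have upiv : uniq piv.
  rewrite /piv !cons_uniq; apply/and3P; split; last by rewrite filter_uniq ?enum_uniq.
    by rewrite inE negb_or ij mem_filter !inE eqxx.
  by rewrite mem_filter !inE eqxx orbT.
have spiv : size piv = n.
  have /perm_size : perm_eq piv (enum 'I_n); last by rewrite size_enum_ord.
  apply: uniq_perm => // [|c]; first exact: enum_uniq.
  by rewrite !inE mem_filter mem_enum !inE; case: (c == i) => //=; case: (c == j).
pose A : 'M[k]_n := \matrix_(r, c) if r == r0 then t.1 c else if r == r1 then (bar i t).2 c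
  else (c == pivot_col piv r)%:R.
have pv0 : pivot_col piv r0 = i by [].
have pv1 : pivot_col piv r1 = j by [].
have [] := pivoted_frame (piv := piv) (A := A).
- move=> q; rewrite mxE; have [->|_] := eqVneq q r0; first by rewrite pv0.
  by have [->|_] := eqVneq q r1; rewrite ?pv1 // eqxx oner_neq0.
- move=> q a qa; rewrite mxE; have [a0|na0] := eqVneq a r0; first by rewrite a0 in qa.
  have [a1|na1] := eqVneq a r1.
    have -> : q = r0 by apply: val_inj; move: qa; rewrite a1 /=; case: (val q).
    by rewrite pv0 zi.
  case: eqP => // E; have : (q == a :> nat) by rewrite -(nth_uniq i _ _ upiv) ?spiv // !pvE // E.
  by move=> /eqP qE; rewrite qE ltnn in qa.
set g := frame_of _ => ug Yg.
have rE : rows g = bar i t.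
  rewrite /rows Yg; congr pair; apply/funext => c.
    by rewrite -[0%N]/(val r0) rowfE mxE eqxx.
  by rewrite -[1%N]/(val r1) rowfE mxE eqxx.
by have := fE g; rewrite ug rE f0 => <-.
Qed.

(** A section is a Laurent polynomial in the entries of the first two reduced rows. The second
    reduced row is the [y] part of [bar i], so composition with [bar i] gives an invariant function
    of [x] and [y]. *)
Lemma compare_onto i s f : is_section lambda (meets W0 W (i :: s)) f ->
  exists F, compare (i :: s) f F.
Proof.
move=> sf; have si : i \in i :: s by rewrite mem_head.
have [_ /(_ f)] := tower_row i s; rewrite -meets_row => /(_ sf)[l El fE].
pose flat (e : {ffun J * J -> int}) : {ffun J + J -> int} :=
  [ffun v => match v with inl j => e (r0, j) | inr j => e (r1, j) end].
pose l' := [seq (x.1, flat x.2) | x <- l].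
have El' x : x \in l' -> bideg (i :: s) (- d%:Z) d%:Z x.2.
  move=> /mapP[y /El[e0 e1 e2] ->]; split=> /=.
  - by move=> j js; rewrite ffunE; apply: e1.
  - by move=> j; rewrite ffunE; apply: e1.
  - by apply: etrans (e2 r0); apply: eq_bigr => j _; rewrite ffunE.
  - by apply: etrans (e2 r1); apply: eq_bigr => j _; rewrite ffunE.
pose G t : k := if pselect (inside (i :: s) t) is left _ then lsum l' (xy t) else 0.
have lG : laz (i :: s) (- d%:Z) d%:Z G.
  split; last by move=> t nt; rewrite /G; case: pselect.
  by exists l' => // t it; rewrite /G; case: pselect.
have lGb := laz_bar si lG.
pose F : B * D -> k^o := fun bt => if bt.1 == b0 then G (bar i bt.2) else 0.
have sF : slice F b0 = (fun t => G (bar i t)) by rewrite /slice /F /= eqxx.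
have sFn b : b != b0 -> slice F b = fun=> 0 by rewrite /slice /F /= => /negPf ->.
exists F; split; last first.
  move=> g; case: ifP => ug; last first.
    have [_ _ ->] := sf => // /over_unit; by rewrite ug.
  rewrite /F /= eqxx /G; case: pselect => [ib|nb]; last first.
    have [_ _ ->] := sf => // /over_locus[_ ig]; exact: nb.
  have ig : inside (i :: s) (rows g) by exact: ib.
  have og : over (meets W0 W (i :: s)) g by apply/over_locus.
  rewrite fE // /lsum big_map [LHS]big_seq [RHS]big_seq; apply: eq_bigr => x /El[e0 e1 _] /=.
  congr (_ * _); rewrite /monomial big_sumType /=.
  have E (w : J * J -> k) : \prod_v w v ^ x.2 v =
      \prod_(j < n) w (r0, j) ^ x.2 (r0, j) * \prod_(j < n) w (r1, j) ^ x.2 (r1, j).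
    transitivity (\prod_(r < n) \prod_(j < n) w (r, j) ^ x.2 (r, j)).
      by rewrite pair_bigA; apply: eq_bigr => -[].
    rewrite (bigD1 r0) //=; congr (_ * _); rewrite (bigD1 r1) //= [X in _ * X]big1 ?mulr1 // => r /andP[nr0 nr1].
    rewrite big1 // => j _; rewrite e0 ?expr0z //.
    by case: r nr0 nr1 => [[|[|r]]].
  rewrite E.
  congr (_ * _); apply: eq_bigr => j _; rewrite ffunE /entries /reduced /= /elim1 //=.
  by congr (_ ^ _); rewrite /tau /rows /= mulNr.
have hF : hin p d 0 (i :: s) F.
  move=> b; have [->|nb] := eqVneq b b0.
    by rewrite deg_zero weight_zero add0r subr0 sF.
  rewrite (sFn b nb); split; first exact: laz0.
  by move=> _ t; have := sFn b nb; move=> /(congr1 (fun h : D -> k => h t)).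
split=> //; apply/funext => -[b t]; rewrite /hdiff /= big1 // => l1 _; case: ifP => // bl.
have [E|nb] := eqVneq (dn l1 b) b0; last by rewrite (sFn _ nb) /hasse taylor0 coef0 mulr0.
rewrite E sF /hasse (@taylorE _ _ _ t (G (bar i t))%:P) => [|c]; last first.
  (* Where [x_i = 0] the map [bar i] is not invariant, but [G] vanishes there because [i] belongs to
     the tuple. *)
  rewrite hornerC; have [ti|nti] := eqVneq (t.1 i) 0; last by rewrite bar_shift.
  have Gn u : u.1 = t.1 -> G u = 0.
    move=> ut; rewrite /G; case: pselect => // -[_ /(_ i si)].
    by rewrite /nonzero ut ti eqxx.
  by rewrite !Gn.
have /andP[st0 _] := stride_bounds hp (b l1).
rewrite coefC gtn_eqF ?mulr0 // muln_gt0 st0 expn_gt0 (ltnW p_gt1).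
by [].
Qed.

Local Notation K := (section_complex lambda W0 W).
Local Notation H := (hasse_complex d hp d_lt).

Lemma compare_kernel_iso : @kernel_iso k J K H compare.
Proof.
split.
- move=> s a u u' v v' _ [cu uE] [cv vE]; split.
    exact: (@dcycle_lin _ _ H 0 s a u' v' cu cv).
  move=> g; change (a * u g + v g = if g \in unitmx then a * u' (b0, rows g) + v' (b0, rows g) else 0).
  by rewrite uE vE; case: ifP => // _; rewrite mulr0 addr0.
- case=> // i s f _ [sf _]; have [F FP] := compare_onto sf.
  by exists F => //; case: FP.
- move=> s F s0 cF; pose f g : k^o := if g \in unitmx then F (b0, rows g) else 0.
  exists f; last by split.
  by split=> //; apply: (compare_section s0 cF).
- move=> s f F s0 cmp; split=> [|F0]; first exact: compare_faithful cmp.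
  have [_ fE] := cmp; apply/funext => g; rewrite fE F0.
  by case: ifP.
- move=> s1 j s2 f F _ [[hF dF] fE]; split.
    split; first exact: hin_ins.
    by rewrite [LHS]hdiff_ins dF raddf0.
  move=> g; rewrite /= /fcut /= fE.
  have oW : over (W j) g <-> g \in unitmx /\ nonzero j (rows g).
    rewrite over_cell; last by left; exact: ltnW.
    by rewrite /= andbT; split=> [[]|[]].
  case: asboolP => [/oW[ug nj]|no]; first by rewrite ug asboolT.
  by case: ifP => // ug; rewrite asboolF // => nj; apply: no; apply/oW.
Qed.

Lemma flag_cohomology j : cohomology_dim L j #|weight_set p d d j|.
Proof.
apply: (cohomology_dimP (W := W)).
have rowR q := resolution_row_exact (F := L) locus_cover (q := q).
have colR q : column_exact (resolution_complex L W0 W) q.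
  by apply: acyclic_column => s s0; exact: locus_acyclic.
apply/(augmented_dim _ rowR (fun q _ => colR q)).
apply: (cech_transfer (kernel_iso_sym (section_kernel_iso lambda W0 W))).
apply: (cech_transfer (kernel_iso_sym compare_kernel_iso)).
have rowH q : row_exact H q by exact: hasse_row_exact.
have colH q : column_exact H q by exact: hasse_column_exact.
apply/(augmented_dim _ rowH (fun q _ => colH q)).
exact: hasse_dim.
Qed.

End Comparison.

Theorem mainTheorem2 (k : closedFieldType) (p d : nat)
    (hp : p \in [pchar k]) (hd : (2 <= d)%N) :
  exists h : nat -> nat,
    (forall j : nat, stable_cohomology_dim k [:: - d%:Z; d%:Z] j (h j)) /\
    (forall j : nat,
       h j = (\sum_(a \in A_set p d) ('X^(tuple_index p a) : {poly nat}))`_j).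
Proof.
exists (fun j => #|weight_set p d d j|); split=> j.
  (* Stability starts at [n = d + 1], the least [n] for which monomials of degree [-d] cannot have
     poles along all the coordinates. *)
  exists d.+1 => n dn; apply: flag_cohomology => //; first exact: ltnW.
  exact: leq_trans hd (ltnW dn).
by apply: tuple_count; exact: pcharf_prime hp.
Qed.
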